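(* Let $n\ge 7$. There is no complete algebraic solution, with non-elementary monodromy, of the Garnier system of rank $n-3$ (deformations of Fuchsian equations on $\mathbb{P}^1$ with $n$ non-apparent singularities) obtained by Kitaev's method. That is, there is no pair $(E,\phi)$ consisting of a Fuchsian equation $E$ on $\mathbb{P}^1$ with non-elementary monodromy and a ramified covering $\phi:\mathbb{P}^1\to\mathbb{P}^1$ such that $\phi^*E$ has exactly $n$ non-apparent singularities and $\phi$ ramifies over at least $n-3$ points distinct from one another and from the non-apparent singularities of $E$.
   Context: A Fuchsian equation is a second order linear differential equation with rational coefficients all of whose singular points are regular singular; its monodromy is taken projectively. It is non-elementary if its monodromy group is Zariski dense in $\mathrm{PGL}(2,\mathbb{C})$. A singular point is apparent if its local projective monodromy is trivial. Kitaev's method: fix a Fuchsian equation $E$ on $\mathbb{P}^1$ and pull it back by a family $\phi_t$ of ramified coverings of fixed topological type, giving an isomonodromic family $\phi_t^*E$ with algebraic coefficients; the resulting algebraic solution of the Garnier system of rank $N=n-3$ ($n$ = number of non-apparent singularities of $\phi_t^*E$) is complete if the deformation has full dimension, which requires $\phi_t$ to have at least $n-3$ free critical values, i.e. to ramify over at least $n-3$ distinct points that are not non-apparent singularities of $E$. *)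

(* Defs.v *)
From HB Require Import structures.
From mathcomp Require Import all_boot all_order all_algebra.
From mathcomp Require Import complex fraction.
From mathcomp Require mpoly.
Import -(notations) mpoly.
From mathcomp Require Import all_classical all_reals all_analysis.

Set Implicit Arguments.
Unset Strict Implicit.
Unset Printing Implicit Defensive.

Import Order.TTheory GRing.Theory Num.Theory.
Import numFieldNormedType.Exports.

Local Open Scope classical_set_scope.
Local Open Scope ring_scope.
Local Open Scope complex_scope.

(* The complex numbers are R[i] with R the reals. The copy R[i]^o carries     *)
(* the normed topology, so derivable f z 1 and derive1 f for                  *)
(* f : R[i]^o -> R[i]^o are complex differentiability and the complex         *)
(* derivative.                                                                *)

Section RationalFunctions.
Variable R : realType.

Definition ratfun : Type := {fraction {poly R[i]}}.

(* Numerator and denominator in lowest terms. *)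
Definition fnum (f : ratfun) : {poly R[i]} :=
  (repr f).1 %/ gcdp (repr f).1 (repr f).2.
Definition fden (f : ratfun) : {poly R[i]} :=
  (repr f).2 %/ gcdp (repr f).1 (repr f).2.

Definition fconst (c : R[i]) : ratfun := FracField.tofrac c%:P.

(* The value of f at z, meaningful when z is not a pole of f. *)
Definition feval (f : ratfun) (z : R[i]) : R[i] := (fnum f).[z] / (fden f).[z].

Definition fderiv (f : ratfun) : ratfun :=
  FracField.tofrac ((fnum f)^`() * fden f - fnum f * (fden f)^`())
  / FracField.tofrac (fden f ^+ 2).

(* The composite z |-> f (g z), meaningful when g is not constant. *)
Definition fcomp (f g : ratfun) : ratfun :=
  (map_poly fconst (fnum f)).[g] / (map_poly fconst (fden f)).[g].

Definition fdegree (f : ratfun) : nat :=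
  maxn (size (fnum f)).-1 (size (fden f)).-1.

Definition pole_order (f : ratfun) (z : R[i]) : nat := mup z (fden f).

(* The Riemann sphere; None is the point at infinity. *)
Definition P1 : Type := option R[i].

(* Holomorphic maps from the sphere to itself are the rational functions, and *)
(* the ramified coverings are the nonconstant ones.                           *)
Definition ramified_covering (phi : ratfun) : Prop := (0 < fdegree phi)%N.

(* Homogenized in degree fdegree phi, this polynomial defines the divisor     *)
(* phi^*(c) on the sphere.                                                    *)
Definition fiber_poly (phi : ratfun) (c : P1) : {poly R[i]} :=
  if c is Some a then fnum phi - a *: fden phi else fden phi.

(* The multiplicity of x in the divisor phi^*(c): the ramification index of   *)
(* phi at x if phi x = c, and 0 otherwise.                                    *)
Definition fiber_mult (phi : ratfun) (c x : P1) : nat :=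
  if x is Some z then mup z (fiber_poly phi c)
  else (fdegree phi - (size (fiber_poly phi c)).-1)%N.

Definition ramifies_over (phi : ratfun) (c : P1) : Prop :=
  exists x : P1, (1 < fiber_mult phi c x)%N.

End RationalFunctions.

Section Equations.
Variable R : realType.

(* The equation y'' + pcoef y' + qcoef y = 0. *)
Record equation := Equation { pcoef : ratfun R; qcoef : ratfun R }.

(* The equation satisfied by the functions y \o phi for y a solution of E:    *)
(* if w = y \o phi then y' \o phi = w' / phi' and                             *)
(* w'' = phi'' (y' \o phi) + phi' ^ 2 (y'' \o phi).                           *)
Definition pullback (phi : ratfun R) (E : equation) : equation :=
  Equation (fcomp (pcoef E) phi * fderiv phi - fderiv (fderiv phi) / fderiv phi)
           (fcomp (qcoef E) phi * fderiv phi ^+ 2).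

(* E in the coordinate 1/z, so that the point at infinity becomes 0. *)
Definition at_infinity (E : equation) : equation :=
  pullback (FracField.tofrac 'X)^-1 E.

Definition ordinary (E : equation) (z : R[i]) : Prop :=
  pole_order (pcoef E) z = 0%N /\ pole_order (qcoef E) z = 0%N.

(* Fuchs' bounds on the pole orders. *)
Definition regular_at (E : equation) (z : R[i]) : Prop :=
  (pole_order (pcoef E) z <= 1)%N /\ (pole_order (qcoef E) z <= 2)%N.

Definition singular (E : equation) (x : P1 R) : Prop :=
  if x is Some z then ~ ordinary E z else ~ ordinary (at_infinity E) 0.

Definition regular_singular (E : equation) (x : P1 R) : Prop :=
  singular E x /\
  if x is Some z then regular_at E z else regular_at (at_infinity E) 0.

Definition fuchsian (E : equation) : Prop :=
  forall x, singular E x -> regular_singular E x.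

(* Below, functions R[i]^o -> R[i]^o stand for their germs at a point. *)
Definition local_solution (E : equation) (y : R[i]^o -> R[i]^o) (z : R[i]^o) :=
  \forall w \near z,
    [/\ derivable y w 1, derivable (derive1 y) w 1 &
        derive1 (derive1 y) w + feval (pcoef E) w * derive1 y w
        + feval (qcoef E) w * y w = 0].

Definition solution_basis (E : equation) (b : R[i]^o)
    (f : 'I_2 -> R[i]^o -> R[i]^o) : Prop :=
  (forall i, local_solution E (f i) b) /\
  (forall a : 'I_2 -> R[i],
     (\forall w \near b, \sum_j a j * f j w = 0) -> forall j, a j = 0).

(* Y t is a germ of solution at gam t, depending continuously (that is,       *)
(* locally constantly) on t in [0, 1].                                        *)
Definition continuation (E : equation) (gam : R -> R[i]^o)
    (Y : R -> R[i]^o -> R[i]^o) : Prop :=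
  forall t, t \in `[0, 1] ->
    local_solution E (Y t) (gam t) /\
    \forall s \near t, s \in `[0, 1] -> \forall w \near gam s, Y s w = Y t w.

Definition loop (E : equation) (gam : R -> R[i]^o) : Prop :=
  [/\ {within `[0, 1], continuous gam}, gam 0 = gam 1 &
      forall t, t \in `[0, 1] -> ordinary E (gam t)].

(* Continuing the germs f at gam 0 along the loop gam yields M f. *)
Definition monodromy_along (E : equation) (gam : R -> R[i]^o)
    (f : 'I_2 -> R[i]^o -> R[i]^o) (M : 'M[R[i]]_2) : Prop :=
  loop E gam /\
  exists Y : 'I_2 -> R -> R[i]^o -> R[i]^o, forall i,
    [/\ continuation E gam (Y i),
        \forall w \near gam 0, Y i 0 w = f i w &
        \forall w \near gam 1, Y i 1 w = \sum_j M i j * f j w].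

(* The monodromy group in GL(2, C) relative to a basis f of the solutions at  *)
(* the base point b.                                                          *)
Definition monodromy_group (E : equation) (b : R[i]^o)
    (f : 'I_2 -> R[i]^o -> R[i]^o) : set 'M[R[i]]_2 :=
  [set M | exists gam, gam 0 = b /\ monodromy_along E gam f M].

(* For G included in GL(2, C): density of its image in PGL(2, C), which is    *)
(* the open subset det <> 0 of the projective space of 2 x 2 matrices, whose  *)
(* closed subsets are cut out by homogeneous polynomials in the entries.      *)
Definition zariski_dense_PGL2 (G : set 'M[R[i]]_2) : Prop :=
  forall (d : nat) (P : mpoly.mpoly (2 * 2) R[i]),
    P \is @mpoly.ishomog1 (2 * 2) R[i] d mpoly.mdeg ->
    (forall M, G M -> mpoly.meval (fun k => mxvec M 0 k) P = 0) ->
    forall M, M \in unitmx -> mpoly.meval (fun k => mxvec M 0 k) P = 0.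

(* Changing the base point or the basis conjugates the group, so that their   *)
(* choice does not matter.                                                    *)
Definition nonelementary (E : equation) : Prop :=
  exists (b : R[i]^o) (f : 'I_2 -> R[i]^o -> R[i]^o),
    [/\ ordinary E b, solution_basis E b f &
        zariski_dense_PGL2 (monodromy_group E b f)].

Definition circle (z : R[i]) (r : R) (t : R) : R[i]^o :=
  z + (r * cos (2 * pi * t) +i* (r * sin (2 * pi * t))).

(* The monodromy along all small circles around z is trivial in PGL(2, C). *)
Definition trivial_local_monodromy (E : equation) (z : R[i]) : Prop :=
  \forall r \near (0 : R)^'+,
    forall (f : 'I_2 -> R[i]^o -> R[i]^o) (M : 'M[R[i]]_2),
      solution_basis E (circle z r 0) f ->
      monodromy_along E (circle z r) f M -> is_scalar_mx M.

Definition apparent (E : equation) (x : P1 R) : Prop :=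
  singular E x /\
  if x is Some z then trivial_local_monodromy E z
  else trivial_local_monodromy (at_infinity E) 0.

Definition nonapparent_singularities (E : equation) : set (P1 R) :=
  [set x | singular E x /\ ~ apparent E x].

End Equations.

(* Main.v *)
(* Cut the plane into parallel strips by lines through the finite singular points of E. A       *)
(* fundamental matrix continues from each strip to the next both above and below the singular    *)
(* point s_k between them; the comparison of the two continuations is a matrix T_k. The T_k are  *)
(* local monodromies at the s_k, they generate the monodromy group up to conjugation, and their  *)
(* ordered product is inverse to a local monodromy at infinity. The local monodromy of phi^*E at *)
(* a point of ramification index e over s is the e-th power of the one of E at s.                *)
(*                                                                                               *)
(* Let S be the set of the m non-apparent singularities of E, p_s the projective order of the    *)
(* local monodromy at s in S, and d the degree of phi. A point over s is apparent for phi^*E only *)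
(* if p_s divides its ramification index, so the numbers k_s of apparent and n_s of non-apparent *)
(* points over s satisfy n_s + k_s p_s <= d, with sum n_s = n. The Riemann-Hurwitz inequality    *)
(* for S together with n - 3 further branch points reads (m - 2) d <= 1 + sum k_s. For n >= 7    *)
(* this is impossible if m >= 4, and if m = 3 unless the triple of the p_s is spherical.         *)
(*                                                                                               *)
(* If m <= 2, or if m = 3 and the triple is spherical, the monodromy group centralizes a         *)
(* non-scalar matrix, or is of dihedral type, or is a quotient of a finite von Dyck group modulo *)
(* scalars. In each case it is contained in finitely many hyperplanes of the space of matrices,  *)
(* hence it is not Zariski dense.                                                                *)

Require Import Defs.
From HB Require Import structures.
From mathcomp Require Import all_boot all_order all_algebra.
From mathcomp Require Import complex fraction.
From mathcomp Require mpoly.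
Import -(notations) mpoly.
From mathcomp Require Import all_classical all_reals all_analysis.
From mathcomp Require Import ring lra zify.

Set Implicit Arguments.
Unset Strict Implicit.
Unset Printing Implicit Defensive.

Import Order.TTheory GRing.Theory Num.Theory.
Import numFieldNormedType.Exports.

Local Open Scope classical_set_scope.
Local Open Scope ring_scope.
Local Open Scope complex_scope.

(** The obstruction is a count of points in the fibres over the m non-apparent singularities of [E],
    together with a description of the monodromy groups for which the count alone gives no
    contradiction.

    If [phi] has ramification index e at x over s, a small circle around x goes to a curve winding e
    times around s. So the local monodromy of the pullback at x is, up to conjugation, A^e, with A
    that of [E] at s ([trivial_monodromy_pullback], [nonapparent_pullback]), and an apparent point
    over s has index at least p_s, the projective order of A. Every fibre has total multiplicity d,
    the degree of [phi], and the Wronskian of numerator and denominator bounds the total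
    ramification by 2d - 2 ([riemann_hurwitz]). If K counts the apparent points over the m
    singularities, the n - 3 further branch values leave md <= 2d + 1 + K. As all p_s are at least
    2, m >= 4 forces n <= 2 ([four_points_bound]); for m = 3 and a non-spherical triple of orders, n
    <= 6 ([three_points_bound]). [pullback_bound] assembles this.

    The remaining cases contradict density of the monodromy ([nonelementary_points]). By
    [global_monodromy] the monodromy group lies, up to conjugation, in the group generated by local
    monodromies T_k whose ordered product is inverse to a local monodromy at infinity. For m <= 2
    this group centralizes a non-scalar matrix ([few_covered]); for m = 3 and spherical orders it is
    of dihedral type or, modulo scalars, a quotient of a von Dyck group (2, 3, n) with n = 3, 4, 5,
    which rewriting shows to be finite ([spherical_covered]). Each such group lies in finitely many
    hyperplanes tr(K M) = 0, and the product of these linear forms violates density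
    ([covered_nondense]).

    The analysis rests on existence and uniqueness of solutions on convex regions: [fsol_exists], by
    power series and continuation along segments, and [fsol_uniq], by a Gronwall estimate. *)

Local Notation Re := (@complex.Re _).
Local Notation Im := (@complex.Im _).

(** * Real-valued modulus and complex differentiability in epsilon-delta form *)

Section Modulus.
Variable R : realType.
Local Notation C := R[i].
Implicit Types z w : C.

(** The norm of [R[i]] has its values in [R[i]]; a real-valued modulus lets the estimates take place
    in the ordered field [R]. *)
Definition nm (z : C) : R := Normc.normc z.

Lemma nmE z : `|z| = (nm z)%:C.
Proof. by []. Qed.

Lemma nm_ge0 z : 0 <= nm z.
Proof. by case: z => a b; apply: sqrtr_ge0. Qed.

Lemma nmM z w : nm (z * w) = nm z * nm w.
Proof. exact: Normc.normcM. Qed.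

Lemma nmV z : nm z^-1 = (nm z)^-1.
Proof. exact: Normc.normcV. Qed.

Lemma nmN z : nm (- z) = nm z.
Proof. by apply: complexI; rewrite -!nmE normrN. Qed.

Lemma nmB z w : nm (z - w) = nm (w - z).
Proof. by rewrite -nmN opprB. Qed.

Lemma nmD z w : nm (z + w) <= nm z + nm w.
Proof. by rewrite -lecR rmorphD /= -!nmE ler_normD. Qed.

Lemma nm0 : nm 0 = 0.
Proof. exact: Normc.normc0. Qed.

Lemma nm1 : nm 1 = 1.
Proof. exact: Normc.normc1. Qed.

Lemma nm_eq0 z : (nm z == 0) = (z == 0).
Proof. by apply/eqP/eqP => [/Normc.eq0_normc|->] //; exact: nm0. Qed.

Lemma nm_gt0 z : (0 < nm z) = (z != 0).
Proof. by rewrite lt_neqAle nm_ge0 andbT eq_sym nm_eq0. Qed.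

Lemma nmX z n : nm (z ^+ n) = nm z ^+ n.
Proof. by elim: n => [|n ih]; rewrite ?expr0 ?nm1 // !exprS nmM ih. Qed.

Lemma nm_sqr z : nm z ^+ 2 = Re z ^+ 2 + Im z ^+ 2.
Proof. by case: z => a b; rewrite /nm /= sqr_sqrtr // addr_ge0 ?sqr_ge0. Qed.

Lemma nm_real (x : R) : nm x%:C = `|x|.
Proof. by rewrite /nm /= expr0n /= addr0 sqrtr_sqr. Qed.

Lemma nm_i : nm 'i = 1.
Proof. by rewrite /nm /= expr0n /= add0r expr1n sqrtr1. Qed.

Lemma nm_Re z : `|Re z| <= nm z.
Proof. by rewrite -(ler_pXn2r (n := 2)) ?nnegrE ?nm_ge0 // real_normK ?num_real // nm_sqr lerDl sqr_ge0. Qed.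

Lemma nm_Im z : `|Im z| <= nm z.
Proof. by rewrite -(ler_pXn2r (n := 2)) ?nnegrE ?nm_ge0 // real_normK ?num_real // nm_sqr lerDr sqr_ge0. Qed.

Lemma nm_le z : nm z <= `|Re z| + `|Im z|.
Proof.
rewrite {1}[z]complexE; apply: (le_trans (nmD _ _)).
by rewrite nmM nm_i mul1r !nm_real.
Qed.

Lemma nm_sum (I : Type) (r : seq I) (P : pred I) (F : I -> C) :
  nm (\sum_(i <- r | P i) F i) <= \sum_(i <- r | P i) nm (F i).
Proof.
elim/big_ind2 : _ => [|x1 x2 y1 y2 h1 h2|i _] //; first by rewrite nm0.
by apply: (le_trans (nmD _ _)); exact: lerD.
Qed.

Lemma nm_nat n : nm n%:R = n%:R :> R.
Proof.
by rewrite -(rmorph_nat (real_complex R)) nm_real ger0_norm ?ler0n.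
Qed.

Lemma nm_sub_ge z w : nm z - nm w <= nm (z - w).
Proof. by rewrite lerBlDr; rewrite -{1}[z](subrK w); exact: nmD. Qed.

Lemma ReD z w : Re (z + w) = Re z + Re w. Proof. by case: z w => [a b] [c d]. Qed.
Lemma ImD z w : Im (z + w) = Im z + Im w. Proof. by case: z w => [a b] [c d]. Qed.
Lemma ReN z : Re (- z) = - Re z. Proof. by case: z. Qed.
Lemma ImN z : Im (- z) = - Im z. Proof. by case: z. Qed.
Lemma ReB z w : Re (z - w) = Re z - Re w. Proof. by case: z w => [a b] [c d]. Qed.
Lemma ImB z w : Im (z - w) = Im z - Im w. Proof. by case: z w => [a b] [c d]. Qed.
Lemma ReM z w : Re (z * w) = Re z * Re w - Im z * Im w. Proof. by case: z w => [a b] [c d]. Qed.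
Lemma ImM z w : Im (z * w) = Re z * Im w + Im z * Re w. Proof. by case: z w => [a b] [c d] /=. Qed.

Lemma complex_ext z w : Re z = Re w -> Im z = Im w -> z = w.
Proof. by case: z w => [a b] [c d] /= -> ->. Qed.

Lemma nearC (z : R[i]^o) (P : C -> Prop) : (\forall w \near z, P w) <->
  exists2 r : R, 0 < r & forall w, nm (w - z) < r -> P w.
Proof.
split.
  (* A positive element of [R[i]] has imaginary part 0, which turns the complex radius into a real
     one. *)
  move=> /nbhs_ballP [[a b] /=]; rewrite ltcE /= => /andP[/eqP -> a0] h.
  exists a => // w hw; apply: h; rewrite /ball /= distrC nmE.
  by rewrite -[a +i* 0]/(a%:C) ltcR.
move=> [r r0 h]; apply/nbhs_ballP; exists (r%:C) => /=; first by rewrite ltcR.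
by move=> w; rewrite /ball /= distrC nmE ltcR; exact: h.
Qed.

Lemma nearR (x : R) (P : R -> Prop) : (\forall t \near x, P t) <->
  exists2 r : R, 0 < r & forall t, `|t - x| < r -> P t.
Proof.
split.
  by move=> /nbhs_ballP [r /= r0 h]; exists r => // t ht; apply: h; rewrite /ball /= distrC.
by move=> [r r0 h]; apply/nbhs_ballP; exists r => //= t; rewrite /ball /= distrC; exact: h.
Qed.

(** Division-free form of differentiability: [h] may be 0, and estimates combine without limits of
    quotients. *)
Definition cder (f : C -> C) (w l : C) : Prop :=
  forall e : R, 0 < e -> exists2 d : R, 0 < d &
    forall h, nm h < d -> nm (f (w + h) - f w - h * l) <= e * nm h.

Lemma cderP (f : R[i]^o -> R[i]^o) (w l : C) :
  cder f w l <-> derivable f w 1 /\ derive1 f w = l.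
Proof.
have key : cder f w l <-> ((fun h => h^-1 *: (f (h + w) - f w)) @ (0 : R[i]^o)^' --> (l : R[i]^o)).
  split.
    move=> hf; apply/cvgrPdist_le => -[e e'] /=; rewrite ltcE /= => /andP[/eqP -> e0].
    have [d d0 hd] := hf e e0.
    apply/nearC; exists d => // h; rewrite subr0 => hh hN0.
    rewrite distrC nmE -[e +i* 0]/(e%:C) lecR.
    have -> : h^-1 *: (f (h + w) - f w) - l = h^-1 * (f (w + h) - f w - h * l).
      by rewrite (addrC w) [RHS]mulrBr mulKf.
    by rewrite nmM nmV mulrC ler_pdivrMr ?nm_gt0 //; exact: hd.
  move=> /cvgrPdist_le h e e0.
  have /h /nearC [d d0 hd] : 0 < e%:C by rewrite ltcR.
  exists d => // k hk; have [->|k0] := eqVneq k 0.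
    by rewrite addr0 subrr mul0r subrr nm0 mulr0.
  have := hd k; rewrite subr0 distrC nmE lecR => /(_ hk k0) h1.
  have -> : f (w + k) - f w - k * l = k * (k^-1 *: (f (k + w) - f w) - l).
    by rewrite (addrC k) [RHS]mulrBr mulVKf.
  by rewrite nmM mulrC ler_pM2r // nm_gt0.
rewrite key; split.
  move=> h; split; last by apply/cvg_lim.
  rewrite /derivable; apply/cvg_ex; exists l.
  apply: cvg_trans h; apply: near_eq_cvg; near=> h.
  by rewrite /= [h *: 1]mulr1.
move=> [h1 <-].
case/cvg_ex: h1 => l' h1.
have hl' : (fun h : R[i]^o => h^-1 *: (f (h + w) - f w)) @ (0 : R[i]^o)^' --> l'.
  apply: cvg_trans h1; apply: near_eq_cvg; near=> h.
  by rewrite /= [h *: 1]mulr1.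
have e : derive1 f w = l' by apply/cvg_lim.
by rewrite e.
Unshelve. all: by end_near. Qed.

End Modulus.

(** * Rules for complex derivatives *)

Section DerivativeCalculus.
Variable R : realType.
Local Notation C := R[i].
Implicit Types (f g : C -> C) (w l : C).

Lemma cder_is f w l : cder f w l <-> is_derive (w : R[i]^o) (1 : R[i]^o) (f : R[i]^o -> R[i]^o) l.
Proof.
rewrite cderP; split.
  move=> [h1 h2]; apply: DeriveDef; first exact: h1.
  by rewrite -derive1E; exact: h2.
move=> [h1 h2]; split; first exact: h1.
by rewrite derive1E; exact: h2.
Qed.

Lemma cderD f g w l m : cder f w l -> cder g w m -> cder (fun z => f z + g z) w (l + m).
Proof. by move=> /cder_is h1 /cder_is h2; apply/cder_is; apply: is_deriveD. Qed.

Lemma cderM f g w l m : cder f w l -> cder g w m ->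
  cder (fun z => f z * g z) w (l * g w + f w * m).
Proof.
move=> /cder_is h1 /cder_is h2; have h3 := is_derive_eq (@is_deriveM _ _ _ _ _ _ _ _ h1 h2).
refine ((cder_is (fun z => f z * g z) w (l * g w + f w * m)).2 (h3 _ _)).
by rewrite addrC; congr (_ + _); rewrite mulrC.
Qed.

Lemma cder_cst c w : cder (fun=> c) w 0.
Proof. by apply/cder_is; apply: is_derive_cst. Qed.

Lemma cder_id w : cder id w 1.
Proof. by apply/cder_is; apply: is_derive_id. Qed.

Lemma cder_uniq f w l m : cder f w l -> cder f w m -> l = m.
Proof. by move=> /cderP[_ <-] /cderP[_ <-]. Qed.

Lemma cderZ c f w l : cder f w l -> cder (fun z => c * f z) w (c * l).
Proof. by move=> h; have := cderM (cder_cst c w) h; rewrite mul0r add0r. Qed.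

Lemma cderN f w l : cder f w l -> cder (fun z => - f z) w (- l).
Proof.
move=> h; have := cderZ (-1) h; rewrite mulN1r.
by rewrite (_ : (fun z => -1 * f z) = fun z => - f z)//; apply/funext => z; rewrite mulN1r.
Qed.

Lemma cder_sum (I : Type) (r : seq I) (F : I -> C -> C) (L : I -> C) w :
  (forall i, cder (F i) w (L i)) ->
  cder (fun z => \sum_(i <- r) F i z) w (\sum_(i <- r) L i).
Proof.
move=> h; elim: r => [|i r ih].
  rewrite big_nil (_ : (fun z => _) = fun=> 0); first exact: cder_cst.
  by apply/funext => z; rewrite big_nil.
rewrite big_cons (_ : (fun z => _) = fun z => F i z + \sum_(j <- r) F j z).
  exact: cderD.
by apply/funext => z; rewrite big_cons.
Qed.

Lemma cder_lipschitz f w l : cder f w l -> exists2 d : R, 0 < d &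
  forall h, nm h < d -> nm (f (w + h) - f w) <= (nm l + 1) * nm h.
Proof.
move=> /(_ 1 ltr01) [d d0 hd]; exists d => // h /hd; rewrite mul1r => h1.
rewrite -{1}[f (w + h) - f w](subrK (h * l)); apply: (le_trans (nmD _ _)).
by rewrite nmM mulrDl mul1r (mulrC (nm l)) addrC lerD.
Qed.

Lemma cder_cont f w l : cder f w l -> forall e : R, 0 < e -> exists2 d : R, 0 < d &
  forall z, nm (z - w) < d -> nm (f z - f w) < e.
Proof.
move=> /cder_lipschitz [d d0 hd] e e0.
have K0 : 0 < nm l + 1 by rewrite ltr_wpDl ?nm_ge0.
exists (Num.min d (e / (nm l + 1))); first by rewrite lt_min d0 divr_gt0.
move=> z; rewrite lt_min => /andP[h1 h2].
have := hd _ h1; rewrite (addrC w) subrK => h; apply: (le_lt_trans h).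
by rewrite mulrC -ltr_pdivlMr.
Qed.

(** With k the increment of [g], the error is that of [f] for the increment k plus [m] times that of
    [g]; each part gets e / 2, the first through the Lipschitz bound on k. *)
Lemma cder_comp f g w l m : cder g w l -> cder f (g w) m ->
  cder (fun z => f (g z)) w (m * l).
Proof.
move=> hg hf e e0.
have [d3 d30 h3] := cder_lipschitz hg.
have K0 : 0 < nm l + 1 by rewrite ltr_wpDl ?nm_ge0.
have M0 : 0 < nm m + 1 by rewrite ltr_wpDl ?nm_ge0.
have [|d1 d10 h1] := hf (e / 2 / (nm l + 1)); first by rewrite !divr_gt0.
have [|d2 d20 h2] := hg (e / 2 / (nm m + 1)); first by rewrite !divr_gt0.
exists (Num.min (Num.min d2 d3) (d1 / (nm l + 1))).
  by rewrite !lt_min d20 d30 divr_gt0.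
move=> h; rewrite !lt_min ltr_pdivlMr // => /andP[/andP[/h2 a /h3 b] c].
set k := g (w + h) - g w in b.
have kd : nm k < d1 by apply: (le_lt_trans b); rewrite mulrC.
have := h1 k kd; rewrite {1}/k (addrC (g w)) subrK => h4.
have -> : f (g (w + h)) - f (g w) - h * (m * l) =
   (f (g (w + h)) - f (g w) - k * m) + (k - h * l) * m by ring.
apply: (le_trans (nmD _ _)); rewrite nmM.
have h5 : nm (f (g (w + h)) - f (g w) - k * m) <= e / 2 * nm h.
  apply: (le_trans h4).
  have -> : e / 2 * nm h = e / 2 / (nm l + 1) * ((nm l + 1) * nm h).
    by field; exact: lt0r_neq0.
  by rewrite ler_pM2l // !divr_gt0.
have h6 : nm (k - h * l) * nm m <= e / 2 * nm h.
  apply: (@le_trans _ _ (nm (k - h * l) * (nm m + 1))).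
    by rewrite ler_wpM2l ?nm_ge0 // lerDl.
  by rewrite -ler_pdivlMr // mulrAC.
have -> : e * nm h = e / 2 * nm h + e / 2 * nm h by rewrite -mulrDl -splitr.
exact: lerD.
Qed.

Lemma cder_ext f g w l : (exists2 r : R, 0 < r & forall z, nm (z - w) < r -> f z = g z) ->
  cder f w l -> cder g w l.
Proof.
move=> [r r0 h] hf e e0; have [d d0 hd] := hf e e0.
exists (Num.min d r); first by rewrite lt_min d0.
move=> k; rewrite lt_min => /andP[/hd h1 h2].
rewrite -!h // ?subrr ?nm0 //.
by rewrite (addrC w) addrK.
Qed.

(** The remainder is exactly h^2 / ((w + h) w^2), and |h| < |w| / 2 keeps |w + h| >= |w| / 2. *)
Lemma cder_inv w : w != 0 -> cder (fun z => z^-1) w (- w ^- 2).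
Proof.
move=> w0 e e0.
have nw : 0 < nm w by rewrite nm_gt0.
exists (Num.min (nm w / 2) (e * nm w ^+ 3 / 2)).
  by rewrite lt_min !divr_gt0 // mulr_gt0 // exprn_gt0.
move=> h; rewrite lt_min => /andP[h1 h2].
have h3 : nm w / 2 <= nm (w + h).
  have := nm_sub_ge w (- h); rewrite opprK nmN => h4.
  by apply: le_trans h4; lra.
have wh0 : w + h != 0 by rewrite -nm_gt0; apply: lt_le_trans h3; rewrite divr_gt0.
have -> : (w + h)^-1 - w^-1 - h * - w ^- 2 = h ^+ 2 / ((w + h) * w ^+ 2).
  by field; rewrite ?wh0 ?w0.
rewrite nmM nmV nmM !nmX expr2 -mulrA [X in _ <= X]mulrC.
rewrite ler_wpM2l ?nm_ge0 // ler_pdivrMr ?mulr_gt0 ?exprn_gt0 ?nm_gt0 //.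
apply: (le_trans (ltW h2)).
have -> : e * nm w ^+ 3 / 2 = e * (nm w / 2 * nm w ^+ 2) by ring.
rewrite ler_pM2l //.
by rewrite ler_wpM2r // exprn_ge0 // nm_ge0.
Qed.

Lemma cderV f w l : f w != 0 -> cder f w l -> cder (fun z => (f z)^-1) w (- l / f w ^+ 2).
Proof.
move=> f0 hf; have := cder_comp hf (cder_inv f0).
by rewrite mulNr mulrC -mulrN mulNr mulrN.
Qed.

Lemma cder_horner (p : {poly C}) w : cder (fun z => p.[z]) w p^`().[w].
Proof.
elim/poly_ind: p => [|p c ih].
  rewrite deriv0 horner0 (_ : (fun z => _) = fun=> 0); first exact: cder_cst.
  by apply/funext => z; rewrite horner0.
rewrite derivD derivC addr0 derivM derivX mulr1 hornerD hornerMX.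
rewrite (_ : (fun z => _) = fun z => p.[z] * z + c).
  rewrite -[_ + _]addr0; apply: cderD (cder_cst _ _).
  by have := cderM ih (cder_id w); rewrite mulr1.
by apply/funext => z; rewrite hornerD hornerMX hornerC.
Qed.

Lemma horner_cont (p : {poly C}) w (e : R) : 0 < e -> exists2 d : R, 0 < d &
  forall z, nm (z - w) < d -> nm (p.[z] - p.[w]) < e.
Proof. exact: cder_cont (cder_horner p w) e. Qed.

Lemma horner_neq0_near (p : {poly C}) w : p.[w] != 0 -> exists2 d : R, 0 < d &
  forall z, nm (z - w) < d -> p.[z] != 0.
Proof.
move=> p0; have [|d d0 h] := @horner_cont p w (nm p.[w]); first by rewrite nm_gt0.
exists d => // z /h; apply: contraTneq => ->.
by rewrite sub0r nmN ltxx.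
Qed.

Lemma horner_punctured (p : {poly C}) w : p != 0 -> exists2 d : R, 0 < d &
  forall z, nm (z - w) < d -> z != w -> p.[z] != 0.
Proof.
move=> p0; have [n [q]] := multiplicity_XsubC p w; rewrite p0 /= => q0 ->.
have [|d d0 h] := @horner_neq0_near q w; first by rewrite -rootE.
exists d => // z /h qz zw.
by rewrite hornerM horner_exp hornerXsubC mulf_neq0 // expf_neq0 // subr_eq0.
Qed.

End DerivativeCalculus.

(** * Uniqueness of solutions along segments *)

Section FundamentalMatrices.
Variable R : realType.
Local Notation C := R[i].

Definition reg (E : equation R) (w : C) : bool :=
  ((fden (pcoef E)).[w] != 0) && ((fden (qcoef E)).[w] != 0).

(* Rows are solutions, and the two columns are their values and derivatives. *)
Definition fsol (E : equation R) (U : C -> Prop) (F : C -> 'M[C]_2) : Prop :=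
  forall w, U w -> forall i,
    cder (fun z => F z i 0) w (F w i 1) /\
    cder (fun z => F z i 1) w
      (- (feval (pcoef E) w * F w i 1 + feval (qcoef E) w * F w i 0)).

Definition cvx (U : C -> Prop) : Prop :=
  forall a b (t : R), U a -> U b -> 0 <= t <= 1 -> U (a + t%:C * (b - a)).

Lemma feval_cder (f : ratfun R) w : (fden f).[w] != 0 -> exists l, cder (feval f) w l.
Proof.
move=> h; eexists; rewrite /feval.
exact: cderM (cder_horner (fnum f) w) (cderV h (cder_horner (fden f) w)).
Qed.

Lemma is_derive_eps (F : R -> R) (t l : R) :
  (forall e : R, 0 < e -> exists2 d : R, 0 < d & forall h, `|h| < d ->
     `|F (t + h) - F t - h * l| <= e * `|h|) -> is_derive t 1 F l.
Proof.
move=> hF.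
have key : (fun h => h^-1 *: (F (h *: 1 + t) - F t)) @ (0 : R)^' --> l.
  apply/cvgrPdist_le => e /hF [d d0 hd].
  apply/nearR; exists d => // h; rewrite subr0 => hh hN0.
  have -> : l - h^-1 *: (F (h *: 1 + t) - F t) = - (h^-1 * (F (t + h) - F t - h * l)).
    by rewrite [h *: 1]mulr1 (addrC t) mulrBr mulKf // opprB.
  by rewrite normrN normrM normfV mulrC ler_pdivrMr ?normr_gt0 //; exact: hd.
by apply: DeriveDef; [apply/cvg_ex; exists l | apply/cvg_lim].
Qed.

(** On a segment with direction [v] the complex equation becomes a real differential system, open to
    real-variable estimates. *)
Lemma cder_segment (f : C -> C) (b v l : C) (t : R) : cder f (b + t%:C * v) l ->
  is_derive t 1 (fun s : R => Re (f (b + s%:C * v))) (Re (l * v)) /\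
  is_derive t 1 (fun s : R => Im (f (b + s%:C * v))) (Im (l * v)).
Proof.
move=> hf.
have key (e : R) : 0 < e -> exists2 d : R, 0 < d & forall h : R, `|h| < d ->
    nm (f (b + (t + h)%:C * v) - f (b + t%:C * v) - h%:C * (l * v)) <= e * `|h|.
  move=> e0; have V0 : 0 < nm v + 1 by rewrite ltr_wpDl ?nm_ge0.
  have [|d d0 hd] := hf (e / (nm v + 1)); first by rewrite divr_gt0.
  exists (d / (nm v + 1)); first by rewrite divr_gt0.
  move=> h; rewrite ltr_pdivlMr // => hh.
  have hv : nm (h%:C * v) <= `|h| * (nm v + 1).
    by rewrite nmM nm_real ler_wpM2l // lerDl.
  have := hd (h%:C * v) (le_lt_trans hv hh).
  have -> : b + t%:C * v + h%:C * v = b + (t + h)%:C * v by rewrite rmorphD /=; ring.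
  rewrite -mulrA (mulrC v) => h1; apply: (le_trans h1).
  have -> : e * `|h| = e / (nm v + 1) * (`|h| * (nm v + 1)).
    by field; exact: lt0r_neq0.
  by rewrite ler_pM2l // divr_gt0.
split; apply: is_derive_eps => e /key [d d0 hd]; exists d => // h /hd; apply: le_trans.
  have -> : Re (f (b + (t + h)%:C * v)) - Re (f (b + t%:C * v)) - h * Re (l * v) =
     Re (f (b + (t + h)%:C * v) - f (b + t%:C * v) - h%:C * (l * v)).
    by rewrite !ReB (ReM h%:C) /= mul0r subr0.
  exact: nm_Re.
have -> : Im (f (b + (t + h)%:C * v)) - Im (f (b + t%:C * v)) - h * Im (l * v) =
   Im (f (b + (t + h)%:C * v) - f (b + t%:C * v) - h%:C * (l * v)).
  by rewrite !ImB (ImM h%:C) /= mul0r addr0.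
exact: nm_Im.
Qed.

(** The function f(t) exp(-K t) has nonpositive derivative, so by the mean value theorem it stays
    below its initial value 0. *)
Lemma gronwall0 (f df : R -> R) (K : R) :
  (forall t : R, 0 <= t <= 1 -> is_derive t 1 f (df t)) ->
  (forall t : R, 0 <= t <= 1 -> df t <= K * f t) -> f 0 = 0 -> f 1 <= 0.
Proof.
move=> hd hK f0.
pose g t := f t * expR (- K * t).
pose dg t := df t * expR (- K * t) - K * f t * expR (- K * t).
have hg (t : R) : 0 <= t <= 1 -> is_derive t 1 g (dg t).
  move=> ht; have h1 := hd t ht.
  have h2 : is_derive t 1 (fun s : R => - K * s) (- K).
    by apply: is_derive_eq; rewrite [_ *: _]mulr1.
  have h3 : is_derive t 1 (fun s : R => expR (- K * s)) (expR (- K * t) * - K).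
    have := @is_derive1_comp _ expR (fun s : R => - K * s) t _ _ (is_derive_expR _) h2.
    by [].
  have h4 := is_deriveM h1 h3; apply: (is_derive_eq h4).
  by rewrite /dg /GRing.scale /=; ring.
have cg : {within `[0, 1], continuous g}.
  apply: continuous_in_subspaceT => t; rewrite inE /= in_itv /= => ht.
  apply: differentiable_continuous; apply/derivable1_diffP.
  by case: (hg t ht).
have [|c cc] := @MVT_segment R g dg 0 1 ler01 _ cg.
  move=> t; rewrite in_itv /= => /andP[t0 t1]; apply: hg.
  by rewrite !ltW.
rewrite subr0 mulr1 {2}/g f0 mul0r subr0.
move: cc; rewrite in_itv /= => cc.
have : dg c <= 0.
  by rewrite /dg -mulrBl mulr_le0_ge0 ?expR_ge0 // subr_le0 hK.
by move=> h e; move: h; rewrite -e /g pmulr_lle0 // expR_gt0.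
Qed.

(** For each row the energy |y|^2 + |y'|^2 along the segment satisfies a linear differential
    inequality and starts at 0, so it vanishes at the end. *)
Lemma fsol_segment0 (E : equation R) (U : C -> Prop) (F : C -> 'M[C]_2) (b w : C) :
  (forall t : R, 0 <= t <= 1 -> U (b + t%:C * (w - b))) ->
  (forall z, U z -> reg E z) -> fsol E U F -> F b = 0 -> F w = 0.
Proof.
move=> hU hreg hF Fb.
pose v := w - b; pose z (t : R) : C := b + t%:C * v.
pose p t := feval (pcoef E) (z t); pose q t := feval (qcoef E) (z t).
(* The coefficients are continuous on the compact segment, hence bounded there. *)
have [B hB] : exists B : R, forall t : R, 0 <= t <= 1 -> nm (p t) + nm (q t) <= B.
  have cont (f : ratfun R) t : (fden f).[z t] != 0 ->
      {for t, continuous (fun s => nm (feval f (z s)))}.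
    move=> h; have [l hl] := feval_cder h.
    apply/cvgrPdist_lt => e e0; have [d d0 hd] := cder_cont hl e0.
    have V0 : 0 < nm v + 1 by rewrite ltr_wpDl ?nm_ge0.
    apply/nearR; exists (d / (nm v + 1)); first by rewrite divr_gt0.
    move=> s; rewrite ltr_pdivlMr // => hs.
    have hz : nm (z s - z t) < d.
      have -> : z s - z t = (s - t)%:C * v by rewrite /z rmorphB /=; ring.
      rewrite nmM nm_real; apply: le_lt_trans hs.
      by rewrite ler_wpM2l // lerDl.
    apply: le_lt_trans (hd _ hz); rewrite distrC ler_norml nm_sub_ge andbT.
    by rewrite lerNl opprB nmB nm_sub_ge.
  have [|c _ hc] := @EVT_max R (fun t => nm (p t) + nm (q t)) 0 1 ler01.
    apply: continuous_in_subspaceT => t; rewrite inE /= in_itv /= => ht.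
    have /andP[h1 h2] := hreg _ (hU t ht).
    by apply: continuousD; apply: cont.
  by exists (nm (p c) + nm (q c)) => t ht; apply: hc; rewrite in_itv.
apply/matrixP => i j.
pose y t := F (z t) i 0; pose y1 t := F (z t) i 1.
pose a t := - (p t * y1 t + q t * y t).
pose En t := Re (y t) * Re (y t) + Im (y t) * Im (y t) +
             (Re (y1 t) * Re (y1 t) + Im (y1 t) * Im (y1 t)).
pose dE t := 2 * (Re (y t) * Re (y1 t * v) + Im (y t) * Im (y1 t * v) +
             (Re (y1 t) * Re (a t * v) + Im (y1 t) * Im (a t * v))).
have EnE (t : R) : En t = nm (y t) ^+ 2 + nm (y1 t) ^+ 2 by rewrite /En !nm_sqr; ring.
have hd (t : R) : 0 <= t <= 1 -> is_derive t 1 En (dE t).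
  move=> ht; have [k1 k2] := hF _ (hU t ht) i.
  have [a1 a2] := cder_segment k1; have [a3 a4] := cder_segment k2.
  have b1 := is_deriveM a1 a1; have b2 := is_deriveM a2 a2.
  have b3 := is_deriveM a3 a3; have b4 := is_deriveM a4 a4.
  have := is_deriveD (is_deriveD b1 b2) (is_deriveD b3 b4) => hh.
  apply: (is_derive_eq hh).
  by rewrite /dE /a /p /q /y /y1 /z /v /GRing.scale /=; ring.
have e0 : En 1 <= 0.
(* With V = |v|, Y = |y|, Z = |y'|, the bound [rr] gives dE <= V (4 Y Z + 4 B Z^2 + 4 B Y Z); then 2
   Y Z <= Y^2 + Z^2 produces the constant V (2 + 6 B). *)
- apply: (gronwall0 (K := nm v * (2 + 6 * B)) hd) => [t ht|]; last first.
    rewrite EnE /y /y1 /z mul0r addr0 Fb !mxE nm0; ring.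
  rewrite EnE /dE.
  set Y := nm (y t); set Z := nm (y1 t); set V := nm v.
  have Y0 : 0 <= Y := nm_ge0 _; have Z0 : 0 <= Z := nm_ge0 _.
  have V0 : 0 <= V := nm_ge0 _.
  have hb := hB t ht.
  have P0 := nm_ge0 (p t); have Q0 := nm_ge0 (q t).
  have rr (c d : C) : Re c * Re d + Im c * Im d <= 2 * (nm c * nm d).
    have h1 : Re c * Re d <= nm c * nm d.
      apply: (le_trans (ler_norm _)); rewrite normrM.
      by apply: ler_pM => //; apply: nm_Re.
    have h2 : Im c * Im d <= nm c * nm d.
      apply: (le_trans (ler_norm _)); rewrite normrM.
      by apply: ler_pM => //; apply: nm_Im.
    by rewrite mulrDl mul1r lerD.
  have h1 : Re (y t) * Re (y1 t * v) + Im (y t) * Im (y1 t * v) <= 2 * (Y * (Z * V)).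
    by apply: (le_trans (rr _ _)); rewrite nmM.
  have ha : nm (a t) <= B * (Z + Y).
    rewrite /a nmN; apply: (le_trans (nmD _ _)); rewrite (nmM (p t)) (nmM (q t)).
    rewrite mulrDr lerD // ler_wpM2r //; apply: le_trans hb.
      by rewrite lerDl.
    by rewrite lerDr.
  have h2 : Re (y1 t) * Re (a t * v) + Im (y1 t) * Im (a t * v) <= 2 * (Z * (B * (Z + Y) * V)).
    apply: (le_trans (rr _ _)); rewrite nmM ler_pM2l // ler_wpM2l //.
    by rewrite ler_wpM2r.
  have B0 : 0 <= B by apply: le_trans hb; rewrite addr_ge0.
  have h3 : 2 * (Y * Z) <= Y ^+ 2 + Z ^+ 2.
    by have := sqr_ge0 (Y - Z); rewrite sqrrB; lra.
  have VB : 0 <= V * B by rewrite mulr_ge0.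
  have h4 : V * (2 * (Y * Z)) <= V * (Y ^+ 2 + Z ^+ 2) by rewrite ler_wpM2l.
  have h5 : V * B * (2 * (Y * Z)) <= V * B * (Y ^+ 2 + Z ^+ 2) by rewrite ler_wpM2l.
  have h6 : V * B * Z ^+ 2 <= V * B * (Y ^+ 2 + Z ^+ 2).
    by rewrite ler_wpM2l // lerDr sqr_ge0.
  by lra.
have hw : z 1 = w by rewrite /z /v mul1r addrC subrK.
move: e0; rewrite EnE /y /y1 hw => e0.
have : nm (F w i 0) ^+ 2 = 0 /\ nm (F w i 1) ^+ 2 = 0.
  by have := sqr_ge0 (nm (F w i 0)); have := sqr_ge0 (nm (F w i 1)); split; lra.
move=> [/eqP + /eqP]; rewrite !sqrf_eq0 !nm_eq0 => /eqP h0 /eqP h1.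
rewrite mxE; case: (unliftP 0 j) => [k|] -> //.
by rewrite (ord1 k) -h1; congr (F w i _); apply: val_inj.
Qed.

End FundamentalMatrices.

(** * Power series solutions of a linear equation with polynomial coefficients *)

Section PowerSeries.
Variable R : realType.
Local Notation C := R[i].
Implicit Types (s u : nat -> C) (z : C).

Definition cl u (l : C) : Prop :=
  forall e : R, 0 < e -> exists N, forall n, (N <= n)%N -> nm (u n - l) < e.

Lemma cl_cst (c : C) : cl (fun=> c) c.
Proof. by move=> e e0; exists 0%N => n _; rewrite subrr nm0. Qed.

Lemma clD u v (l m : C) : cl u l -> cl v m -> cl (fun n => u n + v n) (l + m).
Proof.
move=> hu hv e e0; have e2 : 0 < e / 2 by rewrite divr_gt0.
have [N hN] := hu _ e2; have [N' hN'] := hv _ e2.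
exists (maxn N N') => n; rewrite geq_max => /andP[/hN h1 /hN' h2].
have -> : u n + v n - (l + m) = (u n - l) + (v n - m) by ring.
by apply: (le_lt_trans (nmD _ _)); rewrite (splitr e) ltrD.
Qed.

Lemma clZ c u (l : C) : cl u l -> cl (fun n => c * u n) (c * l).
Proof.
move=> hu e e0; have c0 : 0 < nm c + 1 by rewrite ltr_wpDl ?nm_ge0.
have [|N hN] := hu (e / (nm c + 1)); first by rewrite divr_gt0.
exists N => n /hN; rewrite ltr_pdivlMr // => h; rewrite -mulrBr nmM.
by apply: le_lt_trans h; rewrite mulrC ler_wpM2l ?nm_ge0 // lerDl.
Qed.

Lemma cl_eq u v (l : C) : cl u l -> (forall n, u n = v n) -> cl v l.
Proof. by move=> h /funext <-. Qed.

Lemma cl_le u (l : C) (B : R) : cl u l -> (forall n, nm (u n) <= B) -> nm l <= B.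
Proof.
move=> hu hB; apply/ler_addgt0Pr => e e0; have [N hN] := hu e e0.
rewrite -[l](subKr (u N)); apply: (le_trans (nmD _ _)).
by rewrite nmN lerD // ltW // hN.
Qed.

Lemma cl_uniq u (l m : C) : cl u l -> cl u m -> l = m.
Proof.
move=> hl hm; apply/eqP; rewrite -subr_eq0 -nm_eq0 eq_le nm_ge0 andbT.
have h : cl (fun n => u n + -1 * u n) (l + -1 * m) by apply: clD => //; exact: clZ.
by rewrite mulN1r in h; apply: (cl_le h) => n; rewrite mulN1r subrr nm0.
Qed.

Lemma cl_shift u (l : C) : cl u l -> cl (fun n => u n.+1) l.
Proof. by move=> h e /h [N hN]; exists N => n hn; apply: hN; exact: leqW. Qed.

Lemma cl_unshift u (l : C) : cl (fun n => u n.+1) l -> cl u l.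
Proof. by move=> h e /h [N hN]; exists N.+1 => -[//|n] hn; exact: hN. Qed.

Definition psum s z n := \sum_(k < n) s k * z ^+ k.

Definition ser s z : C := xget 0 [set l | cl (psum s z) l].

(** Geometric growth of the coefficients, that is, a positive radius of convergence. *)
Definition gb s := exists M L : R, [/\ 0 <= M, 0 < L & forall n, nm (s n) <= M * L ^+ n].

Lemma real_geom_cvg (a : nat -> R) (M : R) : 0 <= M ->
  (forall n, `|a n| <= M * 2^-1 ^+ n) -> cvgn (series a).
Proof.
move=> M0 h; apply: normed_cvg; apply: (@series_le_cvg _ _ (geometric M 2^-1)).
- by move=> n /=; exact: normr_ge0.
- by move=> n; rewrite /geometric /= mulr_ge0 // exprn_ge0.
- exact: h.
by apply: is_cvg_geometric_series; rewrite ger0_norm // invf_lt1 // ltr1n.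
Qed.

Lemma series_cl (a : nat -> C) (M : R) : 0 <= M ->
  (forall n, nm (a n) <= M * 2^-1 ^+ n) -> exists l, cl (fun n => \sum_(k < n) a k) l.
Proof.
move=> M0 h.
have /cvg_ex[lr hr] : cvgn (series (fun n => Re (a n))).
  by apply: (real_geom_cvg M0) => n; apply: le_trans (nm_Re _) (h n).
have /cvg_ex[li hi] : cvgn (series (fun n => Im (a n))).
  by apply: (real_geom_cvg M0) => n; apply: le_trans (nm_Im _) (h n).
exists (lr +i* li) => e e0; have e2 : 0 < e / 2 by rewrite divr_gt0.
move/cvgrPdist_lt: hr => /(_ _ e2) [N _ hN]; move/cvgrPdist_lt: hi => /(_ _ e2) [N' _ hN'].
exists (maxn N N') => n; rewrite geq_max => /andP[/hN h1 /hN' h2].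
apply: (le_lt_trans (nm_le _)); rewrite (splitr e) ReB ImB.
have eR : Re (\sum_(k < n) a k) = series (fun n => Re (a n)) n.
  rewrite /series /= big_mkord.
  by elim/big_rec2 : _ => [|i y1 y2 _ <-] //; rewrite ReD.
have eI : Im (\sum_(k < n) a k) = series (fun n => Im (a n)) n.
  rewrite /series /= big_mkord.
  by elim/big_rec2 : _ => [|i y1 y2 _ <-] //; rewrite ImD.
by rewrite eR eI /= ltrD // distrC.
Qed.

Lemma gb_ser s : gb s -> exists2 r : R, 0 < r & forall z, nm z < r -> cl (psum s z) (ser s z).
Proof.
move=> [M [L [M0 L0 h]]]; exists (2 * L)^-1; first by rewrite invr_gt0 mulr_gt0.
move=> z hz; suff [l hl] : exists l, cl (psum s z) l.
  by rewrite /ser; case: xgetP => // /(_ l).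
apply: (@series_cl (fun k => s k * z ^+ k) M M0) => n; rewrite nmM nmX.
have -> : M * 2^-1 ^+ n = M * L ^+ n * (2 * L)^-1 ^+ n.
  by rewrite -mulrA -exprMn invfM mulrCA mulfV ?mulr1 // lt0r_neq0.
apply: ler_pM => //; rewrite ?exprn_ge0 ?nm_ge0 //.
by rewrite lerXn2r ?nnegrE ?nm_ge0 ?invr_ge0 ?mulr_ge0 // ltW.
Qed.

Definition dseq s : nat -> C := fun n => (n.+1)%:R * s n.+1.

Lemma natr_le_exp2 n : (n.+1%:R <= 2 ^+ n.+1 :> R).
Proof. by rewrite -natrX ler_nat ltnW // ltn_expl. Qed.

Lemma gb_dseq s : gb s -> gb (dseq s).
Proof.
move=> [M [L [M0 L0 h]]]; exists (M * (2 * L)), (2 * L); split.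
- by rewrite !mulr_ge0 // ltW.
- by rewrite mulr_gt0.
move=> n; rewrite /dseq nmM nm_nat -mulrA -exprS exprMn mulrCA.
by apply: ler_pM => //; rewrite ?nm_ge0 // natr_le_exp2.
Qed.

(** A quadratic remainder uniform in [n]. The remainder [D k] of z^k obeys r^2 |D k| <= k^2 r^k
    |h|^2 by induction; as k^2 <= 4^k and 8 L r <= 1, the sum of k^2 (L r)^k is dominated by that of
    2^-k, which is at most 2. The derived series has one term less, whence [n.-1]. *)
Lemma psum_diff s (z h : C) (r M L : R) n : 0 < r -> 0 <= M -> 0 < L ->
  (forall n, nm (s n) <= M * L ^+ n) -> 8 * L * r <= 1 ->
  nm z <= r -> nm (z + h) <= r ->
  nm (psum s (z + h) n - psum s z n - h * psum (dseq s) z n.-1)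
    <= 2 * M / r ^+ 2 * nm h ^+ 2.
Proof.
move=> r0 M0 L0 hs hL hz hzh.
pose D k := (z + h) ^+ k - z ^+ k - h * (k%:R * z ^+ k.-1).
have hD k : r ^+ 2 * nm (D k) <= k%:R ^+ 2 * r ^+ k * nm h ^+ 2.
  elim: k => [|k ih].
    by rewrite /D !expr0 subrr !mul0r mulr0 subrr nm0 mulr0 expr0n /= !mul0r.
  have -> : D k.+1 = (z + h) * D k + k%:R * h ^+ 2 * z ^+ k.-1.
    rewrite /D -natr1; case: k {ih} => [|k] /=; first by rewrite !expr0; ring.
    by rewrite !exprS ?expr0; ring.
  have h1 : r ^+ 2 * nm ((z + h) * D k) <= r * (k%:R ^+ 2 * r ^+ k * nm h ^+ 2).
    rewrite nmM mulrCA; apply: ler_pM => //; rewrite ?nm_ge0 //.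
    by rewrite mulr_ge0 ?nm_ge0 // exprn_ge0 // ltW.
  have h2 : r ^+ 2 * nm (k%:R * h ^+ 2 * z ^+ k.-1) <= k%:R * r ^+ k.+1 * nm h ^+ 2.
    case: k {ih h1} => [|k] /=; first by rewrite !mul0r nm0 mulr0.
    rewrite !nmM nm_nat !nmX.
    have h3 : nm z ^+ k <= r ^+ k by rewrite lerXn2r ?nnegrE ?nm_ge0 // ltW.
    have -> : k.+1%:R * r ^+ k.+2 * nm h ^+ 2 = r ^+ 2 * (k.+1%:R * nm h ^+ 2 * r ^+ k).
      by rewrite !exprS; ring.
    apply: ler_wpM2l; first by rewrite exprn_ge0 // ltW.
    apply: ler_wpM2l h3; exact: mulr_ge0 (ler0n _ _) (mulr_ge0 (nm_ge0 _) (nm_ge0 _)).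
  apply: (@le_trans _ _ (r ^+ 2 * nm ((z + h) * D k) + r ^+ 2 * nm (k%:R * h ^+ 2 * z ^+ k.-1))).
    rewrite -mulrDr; apply: ler_wpM2l; last exact: nmD.
    by rewrite exprn_ge0 // ltW.
  apply: (le_trans (lerD h1 h2)); rewrite -natr1.
  have -> : r * (k%:R ^+ 2 * r ^+ k * nm h ^+ 2) + k%:R * r ^+ k.+1 * nm h ^+ 2 =
     (k%:R ^+ 2 + k%:R) * (r ^+ k.+1 * nm h ^+ 2) by rewrite [r ^+ k.+1]exprS; ring.
  rewrite -mulrA ler_wpM2r ?mulr_ge0 ?exprn_ge0 ?nm_ge0 ?ltW //.
  have : (0 : R) <= k%:R by [].
  by nra.
have -> : psum s (z + h) n - psum s z n - h * psum (dseq s) z n.-1 =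
   \sum_(k < n) s k * D k.
  have -> : h * psum (dseq s) z n.-1 = \sum_(k < n) s k * (h * (k%:R * z ^+ k.-1)).
    case: n => [|n]; first by rewrite /psum !big_ord0 mulr0.
    rewrite big_ord_recl mul0r !mulr0 add0r /psum mulr_sumr; apply: eq_bigr => i _.
    by rewrite /dseq /= /bump /=; ring.
  rewrite /psum -!sumrB; apply: eq_bigr => i _; rewrite /D; ring.
apply: (le_trans (nm_sum _ _ _)).
rewrite -(ler_pM2l (x := r ^+ 2)) ?exprn_gt0 // mulr_sumr.
have -> : r ^+ 2 * (2 * M / r ^+ 2 * nm h ^+ 2) = 2 * (M * nm h ^+ 2).
  by field; exact: lt0r_neq0.
apply: (@le_trans _ _ (\sum_(k < n) M * nm h ^+ 2 * 2^-1 ^+ k)).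
  apply: ler_sum => k _; rewrite nmM mulrCA.
  apply: (@le_trans _ _ (M * L ^+ k * (k%:R ^+ 2 * r ^+ k * nm h ^+ 2))).
    by apply: ler_pM => //; rewrite ?nm_ge0 // mulr_ge0 ?nm_ge0 // exprn_ge0 // ltW.
  have -> : M * L ^+ k * (k%:R ^+ 2 * r ^+ k * nm h ^+ 2) =
    M * nm h ^+ 2 * (k%:R ^+ 2 * (L * r) ^+ k) by rewrite exprMn; ring.
  rewrite ler_wpM2l ?mulr_ge0 ?exprn_ge0 ?nm_ge0 //.
  have h4 : k%:R ^+ 2 <= 4 ^+ k :> R.
    rewrite -!natrX ler_nat -[4%N]/(2 ^ 2)%N -expnM mulnC expnM leq_exp2r //.
    by rewrite ltnW // ltn_expl.
  apply: (@le_trans _ _ (4 ^+ k * (L * r) ^+ k)).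
    by rewrite ler_wpM2r // exprn_ge0 // mulr_ge0 // ltW.
  rewrite -exprMn lerXn2r ?nnegrE //; last by lra.
  by rewrite !mulr_ge0 // ltW.
rewrite -mulr_sumr mulrC; apply: ler_wpM2r.
  by rewrite mulr_ge0 // exprn_ge0 // nm_ge0.
suff -> : \sum_(k < n) (2^-1 : R) ^+ k = 2 - 2 * 2^-1 ^+ n.
  by rewrite lerBlDr lerDl mulr_ge0 // exprn_ge0.
elim: n => [|n ih]; first by rewrite big_ord0 expr0 mulr1 subrr.
by rewrite big_ord_recr /= ih exprS; field.
Qed.

(** The remainder bound for partial sums does not depend on the number of terms, so it passes to the
    limit. *)
Lemma ser_cder s : gb s -> exists2 r : R, 0 < r & forall z, nm z < r ->
  cder (ser s) z (ser (dseq s) z).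
Proof.
move=> gs; have [r1 r10 h1] := gb_ser gs; have [r2 r20 h2] := gb_ser (gb_dseq gs).
case: gs => M [L [M0 L0 hs]].
pose r := Num.min (Num.min r1 r2) (8 * L)^-1.
have r0 : 0 < r by rewrite !lt_min r10 r20 invr_gt0 mulr_gt0.
have hLr : 8 * L * r <= 1.
  rewrite mulrC -ler_pdivlMr ?mulr_gt0 // mul1r /r ge_min lexx orbT //.
exists r => // z hz e e0.
pose K := 2 * M / r ^+ 2 + 1.
have K0 : 0 < K by rewrite ltr_wpDl // divr_ge0 ?mulr_ge0 ?exprn_ge0 ?(ltW r0).
exists (Num.min (r - nm z) (e / K)); first by rewrite lt_min subr_gt0 hz divr_gt0.
move=> h; rewrite lt_min => /andP[hh1 hh2].
have hzh : nm (z + h) < r by apply: (le_lt_trans (nmD _ _)); rewrite -ltrBrDl.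
have rr1 : forall x, nm x < r -> nm x < r1 by move=> x; rewrite /r !lt_min -andbA => /and3P[].
have rr2 : forall x, nm x < r -> nm x < r2 by move=> x; rewrite /r !lt_min -andbA => /and3P[].
have c1 := h1 _ (rr1 _ hzh); have c2 := h1 _ (rr1 _ hz); have c3 := h2 _ (rr2 _ hz).
have c4 : cl (fun n => psum (dseq s) z n.-1) (ser (dseq s) z) by apply: cl_unshift.
have c5 := clD (clD c1 (clZ (-1) c2)) (clZ (- h) c4).
have h3 : nm (ser s (z + h) - ser s z - h * ser (dseq s) z) <= 2 * M / r ^+ 2 * nm h ^+ 2.
  rewrite -mulN1r -mulNr; apply: (cl_le c5) => n.
  by rewrite mulN1r mulNr; apply: (psum_diff n r0 M0 L0 hs hLr); rewrite ltW.
apply: (le_trans h3); rewrite expr2 mulrA ler_wpM2r ?nm_ge0 //.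
apply: (@le_trans _ _ (K * nm h)); first by rewrite ler_wpM2r ?nm_ge0 // /K lerDl.
by rewrite mulrC -ler_pdivlMr // ltW.
Qed.

(** Coefficients of the product of a polynomial and a power series. *)
Definition conv (p : {poly C}) s n := \sum_(j < n.+1) p`_j * s (n - j)%N.

Lemma ser_conv (p : {poly C}) s z (l : C) : cl (psum s z) l -> cl (psum (conv p s) z) (p.[z] * l).
Proof.
move=> h; elim/poly_ind: p => [|p c ih].
  rewrite horner0 mul0r; apply: cl_eq (cl_cst _) _ => n.
  by rewrite /psum big1 // => k _; rewrite /conv big1 ?mul0r // => j _; rewrite coef0 mul0r.
rewrite hornerMXaddC mulrDl; apply: cl_unshift.
have h1 := clD (clZ z ih) (clZ c (cl_shift h)).
have -> : p.[z] * z * l = z * (p.[z] * l) by ring.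
apply: cl_eq h1 _ => n; rewrite /psum big_ord_recl [RHS]big_ord_recl !expr0 !mulr1.
have -> : conv (p * 'X + c%:P) s 0 = c * s 0%N.
  by rewrite /conv big_ord1 coefD coefMX coefC /= add0r.
rewrite mulrDr addrCA; congr (_ + _).
rewrite !mulr_sumr -big_split /=; apply: eq_bigr => i _; rewrite /bump /= add1n.
have -> : conv (p * 'X + c%:P) s i.+1 = conv p s i + c * s i.+1.
  rewrite /conv big_ord_recl coefD coefMX coefC /= add0r subn0 addrC; congr (_ + _).
  by apply: eq_bigr => j _; rewrite coefD coefMX coefC /= addr0 /bump /= add1n subSS.
by rewrite exprS; ring.
Qed.

Definition coefnorm (p : {poly C}) : R := \sum_(j < size p) nm p`_j.

Lemma coefnorm_ge (p : {poly C}) n : \sum_(j < n) nm p`_j <= coefnorm p.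
Proof.
have [h|h] := leqP n (size p).
  rewrite /coefnorm -(subnKC h) big_split_ord /= lerDl sumr_ge0 // => i _.
  exact: nm_ge0.
rewrite -(subnKC (ltnW h)) big_split_ord /= [X in _ + X]big1 ?addr0 //.
by move=> i _; rewrite nth_default ?nm0 // leq_addr.
Qed.

(** A term may depend on all earlier ones, so the recursion runs on the list of the values found so
    far. *)
Lemma recursive_sequence (c0 c1 : C) (G : nat -> (nat -> C) -> C) :
  (forall n c d, (forall k, (k <= n.+1)%N -> c k = d k) -> G n c = G n d) ->
  exists c : nat -> C, [/\ c 0%N = c0, c 1%N = c1 & forall n, c n.+2 = G n c].
Proof.
move=> hG.
pose st (s : seq C) := rcons s (G (size s).-2 (nth 0 s)).
pose L n := iter n st [:: c0; c1].
have sL n : size (L n) = n.+2 by elim: n => // n ih; rewrite /L /= size_rcons -/(L n) ih.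
have LS n k : (k < n.+2)%N -> nth 0 (L n.+1) k = nth 0 (L n) k.
  by move=> h; rewrite /L /= nth_rcons -/(L n) sL h.
pose c n := nth 0 (L n) n.
have Lc n k : (k < n.+2)%N -> nth 0 (L n) k = c k.
  elim: n k => [|n ih] k; first by case: k => [|[|]].
  rewrite ltnS leq_eqVlt => /orP[/eqP ->|h]; last by rewrite LS // ih.
  by rewrite /c [RHS]LS.
exists c; split=> // n.
rewrite -(@Lc n.+1) // /L /= nth_rcons -/(L n) sL ltnn eqxx /=.
by apply: hG => k hk; rewrite Lc.
Qed.

Lemma subS_leq n (j : 'I_n) : ((n - j.+1).+2 <= n.+1)%N.
Proof. by have := ltn_ord j; lia. Qed.

Section Recurrence.
Variables (A0 A1 A2 : {poly C}) (c0 c1 : C).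
Hypothesis A00 : A0`_0 != 0.

(** The coefficient of z^n in A0 y'' + A1 y' + A2 y, set to 0 and solved for c_{n+2}, which enters
    only through the constant term of A0. *)
Let G n (c : nat -> C) : C :=
  - (\sum_(j < n) A0`_j.+1 * dseq (dseq c) (n - j.+1)%N
     + conv A1 (dseq c) n + conv A2 c n) / (A0`_0 * (n.+1%:R * n.+2%:R)).

Let natS_neq0 n : n.+1%:R != 0 :> C.
Proof. by rewrite -nm_eq0 nm_nat pnatr_eq0. Qed.

(** Induction step for |c_n| <= M K^n: the index factors in the numerator are at most (n + 1)(n +
    2), which the denominator cancels, and the remaining quotient of coefficient sums is at most
    K. *)
Let nmG n c (M K : R) : 0 <= M -> 1 <= K ->
  (coefnorm A0 + coefnorm A1 + coefnorm A2) / nm A0`_0 <= K ->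
  (forall k, (k <= n.+1)%N -> nm (c k) <= M * K ^+ k) -> nm (G n c) <= M * K ^+ n.+2.
Proof.
move=> M0 K1 hK hc.
have A0n : 0 < nm A0`_0 by rewrite nm_gt0.
pose X := M * K ^+ n.+1.
have K0 : 0 <= K by apply: le_trans K1.
have X0 : 0 <= X by rewrite mulr_ge0 // exprn_ge0.
have hX k : (k <= n.+1)%N -> nm (c k) <= X.
  by move=> hk; apply: (le_trans (hc k hk)); rewrite ler_wpM2l // ler_weXn2l.
have n0 : 0 < n.+1%:R * n.+2%:R :> R by rewrite mulr_gt0.
rewrite /G nmM nmV nmM nmM !nm_nat nmN ler_pdivrMr ?mulr_gt0 //.
have sumb (p : {poly C}) m : (\sum_(j < m) nm p`_j) * (n.+1%:R * n.+2%:R * X) <=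
     coefnorm p * (n.+1%:R * n.+2%:R * X).
  apply: ler_wpM2r; last exact: coefnorm_ge.
  exact: mulr_ge0 (ltW n0) X0.
have n1 : (1 : R) <= n.+1%:R by rewrite ler1n.
have n2 : (1 : R) <= n.+2%:R by rewrite ler1n.
have b1 : nm (\sum_(j < n) A0`_j.+1 * dseq (dseq c) (n - j.+1)%N)
     <= coefnorm A0 * (n.+1%:R * n.+2%:R * X).
  apply: (le_trans (nm_sum _ _ _)).
  apply: le_trans (sumb A0 n.+1); rewrite big_ord_recl mulrDl -[X in X <= _]add0r.
  apply: lerD; first exact: mulr_ge0 (nm_ge0 _) (mulr_ge0 (ltW n0) X0).
  rewrite mulr_suml; apply: ler_sum => j _; rewrite nmM lift0.
  apply: ler_wpM2l; first exact: nm_ge0.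
  rewrite /dseq nmM nmM !nm_nat mulrA.
  apply: ler_pM; [by rewrite mulr_ge0|exact: nm_ge0| |exact/hX/subS_leq].
  by apply: ler_pM => //; rewrite ler_nat; [exact/ltnW/subS_leq|exact/leqW/subS_leq].
have b2 : nm (conv A1 (dseq c) n) <= coefnorm A1 * (n.+1%:R * n.+2%:R * X).
  apply: (le_trans (nm_sum _ _ _)).
  apply: le_trans (sumb A1 n.+1).
  rewrite mulr_suml; apply: ler_sum => j _; rewrite nmM.
  apply: ler_wpM2l; first exact: nm_ge0.
  rewrite /dseq nmM nm_nat.
  apply: ler_pM => //; first exact: nm_ge0; last by apply: hX; rewrite ltnS leq_subr.
  rewrite -[X in X <= _]mulr1; apply: ler_pM => //.
  by rewrite ler_nat ltnS leq_subr.
have b3 : nm (conv A2 c n) <= coefnorm A2 * (n.+1%:R * n.+2%:R * X).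
  apply: (le_trans (nm_sum _ _ _)).
  apply: le_trans (sumb A2 n.+1).
  rewrite mulr_suml; apply: ler_sum => j _; rewrite nmM.
  apply: ler_wpM2l; first exact: nm_ge0.
  rewrite -[X in X <= _]mul1r; apply: ler_pM => //; first exact: nm_ge0.
    by rewrite -[X in X <= _]mulr1; apply: ler_pM.
  by apply: hX; rewrite leqW // leq_subr.
apply: (le_trans (nmD _ _)); apply: (le_trans (lerD (nmD _ _) (lexx _))).
apply: (le_trans (lerD (lerD b1 b2) b3)); rewrite -!mulrDl.
move: hK; rewrite ler_pdivrMr // => hK.
apply: (@le_trans _ _ (K * nm A0`_0 * (n.+1%:R * n.+2%:R * X))).
  by rewrite ler_wpM2r // mulr_ge0 // ltW.
by rewrite /X [K ^+ n.+2]exprS le_eqVlt; apply/orP; left; apply/eqP; ring.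
Qed.

Lemma power_series_solution : exists c : nat -> C,
  [/\ c 0%N = c0, c 1%N = c1, gb c & forall n,
   conv A0 (dseq (dseq c)) n + conv A1 (dseq c) n + conv A2 c n = 0].
Proof.
have [|c [h0 h1 h]] := @recursive_sequence c0 c1 G.
  move=> n c d hcd; rewrite /G /conv /dseq; congr (- (_ + _ + _) / _).
  - by apply: eq_bigr => j _; rewrite hcd //; exact: subS_leq.
  - by apply: eq_bigr => j _; rewrite hcd // ltnS leq_subr.
  - by apply: eq_bigr => j _; rewrite hcd // leqW // leq_subr.
exists c; split=> //; last first.
  move=> n; rewrite {1}/conv big_ord_recl subn0 {1}/dseq {1}/dseq h /G.
  have -> : \sum_(i < n) A0`_(lift ord0 i) * dseq (dseq c) (n - lift ord0 i)%N =
      \sum_(i < n) A0`_i.+1 * dseq (dseq c) (n - i.+1)%N.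
    by apply: eq_bigr => i _; rewrite lift0.
  have := natS_neq0 n; have := natS_neq0 n.+1.
  move: (n.+1%:R : C) (n.+2%:R : C) => x y y0 x0.
  by field; rewrite A00 x0 y0.
(* M covers both initial values; the summand 1 makes K >= 1, so that the powers of K increase. *)
pose M := nm c0 + nm c1; pose K := 1 + (coefnorm A0 + coefnorm A1 + coefnorm A2) / nm A0`_0.
have cn p : 0 <= coefnorm p by apply: sumr_ge0 => i _; exact: nm_ge0.
have K1 : 1 <= K by rewrite lerDl divr_ge0 ?nm_ge0 // !addr_ge0.
have M0 : 0 <= M by rewrite addr_ge0 ?nm_ge0.
exists M, K; split=> //; first exact: lt_le_trans K1.
suff H n : forall k, (k <= n)%N -> nm (c k) <= M * K ^+ k by move=> n; exact: (H n).
elim: n => [|n ih] k; first by rewrite leqn0 => /eqP ->; rewrite h0 expr0 mulr1 /M lerDl nm_ge0.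
rewrite leq_eqVlt => /orP[/eqP ->|]; last by rewrite ltnS; exact: ih.
case: n ih => [|n] ih.
  rewrite h1 expr1 -[nm c1]mulr1; apply: ler_pM; rewrite ?nm_ge0 // /M lerDr nm_ge0 //.
by rewrite h; apply: nmG => //; rewrite /K lerDr.
Qed.

Lemma local_solution0 : exists r : R, exists y y1 y2 : C -> C,
  [/\ 0 < r, y 0 = c0, y1 0 = c1 & forall z, nm z < r ->
   [/\ cder y z (y1 z), cder y1 z (y2 z) & A0.[z] * y2 z + A1.[z] * y1 z + A2.[z] * y z = 0]].
Proof.
have [c [h0 h1 gc hc]] := power_series_solution.
have gc1 := gb_dseq gc; have gc2 := gb_dseq gc1.
have [r1 r10 d1] := ser_cder gc; have [r2 r20 d2] := ser_cder gc1.
have [s0 s00 e0] := gb_ser gc; have [s1 s10 e1] := gb_ser gc1.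
have [s2 s20 e2] := gb_ser gc2.
pose r := Num.min (Num.min r1 r2) (Num.min s0 (Num.min s1 s2)).
have r0 : 0 < r by rewrite !lt_min r10 r20 s00 s10 s20.
have ser0 s (x : R) : 0 < x -> (forall z, nm z < x -> cl (psum s z) (ser s z)) -> ser s 0 = s 0%N.
  move=> x0 /(_ 0); rewrite nm0 => /(_ x0) /cl_shift h; apply: cl_uniq h _.
  apply: cl_eq (cl_cst _) _ => n; rewrite /psum big_ord_recl expr0 mulr1.
  by rewrite big1 ?addr0 // => i _; rewrite exprS mul0r mulr0.
exists r, (ser c), (ser (dseq c)), (ser (dseq (dseq c))); split=> //.
- by rewrite (ser0 _ s0).
- by rewrite (ser0 _ s1) // /dseq mul1r.
move=> z; rewrite !lt_min => /andP[/andP[k1 k2] /and3P[k3 k4 k5]]; split.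
- exact: d1.
- exact: d2.
have := clD (clD (ser_conv A0 (e2 _ k5)) (ser_conv A1 (e1 _ k4))) (ser_conv A2 (e0 _ k3)).
move=> h; apply: cl_uniq h _; apply: cl_eq (cl_cst _) _ => n.
rewrite /psum -!big_split big1 //= => i _.
by rewrite -!mulrDl hc mul0r.
Qed.

End Recurrence.

End PowerSeries.

(** * Existence and uniqueness of solutions on convex regions *)

Section LinearODE.
Variable R : realType.
Local Notation C := R[i].
Implicit Types (E : equation R) (U V : C -> Prop) (F G : C -> 'M[C]_2).

Definition ballC (c : C) (r : R) : C -> Prop := fun z => nm (z - c) < r.

Definition opn U := forall w, U w -> exists2 r : R, 0 < r & forall z, ballC w r z -> U z.

Lemma ballC_center (c : C) (r : R) : 0 < r -> ballC c r c.
Proof. by rewrite /ballC subrr nm0. Qed.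

Lemma opn_ball (c : C) (r : R) : opn (ballC c r).
Proof.
move=> w hw; exists (r - nm (w - c)); first by rewrite subr_gt0.
move=> z; rewrite /ballC ltrBrDr => h; apply: le_lt_trans h.
by rewrite (_ : z - c = (z - w) + (w - c)) ?nmD //; ring.
Qed.

Lemma segment_comb (a b : C) (t : R) : a + t%:C * (b - a) = (1 - t)%:C * a + t%:C * b.
Proof. by rewrite rmorphB /=; ring. Qed.

Lemma cvx_ball (c : C) (r : R) : cvx (ballC c r).
Proof.
move=> a b t; rewrite /ballC => ha hb /andP[t0 t1]; rewrite segment_comb.
have -> : (1 - t)%:C * a + t%:C * b - c = (1 - t)%:C * (a - c) + t%:C * (b - c).
  by rewrite rmorphB /=; ring.
apply: (le_lt_trans (nmD _ _)); rewrite !nmM !nm_real !ger0_norm ?subr_ge0 //.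
have [->|tN0] := eqVneq t 0; first by rewrite subr0 mul1r mul0r addr0.
have tp : 0 < t by rewrite lt_neqAle eq_sym tN0.
have -> : r = (1 - t) * r + t * r by ring.
apply: ler_ltD; first by rewrite ler_wpM2l ?subr_ge0 // ltW.
by rewrite ltr_pM2l.
Qed.

Lemma cvxI U V : cvx U -> cvx V -> cvx (fun z => U z /\ V z).
Proof. by move=> hU hV a b t [a1 a2] [b1 b2] ht; split; [apply: hU|apply: hV]. Qed.

Lemma opnI U V : opn U -> opn V -> opn (fun z => U z /\ V z).
Proof.
move=> hU hV w [/hU[r r0 h] /hV[s s0 k]]; exists (Num.min r s); first by rewrite lt_min r0.
by move=> z; rewrite /ballC lt_min => /andP[/h ? /k].
Qed.

Lemma fsol_sub E U V F : (forall z, V z -> U z) -> fsol E U F -> fsol E V F.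
Proof. by move=> h hF w /h; exact: hF. Qed.

Lemma fsol_mul E U F (M : 'M[C]_2) : fsol E U F -> fsol E U (fun z => M *m F z).
Proof.
move=> hF w Uw i; have h k := hF w Uw k.
have e (j : 'I_2) z : (M *m F z) i j = \sum_k M i k * F z k j by rewrite mxE.
split.
  rewrite e (_ : (fun z => _) = fun z => \sum_k M i k * F z k 0).
    by apply: cder_sum => k; apply: cderZ; case: (h k).
  by apply/funext => z; rewrite e.
have -> : - (feval (pcoef E) w * (M *m F w) i 1 + feval (qcoef E) w * (M *m F w) i 0)
  = \sum_k M i k * - (feval (pcoef E) w * F w k 1 + feval (qcoef E) w * F w k 0).
  rewrite !e !mulr_sumr -big_split -sumrN /=; apply: eq_bigr => k _; ring.
rewrite (_ : (fun z => _) = fun z => \sum_k M i k * F z k 1).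
  by apply: cder_sum => k; apply: cderZ; case: (h k).
by apply/funext => z; rewrite e.
Qed.

Lemma fsolB E U F G : fsol E U F -> fsol E U G -> fsol E U (fun z => F z - G z).
Proof.
move=> hF hG w Uw i; have [f1 f2] := hF w Uw i; have [g1 g2] := hG w Uw i.
have e (j : 'I_2) z : (F z - G z) i j = F z i j + - G z i j by rewrite !mxE.
split.
  rewrite e (_ : (fun z => _) = fun z => F z i 0 + - G z i 0).
    by apply: cderD => //; apply: cderN.
  by apply/funext => z; rewrite e.
rewrite !e (_ : (fun z => _) = fun z => F z i 1 + - G z i 1); last first.
  by apply/funext => z; rewrite e.
have := cderD f2 (cderN g2); congr cder; ring.
Qed.

Lemma fsol_ext E U F G : opn U -> (forall z, U z -> F z = G z) -> fsol E U F -> fsol E U G.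
Proof.
move=> oU h hF w Uw i; have [f1 f2] := hF w Uw i.
have [r r0 hr] := oU w Uw; rewrite -(h _ Uw); split.
  by apply: cder_ext f1; exists r => // z /hr /h ->.
by apply: cder_ext f2; exists r => // z /hr /h ->.
Qed.

Lemma fsol_uniq E U F G b : cvx U -> (forall z, U z -> reg E z) ->
  fsol E U F -> fsol E U G -> U b -> F b = G b -> forall w, U w -> F w = G w.
Proof.
move=> cU rU hF hG Ub h w Uw; apply/eqP; rewrite -subr_eq0; apply/eqP.
apply: (@fsol_segment0 _ E U (fun z => F z - G z) b w _ rU (fsolB hF hG)).
  by move=> t ht; apply: cU.
by rewrite h subrr.
Qed.

Lemma fsol_transition E U F G b : cvx U -> (forall z, U z -> reg E z) ->
  fsol E U F -> fsol E U G -> U b -> F b \in unitmx ->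
  forall w, U w -> G w = (G b *m invmx (F b)) *m F w.
Proof.
move=> cU rU hF hG Ub h; apply: (fsol_uniq cU rU hG (fsol_mul _ hF) Ub).
by rewrite mulmxKV.
Qed.

(** The left kernel at one point produces solutions that vanish there, hence also at [b], where the
    matrix is invertible. *)
Lemma fsol_unit E U F b : cvx U -> (forall z, U z -> reg E z) ->
  fsol E U F -> U b -> F b \in unitmx -> forall w, U w -> F w \in unitmx.
Proof.
move=> cU rU hF Ub hb w Uw; rewrite -row_free_unit -kermx_eq0; apply/eqP.
set K := kermx _.
have hK : K *m F w = 0 by exact: mulmx_ker.
have h : fsol E U (fun z => K *m F z) by exact: fsol_mul.
have := @fsol_segment0 _ E U _ w b _ rU h hK.
rewrite -[RHS](mul0mx _ (F b)) => k; apply: (can_inj (mulmxK hb)); apply: k => t ht.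
exact: cU.
Qed.

(** The overlap of two convex regions is convex, so agreement at one common point spreads over
    it. *)
Lemma fsol_glue E U V F G c : cvx U -> cvx V -> opn U -> opn V ->
  (forall z, U z -> reg E z) -> U c -> V c -> fsol E U F -> fsol E V G -> F c = G c ->
  exists H, [/\ fsol E (fun z => U z \/ V z) H, forall z, U z -> H z = F z &
    forall z, V z -> H z = G z].
Proof.
move=> cU cV oU oV rU Uc Vc hF hG hc.
pose H z := if `[< U z >] then F z else G z.
have HF z : U z -> H z = F z by move=> /asboolP h; rewrite /H h.
have HG z : V z -> H z = G z.
  move=> Vz; rewrite /H; case: asboolP => // Uz.
  apply: (@fsol_uniq E _ F G c (cvxI cU cV)) => //; first by move=> ? [/rU].
    by apply: fsol_sub hF => ? [].
  by apply: fsol_sub hG => ? [].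
exists H; split=> // w [Uw|Vw].
  by apply: (fsol_ext oU (F := F) _ hF) => // z /HF.
by apply: (fsol_ext oV (F := G) _ hG) => // z /HG.
Qed.

Lemma fsol_local E b : reg E b -> exists2 r : R, 0 < r &
  (forall z, ballC b r z -> reg E z) /\
  exists F, fsol E (ballC b r) F /\ F b = 1%:M.
Proof.
move=> /andP[hp hq].
pose dp := fden (pcoef E); pose dq := fden (qcoef E).
pose sh (p : {poly C}) := p \Po ('X + b%:P).
have shE p z : (sh p).[z - b] = p.[z].
  by rewrite horner_comp hornerD hornerX hornerC subrK.
(* Denominators are cleared and [b] is moved to 0; regularity at [b] makes the leading coefficient
   nonzero there. *)
pose A0 := sh (dp * dq); pose A1 := sh (fnum (pcoef E) * dq).
pose A2 := sh (fnum (qcoef E) * dp).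
have A00 : A0`_0 != 0.
  have e0 : A0.[0] = (dp * dq).[b] by rewrite -(subrr b) shE.
  by rewrite -horner_coef0 e0 hornerM mulf_neq0.
have [r1 [y [y1 [y2 [r10 ya yb hy]]]]] := @local_solution0 _ A0 A1 A2 1 0 A00.
have [r2 [u [u1 [u2 [r20 ua ub hu]]]]] := @local_solution0 _ A0 A1 A2 0 1 A00.
have [r3 r30 h3] := horner_neq0_near hp; have [r4 r40 h4] := horner_neq0_near hq.
pose r := Num.min (Num.min r1 r2) (Num.min r3 r4).
exists r; first by rewrite !lt_min r10 r20 r30 r40.
split; first by move=> z; rewrite /ballC !lt_min => /andP[_ /andP[/h3 ? /h4 ?]]; apply/andP.
pose f (i : 'I_2) := if i == 0 then y else u.
pose f1 (i : 'I_2) := if i == 0 then y1 else u1.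
pose f2 (i : 'I_2) := if i == 0 then y2 else u2.
have sub1 w : cder (fun z : C => z - b) w 1.
  by rewrite -[1]addr0; apply: cderD (cder_id w) _; exact: cder_cst.
exists (fun z => \matrix_(i, j) if j == 0 then f i (z - b) else f1 i (z - b)); split.
  move=> w; rewrite /ballC !lt_min => /andP[/andP[k1 k2] /andP[k3 k4]] i.
  have pw := h3 _ k3; have qw := h4 _ k4.
  have [c1 c2 c3] : [/\ cder (f i) (w - b) (f1 i (w - b)), cder (f1 i) (w - b) (f2 i (w - b)) &
     A0.[w - b] * f2 i (w - b) + A1.[w - b] * f1 i (w - b) + A2.[w - b] * f i (w - b) = 0].
    by rewrite /f /f1 /f2; case: (i == 0); [exact: hy|exact: hu].
  have d1 := cder_comp (sub1 w) c1; have d2 := cder_comp (sub1 w) c2.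
  rewrite !mulr1 in d1 d2; rewrite !mxE /=; split.
    by rewrite (_ : (fun z => _) = fun z => f i (z - b)) //; apply/funext => z; rewrite mxE.
  rewrite (_ : (fun z => _) = fun z => f1 i (z - b)); last by apply/funext => z; rewrite mxE.
  have -> // : - (feval (pcoef E) w * f1 i (w - b) + feval (qcoef E) w * f i (w - b)) = f2 i (w - b).
  move: c3; rewrite !shE !hornerM /feval -/dp -/dq in pw qw * => c3.
  apply: (mulfI (mulf_neq0 pw qw)); rewrite -[RHS]addr0 -[X in _ = _ + X]oppr0 -c3.
  by field; rewrite pw qw.
apply/matrixP => i j; rewrite !mxE subrr /f /f1.
by case: i j => [[|[|//]] hi] [[|[|//]] hj] /=; rewrite ?ya ?yb ?ua ?ub.
Qed.

Lemma fsol_local_data E b : reg E b -> exists2 r : R, 0 < r &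
  (forall z, ballC b r z -> reg E z) /\
  forall w (D : 'M[C]_2), ballC b r w -> exists F, fsol E (ballC b r) F /\ F w = D.
Proof.
move=> /fsol_local [r r0 [rE [F [hF Fb]]]]; exists r => //; split=> // w D hw.
exists (fun z => D *m invmx (F w) *m F z); split; first exact: fsol_mul.
rewrite mulmxKV //; apply: (fsol_unit (@cvx_ball b r) rE hF _ _ hw).
  exact: ballC_center.
by rewrite Fb unitmx1.
Qed.

(** Connectedness of [0, 1] for a locally constant predicate, by the supremum of the initial
    intervals on which it holds. *)
Lemma lconst01 (P : R -> Prop) :
  (forall t : R, 0 <= t <= 1 -> exists2 d : R, 0 < d & forall s : R, 0 <= s <= 1 ->
     `|s - t| < d -> (P s <-> P t)) -> P 0 -> forall t : R, 0 <= t <= 1 -> P t.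
Proof.
move=> h P0.
pose S : set R := [set t | 0 <= t <= 1 /\ forall s : R, 0 <= s <= t -> P s].
have S0 : S 0 by split; [rewrite lexx ler01|move=> s; rewrite -eq_le => /eqP <-].
have hS : has_sup S by split; [exists 0|exists 1 => x [/andP[]]].
have c0 : 0 <= sup S by apply: ub_le_sup => //; case: hS.
have c1 : sup S <= 1 by apply: ge_sup; [case: hS|move=> x [/andP[]]].
have [d d0 hd] := h (sup S) (introT andP (conj c0 c1)).
have [s Ss hs] := sup_adherent d0 hS.
have sle : s <= sup S by apply: ub_le_sup => //; case: hS.
case: (Ss) => /andP[s0 s1] Ps.
have Pc : P (sup S).
  apply/(hd s); first by rewrite s0.
    by rewrite ler0_norm ?subr_le0 // opprB ltrBlDr -ltrBlDl.
  by apply: Ps; rewrite s0 lexx.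
have Pall t : 0 <= t <= 1 -> t < sup S + d -> P t.
  move=> /andP[t0 t1] td; have [ts|st] := leP t s; first by apply: Ps; rewrite t0.
  apply/(hd t) => //; first by rewrite t0.
  by rewrite ltr_norml; apply/andP; split; lra.
have e1 : sup S = 1.
  apply/eqP; rewrite eq_le c1 /= leNgt; apply/negP => c11.
  pose m := Num.min 1 (sup S + d / 2).
  have m1 : m <= 1 by rewrite ge_min lexx.
  have mc : sup S < m by rewrite lt_min c11 ltrDl divr_gt0.
  have : S m.
    split; first by rewrite m1 (le_trans c0) // ltW.
    move=> t /andP[t0 tm]; apply: Pall; first by rewrite t0 (le_trans tm).
    apply: (le_lt_trans tm); rewrite gt_min; apply/orP; right; lra.
  by move=> /(ub_le_sup (proj2 hS)); rewrite leNgt mc.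
move=> t /andP[t0 t1]; apply: Pall; first by rewrite t0.
by rewrite e1; apply: (le_lt_trans t1); rewrite ltrDl.
Qed.

(** A convex neighbourhood of the segment from [b] to [w], so that uniqueness applies on it. *)
Definition tube (b w : C) (e : R) : C -> Prop :=
  fun z => exists2 t : R, 0 <= t <= 1 & nm (z - (b + t%:C * (w - b))) < e.

Lemma cvx_tube b w (e : R) : cvx (tube b w e).
Proof.
move=> z z' t [s hs h] [s' hs' h'] ht.
exists (s + t * (s' - s)); first by nra.
pose g (x : R) := b + x%:C * (w - b).
have := @cvx_ball 0 e (z - g s) (z' - g s') t; rewrite /ballC !subr0 => /(_ h h' ht).
congr (nm _ < _); rewrite /g rmorphD rmorphM rmorphB /=; ring.
Qed.

Lemma opn_tube b w (e : R) : opn (tube b w e).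
Proof.
move=> z [t ht h]; have [r r0 hr] := @opn_ball _ e z h.
by exists r => // z' /hr; exists t.
Qed.

(** The segment is traversed from [b]: having a solution on a tube around the part up to parameter t
    is locally constant in t, because such a solution can be glued to a local one near the end of
    the part. *)
Lemma fsol_tube E b w : (forall t : R, 0 <= t <= 1 -> reg E (b + t%:C * (w - b))) ->
  exists2 e : R, 0 < e & (forall z, tube b w e z -> reg E z) /\
    exists F, fsol E (tube b w e) F /\ F b = 1%:M.
Proof.
move=> hreg; pose g (t : R) := b + t%:C * (w - b).
have gg (s t : R) : b + t%:C * (g s - b) = g (t * s).
  by rewrite /g rmorphM /=; ring.
pose P (t : R) := exists2 e : R, 0 < e & (forall z, tube b (g t) e z -> reg E z) /\
    exists F, fsol E (tube b (g t) e) F /\ F b = 1%:M.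
suff : P 1 by rewrite /P /g mul1r addrC subrK.
have tb (t e : R) : 0 < e -> tube b (g t) e b.
  by move=> e0; exists 0; rewrite ?lexx ?ler01 // mul0r addr0 subrr nm0.
apply: lconst01; last by rewrite lexx ler01.
  move=> t ht; have [r r0 [rE hloc]] := fsol_local_data (hreg t ht).
  have W0 : 0 < nm (w - b) + 1 by rewrite ltr_wpDl ?nm_ge0.
  pose d := r / 2 / (nm (w - b) + 1).
  have d0 : 0 < d by rewrite !divr_gt0.
  have gd (s : R) : `|s - t| < d -> nm (g s - g t) < r / 2.
    rewrite ltr_pdivlMr // => hs; apply: le_lt_trans hs.
    have -> : g s - g t = (s - t)%:C * (w - b) by rewrite /g rmorphB /=; ring.
    by rewrite nmM nm_real ler_wpM2l // lerDl.
  suff key (s s' : R) : 0 <= s <= 1 -> 0 <= s' <= 1 ->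
     `|s - t| < d -> `|s' - t| < d -> P s -> P s'.
    exists d => // s hs hst; split; apply: key => //; by rewrite subrr normr0.
  move=> hs hs' hst hst' [e e0 [rT [F [hF Fb]]]].
  have r2 : 0 < r / 2 by rewrite divr_gt0.
  have gsT : tube b (g s) e (g s).
    by exists 1; rewrite ?lexx ?ler01 // mul1r (addrC b) subrK subrr nm0.
  have gsB : ballC (g t) r (g s).
    by apply: (lt_trans (gd _ hst)); rewrite ltr_pdivrMr // ltr_pMr // ltr1n.
  have [G [hG Gs]] := hloc (g s) (F (g s)) gsB.
  have [|H [hH HF _]] := fsol_glue (@cvx_tube b (g s) e) (@cvx_ball (g t) r) (@opn_tube _ _ _)
     (@opn_ball _ _) rT gsT gsB hF hG; first by rewrite Gs.
  (* A point of the new tube is close to some g(x s'). If x s' <= s it lies in the old tube;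
     otherwise x s' is within [d] of t and the point lies in the ball. *)
  have sub z : tube b (g s') (Num.min e (r / 2)) z -> tube b (g s) e z \/ ballC (g t) r z.
    move=> [x /andP[x0 x1]]; rewrite gg lt_min => /andP[h1 h2].
    move: hs hs' => /andP[s0 s1] /andP[s'0 s'1].
    have [xs|xs] := leP (x * s') s.
      left; have [es|sn] := eqVneq s 0.
        exists 0; first by rewrite lexx ler01.
        by rewrite gg mul0r; move: xs h1; rewrite es => xs; rewrite (@le_anti _ _ (x * s') 0) // xs mulr_ge0.
      have sp : 0 < s by rewrite lt_neqAle eq_sym sn.
      exists (x * s' / s); last by rewrite gg divfK.
      by rewrite divr_ge0 ?mulr_ge0 //= ler_pdivrMr // mul1r.
    right; rewrite /ballC.
    have xt : `|x * s' - t| < d.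
      move: hst hst'; rewrite !ltr_norml => /andP[a1 a2] /andP[a3 a4].
      by apply/andP; split; nra.
    rewrite (_ : z - g t = (z - g (x * s')) + (g (x * s') - g t)); last by ring.
    by apply: (le_lt_trans (nmD _ _)); rewrite (splitr r); apply: ltrD => //; exact: gd.
  exists (Num.min e (r / 2)); first by rewrite lt_min e0.
  split; first by move=> z /sub [/rT|/rE].
  exists H; split; last by rewrite HF //; exact: tb.
  exact: fsol_sub hH.
have [|e e0 [rE [F [hF Fb]]]] := @fsol_local E b.
  by have := hreg 0; rewrite mul0r addr0; apply; rewrite lexx ler01.
have sub z : tube b (g 0) e z -> ballC b e z.
  by move=> [x _]; rewrite gg mulr0 /g mul0r addr0.
exists e => //; split; first by move=> z /sub /rE.
by exists F; split=> //; exact: fsol_sub hF.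
Qed.

(** Each [w] is reached from [b] along a segment, and the value at [w] is that of the solution on
    its tube. Two tubes share [b] and have a convex intersection, so these solutions agree where
    both are defined and form one solution. *)
Lemma fsol_exists E U b (D : 'M[C]_2) : cvx U -> opn U -> (forall z, U z -> reg E z) -> U b ->
  exists F, fsol E U F /\ F b = D.
Proof.
move=> cU oU rU Ub.
suff [F [hF Fb]] : exists F, fsol E U F /\ F b = 1%:M.
  by exists (fun z => D *m F z); split; [exact: fsol_mul|rewrite Fb mulmx1].
have H w : exists eF : R * (C -> 'M[C]_2), U w -> [/\ 0 < eF.1,
   forall z, tube b w eF.1 z -> reg E z, fsol E (tube b w eF.1) eF.2 & eF.2 b = 1%:M].
  have [Uw|] := pselect (U w); last by exists (0, fun=> 0).
  have [|e e0 [rE [F [hF Fb]]]] := @fsol_tube E b w.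
    by move=> t ht; apply/rU/cU.
  by exists (e, F).
have [eF heF] := choice H.
have tb w : U w -> tube b w (eF w).1 b.
  by move=> /heF[e0 _ _ _]; exists 0; rewrite ?lexx ?ler01 // mul0r addr0 subrr nm0.
have tw w : U w -> tube b w (eF w).1 w.
  by move=> /heF[e0 _ _ _]; exists 1; rewrite ?lexx ?ler01 // mul1r (addrC b) subrK subrr nm0.
exists (fun z => (eF z).2 z); split; last by have [] := heF b Ub.
move=> w Uw; have [e0 rT hF Fb] := heF w Uw.
pose V z := tube b w (eF w).1 z /\ U z.
have oV : opn V by apply: opnI => //; exact: opn_tube.
suff : fsol E V (fun z => (eF z).2 z) by apply; split=> //; exact: tw.
apply: (@fsol_ext _ _ (eF w).2) => //; last by apply: fsol_sub hF => z [].
move=> z [zT Uz]; have [e0' rT' hF' Fb'] := heF z Uz.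
apply: (@fsol_uniq E _ _ _ b (cvxI (@cvx_tube b w (eF w).1) (@cvx_tube b z (eF z).1))).
- by move=> x [/rT].
- by apply: fsol_sub hF => x [].
- by apply: fsol_sub hF' => x [].
- by split; exact: tb.
- by rewrite Fb.
- by split=> //; exact: tw.
Qed.

End LinearODE.

(** * Analytic continuation and monodromy in matrix form *)

Section Continuation.
Variable R : realType.
Local Notation C := R[i].
Implicit Types (E : equation R) (F G : C -> 'M[C]_2).

Definition gsol E (w : C) F : Prop := exists2 r : R, 0 < r & fsol E (ballC w r) F.

Definition fundmx (f : 'I_2 -> C -> C) : C -> 'M[C]_2 :=
  fun z => \matrix_(i, j) if j == 0 then f i z else derive1 (f i : R[i]^o -> R[i]^o) z.

Lemma fden_neq0 (f : ratfun R) : fden f != 0.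
Proof.
rewrite /fden; set a := (repr f).1; set b := (repr f).2.
have b0 : b != 0 by exact: denom_ratioP.
by rewrite dvdp_div_eq0 ?dvdp_gcdr.
Qed.

Lemma regP E (z : C) : ordinary E z <-> reg E z.
Proof.
have key (f : ratfun R) : pole_order f z = 0%N <-> (fden f).[z] != 0.
  rewrite /pole_order -rootE root_factor_theorem XsubC_dvd ?fden_neq0 // lt0n negbK.
  by split=> /eqP.
rewrite /ordinary /reg; split; first by move=> [/key -> /key ->].
by move=> /andP[/key h /key h'].
Qed.

Lemma reg_near E (w : C) : reg E w -> exists2 r : R, 0 < r & forall z, ballC w r z -> reg E z.
Proof. by move=> /fsol_local_data [r r0 [h _]]; exists r. Qed.

Lemma gsol_mul E w F (M : 'M[C]_2) : gsol E w F -> gsol E w (fun z => M *m F z).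
Proof. by move=> [r r0 h]; exists r => //; exact: fsol_mul. Qed.

Lemma ballC_min w (r s : R) z : ballC w (Num.min r s) z -> ballC w r z /\ ballC w s z.
Proof. by rewrite /ballC lt_min => /andP. Qed.

Lemma gsol_common E w F G : reg E w -> gsol E w F -> gsol E w G -> exists2 r : R, 0 < r &
  [/\ forall z, ballC w r z -> reg E z, fsol E (ballC w r) F & fsol E (ballC w r) G].
Proof.
move=> /reg_near[r r0 h] [s s0 hF] [t t0 hG].
exists (Num.min r (Num.min s t)); first by rewrite !lt_min r0 s0.
split; first by move=> z /ballC_min[/h].
  by apply: fsol_sub hF => z /ballC_min[_ /ballC_min[]].
by apply: fsol_sub hG => z /ballC_min[_ /ballC_min[]].
Qed.

Lemma gsol_eq_near E w F G : reg E w -> gsol E w F -> gsol E w G ->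
  exists2 r : R, 0 < r & forall z, ballC w r z -> (F z = G z <-> F w = G w).
Proof.
move=> rw hF hG; have [r r0 [rE fF fG]] := gsol_common rw hF hG.
exists r => // z hz; split=> h.
  apply: (fsol_uniq (@cvx_ball _ w r) rE fF fG hz h); exact: ballC_center.
exact: (fsol_uniq (@cvx_ball _ w r) rE fF fG (ballC_center w r0) h hz).
Qed.

Definition pcont (gam : R -> C) : Prop := forall t : R, 0 <= t <= 1 -> forall e : R, 0 < e ->
  exists2 d : R, 0 < d & forall s : R, 0 <= s <= 1 -> `|s - t| < d -> nm (gam s - gam t) < e.

Lemma pcontP (gam : R -> R[i]^o) : {within `[0, 1], continuous gam} <-> pcont gam.
Proof.
have itv (t : R) : t \in `[0%R, 1%R] = (0 <= t <= 1) by rewrite in_itv.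
rewrite subspace_continuousP; split=> h t.
  move=> ht e e0; have := h t; rewrite /= itv => /(_ ht).
  move=> /cvgrPdist_lt /(_ e%:C); rewrite ltcR => /(_ e0) /nearR [d d0 hd].
  exists d => // s hs hst.
  by have := hd s hst; rewrite /= itv => /(_ hs); rewrite distrC nmE ltcR.
rewrite /= itv => ht; apply/cvgrPdist_lt => -[e e']; rewrite ltcE /= => /andP[/eqP -> e0].
have [d d0 hd] := h t ht e e0.
apply/nearR; exists d => // s hst; rewrite /= itv => hs.
by rewrite distrC nmE -[e +i* 0]/(e%:C) ltcR; exact: hd.
Qed.

(** [G] is a choice of fundamental germs along the path whose jumps lie in the group [H], and [Y] is
    a true continuation. That Y(t) = D A G(t) for some A in [H] is locally constant in t, so it
    holds at the end. *)
Lemma loop_transport E (gam : R -> C) (H : 'M[C]_2 -> Prop) (G Y : R -> C -> 'M[C]_2) (D : 'M[C]_2) :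
  pcont gam -> (forall t : R, 0 <= t <= 1 -> reg E (gam t)) ->
  H 1%:M -> (forall A B, H A -> H B -> H (A *m B)) ->
  (forall A, H A -> A \in unitmx /\ H (invmx A)) ->
  (forall t : R, 0 <= t <= 1 -> gsol E (gam t) (G t)) ->
  (forall t : R, 0 <= t <= 1 -> gsol E (gam t) (Y t)) ->
  (forall t : R, 0 <= t <= 1 -> exists2 d : R, 0 < d & forall s : R, 0 <= s <= 1 -> `|s - t| < d ->
     exists2 A, H A & G s (gam s) = A *m G t (gam s)) ->
  (forall t : R, 0 <= t <= 1 -> exists2 d : R, 0 < d & forall s : R, 0 <= s <= 1 -> `|s - t| < d ->
     Y s (gam s) = Y t (gam s)) ->
  Y 0 (gam 0) = D *m G 0 (gam 0) ->
  exists2 A, H A & Y 1 (gam 1) = D *m A *m G 1 (gam 1).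
Proof.
move=> cg rg H1 HM HV gG gY lG lY Y0.
pose P t := exists2 A, H A & Y t (gam t) = D *m A *m G t (gam t).
suff : P 1 by [].
apply: (@lconst01 _ P); last by rewrite lexx ler01.
  move=> t ht; have [d1 d10 h1] := lG t ht; have [d2 d20 h2] := lY t ht.
  have [r r0 [rE fG fY]] := gsol_common (rg t ht) (gG t ht) (gY t ht).
  have [d3 d30 h3] := cg t ht r r0.
  exists (Num.min d1 (Num.min d2 d3)); first by rewrite !lt_min d10 d20.
  move=> s hs; rewrite !lt_min => /and3P[k1 k2 k3].
  have [B HB eB] := h1 s hs k1; have eY := h2 s hs k2.
  have hb : ballC (gam t) r (gam s) := h3 s hs k3.
  have hc := ballC_center (gam t) r0.
  have [uB HiB] := HV _ HB.
  have fs (A : 'M[C]_2) := fsol_mul A fG.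
  split=> -[A HA eA].
    exists (A *m B); first exact: HM.
    apply: (fsol_uniq (@cvx_ball _ (gam t) r) rE fY (fs _) hb _ hc).
    by rewrite -eY eA eB !mulmxA.
  exists (A *m invmx B); first exact: HM.
  rewrite eB eY mulmxA -[D *m _ *m B]mulmxA mulmxKV //.
  exact: (fsol_uniq (@cvx_ball _ (gam t) r) rE fY (fs _) hc eA hb).
by exists 1%:M => //; rewrite mulmx1.
Qed.

Lemma ord2_ind (P : 'I_2 -> Prop) : P 0 -> P 1 -> forall i, P i.
Proof.
move=> h0 h1 [[|[|//]] hi].
  by rewrite (_ : Ordinal hi = 0) //; apply: val_inj.
by rewrite (_ : Ordinal hi = 1) //; apply: val_inj.
Qed.

Lemma fundmx0 (f : 'I_2 -> C -> C) (z : C) i : fundmx f z i 0 = f i z.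
Proof. by rewrite mxE. Qed.

Lemma fundmx1 (f : 'I_2 -> C -> C) (z : C) i :
  fundmx f z i 1 = derive1 (f i : R[i]^o -> R[i]^o) z.
Proof. by rewrite mxE. Qed.

Lemma mx2P (A B : 'M[C]_2) : (forall i, A i 0 = B i 0) -> (forall i, A i 1 = B i 1) -> A = B.
Proof. by move=> h0 h1; apply/matrixP => i; apply: ord2_ind. Qed.

Lemma derive1_near (f g : C -> C) (z : C) :
  (exists2 r : R, 0 < r & forall w, nm (w - z) < r -> f w = g w) ->
  derive1 (f : R[i]^o -> R[i]^o) z = derive1 (g : R[i]^o -> R[i]^o) z.
Proof. by move=> /nearC h; rewrite !derive1E; exact: near_eq_derive. Qed.

Lemma fundmx_eq (f g : 'I_2 -> C -> C) (z : C) :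
  (forall i, exists2 r : R, 0 < r & forall w, nm (w - z) < r -> f i w = g i w) ->
  fundmx f z = fundmx g z.
Proof.
move=> h; apply: mx2P => i.
  have [r r0 hr] := h i.
  apply: (etrans (fundmx0 f z i)); apply: (etrans _ (esym (fundmx0 g z i))).
  by apply: hr; rewrite subrr nm0.
apply: (etrans (fundmx1 f z i)); apply: (etrans _ (esym (fundmx1 g z i))).
exact: (derive1_near (h i)).
Qed.

Lemma sum2E (M : 'M[C]_2) (f : 'I_2 -> C -> C) (w : C) i :
  (M *m fundmx f w) i 0 = \sum_j M i j * f j w.
Proof. by rewrite mxE; apply: eq_bigr => j _; rewrite mxE. Qed.

Lemma gsol_fundmx E (f : 'I_2 -> C -> C) (b : C) :
  (forall i, local_solution E (f i) b) <-> gsol E b (fundmx f).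
Proof.
have e0 i : (fun z => fundmx f z i 0) = f i by apply/funext => z; exact: fundmx0.
have e1 i : (fun z => fundmx f z i 1) = derive1 (f i : R[i]^o -> R[i]^o).
  by apply/funext => z; exact: fundmx1.
split.
  move=> h; have := h 0 => /nearC[r r0 h0]; have := h 1 => /nearC[s s0 h1].
  exists (Num.min r s); first by rewrite lt_min r0.
  move=> w /ballC_min[wr ws] i.
  have [a1 a2 a3] : [/\ derivable (f i : R[i]^o -> R[i]^o) w 1,
     derivable (derive1 (f i : R[i]^o -> R[i]^o)) w 1 &
        derive1 (derive1 (f i : R[i]^o -> R[i]^o)) w + feval (pcoef E) w * derive1 (f i : R[i]^o -> R[i]^o) w
        + feval (qcoef E) w * f i w = 0].
    by move: i; apply: ord2_ind; [exact: h0|exact: h1].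
  rewrite e0 e1 fundmx0 fundmx1; split; first exact/(cderP (f i : R[i]^o -> R[i]^o)).
  apply/(cderP (derive1 (f i : R[i]^o -> R[i]^o))); split; first exact: a2.
  by move/eqP: a3; rewrite -addrA addr_eq0 => /eqP ->.
move=> [r r0 h] i; apply/nearC; exists r => // w hw.
have [] := h w hw i; rewrite e0 e1 fundmx0 fundmx1.
move=> /(cderP (f i : R[i]^o -> R[i]^o)) [d1 _] /(cderP (derive1 (f i : R[i]^o -> R[i]^o))) [d2 e2].
split; [exact: d1|exact: d2|rewrite e2; ring].
Qed.

Lemma fundmx_near (w : C) (f : 'I_2 -> C -> C) (F : C -> 'M[C]_2) (r : R) E :
  fsol E (ballC w r) F -> (forall z, ballC w r z -> forall i, f i z = F z i 0) ->
  forall z, ballC w r z -> fundmx f z = F z.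
Proof.
move=> hF hf z hz; apply: mx2P => i; first by rewrite fundmx0 hf.
have [c1 _] := hF z hz i; have [s s0 hs] := opn_ball hz.
have : cder (f i) z (F z i 1).
  by apply: cder_ext c1; exists s => // z' /hs h; rewrite hf.
by move=> /(cderP (f i : R[i]^o -> R[i]^o)) [_ <-]; rewrite fundmx1.
Qed.

(** Independence of two solutions is nonvanishing of their Wronskian, the determinant of
    [fundmx f b]: by uniqueness a linear relation between the rows at [b] persists nearby. *)
Lemma solution_basisP E (b : C) (f : 'I_2 -> C -> C) : reg E b ->
  solution_basis E b f <-> gsol E b (fundmx f) /\ fundmx f b \in unitmx.
Proof.
move=> rb; split.
  move=> [/gsol_fundmx hf hi]; split=> //.
  rewrite -row_free_unit -kermx_eq0; apply/eqP/row_matrixP => k; rewrite row0.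
  set v := row k _.
  have hv : v *m fundmx f b = 0 by apply/sub_kermxP; exact: row_sub.
  (* The row vector is repeated, since solutions are handled as 2 x 2 matrices. *)
  pose M : 'M[C]_2 := \matrix_(i, j) v 0 j.
  have hM : M *m fundmx f b = 0 *m fundmx f b.
    rewrite mul0mx; apply/matrixP => i j; transitivity ((v *m fundmx f b) 0 j).
      by rewrite [LHS]mxE [RHS]mxE; apply: eq_bigr => l _; rewrite [M i l]mxE.
    by rewrite hv [LHS]mxE [RHS]mxE.
  have [r r0 [rE fF fG]] := gsol_common rb (gsol_mul M hf) (gsol_mul 0 hf).
  have h0 := fsol_uniq (@cvx_ball _ b r) rE fF fG (ballC_center b r0) hM.
  apply/rowP => j; rewrite [RHS]mxE; apply: (hi (fun j => v 0 j)).
  apply/nearC; exists r => // w /h0 hw.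
  transitivity ((M *m fundmx f w) 0 0); last by rewrite hw mul0mx mxE.
  by rewrite sum2E; apply: eq_bigr => l _; rewrite [M _ _]mxE.
move=> [hg hu]; split; first exact/gsol_fundmx.
move=> a /nearC[r r0 ha].
have [s s0 hs] := hg.
pose M : 'M[C]_2 := \matrix_(i, j) a j.
have f1 : fsol E (ballC b (Num.min r s)) (fun z => M *m fundmx f z).
  by apply: fsol_sub (fsol_mul M hs) => z /ballC_min[].
have hz : forall z, ballC b (Num.min r s) z -> forall i, (fun _ => cst 0) i z = (M *m fundmx f z) i 0.
  move=> z /ballC_min[/ha e _] i; rewrite sum2E -[LHS]e.
  by apply: eq_bigr => j _; rewrite mxE.
have := fundmx_near f1 hz (ballC_center b (_ : 0 < Num.min r s)).
rewrite lt_min r0 s0 => /(_ isT) e.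
have : M = 0.
  apply: (can_inj (mulmxK hu)); rewrite -e mul0mx.
  apply: mx2P => i; first by rewrite fundmx0 mxE.
  rewrite fundmx1 [RHS]mxE; exact: (derive1_cst (0 : R[i]^o) (b : R[i]^o)).
by move=> /matrixP h j; have := h 0 j; rewrite !mxE.
Qed.

Lemma continuationE E (gam : R -> C) (Y : 'I_2 -> R -> C -> C) :
  (forall i, continuation E gam (Y i)) -> forall t : R, 0 <= t <= 1 ->
  gsol E (gam t) (fundmx (fun i => Y i t)) /\
  exists2 d : R, 0 < d & forall s : R, 0 <= s <= 1 -> `|s - t| < d ->
     fundmx (fun i => Y i s) (gam s) = fundmx (fun i => Y i t) (gam s).
Proof.
have itv (t : R) : t \in `[0%R, 1%R] = (0 <= t <= 1) by rewrite in_itv.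
move=> h t ht; split; first by apply/gsol_fundmx => i; case: (h i t); rewrite ?itv.
have [|_ /nearR[d0 d00 h0]] := h 0 t; first by rewrite itv.
have [|_ /nearR[d1 d10 h1]] := h 1 t; first by rewrite itv.
exists (Num.min d0 d1); first by rewrite lt_min d00.
move=> s hs; rewrite lt_min => /andP[k0 k1].
apply: fundmx_eq => i; apply/nearC.
by move: i; apply: ord2_ind; [apply: h0|apply: h1]; rewrite // itv.
Qed.

Lemma monodromy_alongE E (gam : R -> C) (f : 'I_2 -> C -> C) (M : 'M[C]_2) :
  gsol E (gam 0) (fundmx f) -> monodromy_along E gam f M ->
  [/\ pcont gam, gam 0 = gam 1, forall t : R, 0 <= t <= 1 -> reg E (gam t) &
   exists Y : R -> C -> 'M[C]_2, [/\ (forall t : R, 0 <= t <= 1 -> gsol E (gam t) (Y t)),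
     (forall t : R, 0 <= t <= 1 -> exists2 d : R, 0 < d & forall s : R, 0 <= s <= 1 -> `|s - t| < d ->
     Y s (gam s) = Y t (gam s)),
     Y 0 (gam 0) = fundmx f (gam 0) & Y 1 (gam 1) = M *m fundmx f (gam 1)]].
Proof.
have itv (t : R) : t \in `[0%R, 1%R] = (0 <= t <= 1) by rewrite in_itv.
move=> hf [[/pcontP cg e01 og] [Y hY]].
have rg (t : R) : 0 <= t <= 1 -> reg E (gam t) by move=> ht; apply/regP/og; rewrite itv.
have hc i : continuation E gam (Y i) by case: (hY i).
split=> //; exists (fun t => fundmx (fun i => Y i t)); split.
- by move=> t /(continuationE hc)[].
- by move=> t /(continuationE hc)[].
- by apply: fundmx_eq => i; have [_ /nearC h _] := hY i; exact: h.
have e i : \forall w \near (gam 1 : R[i]^o), Y i 1 w = \sum_j M i j * f j w by case: (hY i).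
have /nearC[r0 r00 h0] := e 0; have /nearC[r1 r10 h1] := e 1.
rewrite e01 in hf; have [r2 r20 h2] := gsol_mul M hf.
pose r := Num.min r2 (Num.min r0 r1).
have rp : 0 < r by rewrite !lt_min r00 r10 r20.
apply: (@fundmx_near (gam 1) _ (fun z => M *m fundmx f z) r E) (ballC_center _ rp).
  by apply: fsol_sub h2 => z /ballC_min[].
move=> z /ballC_min[_ /ballC_min[z0 z1]] i; rewrite sum2E.
by move: i; apply: ord2_ind; [exact: h0|exact: h1].
Qed.

(** Equality of values along the path suffices, because solutions with equal values at a regular
    point have equal germs. *)
Lemma monodromy_along_intro E (gam : R -> C) (G : R -> C -> 'M[C]_2) (M : 'M[C]_2) :
  pcont gam -> gam 0 = gam 1 -> (forall t : R, 0 <= t <= 1 -> reg E (gam t)) ->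
  (forall t : R, 0 <= t <= 1 -> gsol E (gam t) (G t)) ->
  (forall t : R, 0 <= t <= 1 -> exists2 d : R, 0 < d & forall s : R, 0 <= s <= 1 -> `|s - t| < d ->
     G s (gam s) = G t (gam s)) ->
  G 1 (gam 1) = M *m G 0 (gam 1) ->
  monodromy_along E gam (fun i z => G 0 z i 0) M.
Proof.
have itv (t : R) : t \in `[0%R, 1%R] = (0 <= t <= 1) by rewrite in_itv.
move=> cg e01 rg gG lG hM; split.
  split=> //; first exact/pcontP.
  by move=> t; rewrite itv => ht; apply/regP/rg.
exists (fun i t z => G t z i 0) => i.
have h01 : 0 <= (0 : R) <= 1 by apply/andP; split; [exact: lexx|exact: ler01].
have h11 : 0 <= (1 : R) <= 1 by apply/andP; split; [exact: ler01|exact: lexx].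
split.
- move=> t; rewrite itv => ht; split.
    have [r r0 hr] := gG t ht.
    apply: ((@gsol_fundmx E (fun i z => G t z i 0) (gam t)).2 _ i); exists r => //.
    have e := fundmx_near hr (f := fun i z => G t z i 0) (fun z _ j => erefl).
    by apply: (fsol_ext (@opn_ball _ (gam t) r) _ hr) => z /e.
  have [d1 d10 h1] := lG t ht; have [r r0 [rE fG _]] := gsol_common (rg t ht) (gG t ht) (gG t ht).
  have [d2 d20 h2] := cg t ht r r0.
  apply/nearR; exists (Num.min d1 d2); first by rewrite lt_min d10.
  move=> s; rewrite lt_min itv => /andP[k1 k2] hs.
  have [r' r'0 hr'] := opn_ball (h2 s hs k2).
  have gt : gsol E (gam s) (G t) by exists r' => //; exact: fsol_sub fG.
  have [q q0 hq] := gsol_eq_near (rg s hs) (gG s hs) gt.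
  apply/nearC; exists q => // z /hq h.
  by have /h -> := h1 s hs k1.
- by apply/nearC; exists 1.
have g0 : gsol E (gam 1) (fun z => M *m G 0 z) by apply: gsol_mul; rewrite -e01; exact: gG.
have [q q0 hq] := gsol_eq_near (rg 1 h11) (gG 1 h11) g0.
apply/nearC; exists q => // z /hq h; have /h -> := hM.
by rewrite mxE.
Qed.

End Continuation.

(** * Rational functions compared through their values *)

Section RationalEvaluation.
Variable R : realType.
Local Notation C := R[i].
Local Notation tofrac := (@FracField.tofrac {poly R[i]}).
Implicit Types (f g : ratfun R) (F G : C -> C).

Lemma poly_nonroot (K : numDomainType) (p : {poly K}) : p != 0 -> exists z, p.[z] != 0.
Proof.
move=> p0; apply: contrapT => h.
have hz z : root p z by apply/rootP/eqP; apply: contrapT => k; apply: h; exists z; exact/negP.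
pose rs : seq K := [seq n%:R | n <- iota 0 (size p)].
have : (size rs < size p)%N.
  apply: max_poly_roots => //; first by apply/allP => x _; exact: hz.
  rewrite map_inj_uniq ?iota_uniq // => m n /eqP; rewrite eqr_nat; exact/eqP.
by rewrite size_map size_iota ltnn.
Qed.

(** The exceptional finite set is given as the zeros of a polynomial, so that conjunction amounts to
    a product. *)
Definition cofin (P : C -> Prop) : Prop :=
  exists2 D : {poly C}, D != 0 & forall z, D.[z] != 0 -> P z.

Lemma cofinT (P : C -> Prop) : (forall z, P z) -> cofin P.
Proof. by move=> h; exists 1; [exact: oner_neq0|move=> z _; exact: h]. Qed.

Lemma cofin_poly (D : {poly C}) : D != 0 -> cofin (fun z => D.[z] != 0).
Proof. by exists D. Qed.

Lemma cofinS (P Q : C -> Prop) : (forall z, P z -> Q z) -> cofin P -> cofin Q.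
Proof. by move=> h [D D0 hD]; exists D => // z /hD /h. Qed.

Lemma cofinI (P Q : C -> Prop) : cofin P -> cofin Q -> cofin (fun z => P z /\ Q z).
Proof.
move=> [D D0 hD] [D' D'0 hD']; exists (D * D'); first exact: mulf_neq0.
by move=> z; rewrite hornerM mulf_eq0 negb_or => /andP[/hD ? /hD'].
Qed.

Lemma cofin_ex (P : C -> Prop) : cofin P -> exists z, P z.
Proof. by move=> [D /poly_nonroot[z hz] hD]; exists z; exact: hD. Qed.

Lemma cofin_punctured (P : C -> Prop) w : cofin P -> exists2 r : R, 0 < r &
  forall z, ballC w r z -> z != w -> P z.
Proof.
by move=> [D /(horner_punctured w)[r r0 h] hD]; exists r => // z hz zw; apply/hD/h.
Qed.

Lemma cofin_nbhs (P : C -> Prop) : cofin P ->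
  cofin (fun w => exists2 r : R, 0 < r & forall z, ballC w r z -> P z).
Proof.
move=> [D D0 hD]; exists D => // w /horner_neq0_near[r r0 h].
by exists r => // z /h /hD.
Qed.

Lemma tofrac_neq0 (p : {poly C}) : p != 0 -> tofrac p != 0.
Proof. by rewrite tofrac_eq0. Qed.

Lemma ratfun_repr f : f = tofrac (repr f).1 / tofrac (repr f).2.
Proof.
have d0 : (repr f).2 != 0 by exact: denom_ratioP.
apply/eqP; rewrite -subr_eq0 -(mulIr_eq0 _ (mulIf (tofrac_neq0 d0))) mulrBl divfK ?tofrac_neq0 //.
rewrite subr_eq0; apply/eqP.
rewrite -{1}[f]reprK !piE; apply/eqmodP; rewrite /= FracField.equivfE.
rewrite /FracField.mulf !numden_Ratio ?mulr1 ?oner_neq0 //.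
by rewrite mulrC.
Qed.

Lemma ratfun_numden f : f = tofrac (fnum f) / tofrac (fden f).
Proof.
rewrite {1}[f]ratfun_repr /fnum /fden; set a := (repr f).1; set b := (repr f).2.
have b0 : b != 0 by exact: denom_ratioP.
have g0 : gcdp a b != 0 by rewrite gcdp_eq0 negb_and b0 orbT.
have d0 : b %/ gcdp a b != 0 by exact: fden_neq0 f.
have := divpK (dvdp_gcdr a b); have := divpK (dvdp_gcdl a b).
move: (gcdp a b) g0 d0 => g g0 d0 ea eb.
apply/eqP; rewrite eqr_div ?tofrac_neq0 // -!tofracM tofrac_eq -{1}ea -{2}eb.
by rewrite -mulrA [g * _]mulrC.
Qed.

Lemma coprime_numden f : coprimep (fnum f) (fden f).
Proof.
rewrite /fnum /fden; set a := (repr f).1; set b := (repr f).2.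
have b0 : b != 0 by exact: denom_ratioP.
by rewrite coprimep_div_gcd // b0 orbT.
Qed.

Lemma fnum_fden_neq0 f z : (fden f).[z] = 0 -> (fnum f).[z] != 0.
Proof.
move=> h; apply/negP => /eqP h'.
by have := coprimep_root (coprime_numden f); move=> /(_ z) /=; rewrite rootE h' eqxx h eqxx; move/(_ isT).
Qed.

(** The rational function [f] has the values of [F] off a finite set. Identities between rational
    functions are obtained by computing with values and concluding by [rep_uniq]; poles fall into
    the exceptional sets. *)
Definition rep f F : Prop := cofin (fun z => (fden f).[z] != 0 /\ feval f z = F z).

Lemma rep_feval f : rep f (feval f).
Proof. by exists (fden f); [exact: fden_neq0|]. Qed.

Lemma rep_ext f F G : rep f F -> cofin (fun z => F z = G z) -> rep f G.
Proof. by move=> h k; apply: cofinS (cofinI h k) => z [[? ->] ->]. Qed.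

Lemma rep_frac f (a b : {poly C}) : b != 0 -> f = tofrac a / tofrac b ->
  rep f (fun z => a.[z] / b.[z]).
Proof.
move=> b0 e; exists (b * fden f); first by rewrite mulf_neq0 ?fden_neq0.
move=> z; rewrite hornerM mulf_eq0 negb_or => /andP[hb hd]; split=> //.
have : fnum f * b = a * fden f.
  apply/eqP; rewrite -tofrac_eq !tofracM; apply/eqP.
  have := e; rewrite [LHS]ratfun_numden => /eqP.
  by rewrite eqr_div ?tofrac_neq0 ?fden_neq0 // => /eqP.
move=> /(congr1 (fun p : {poly C} => p.[z])); rewrite !hornerM => h.
by rewrite /feval; apply/eqP; rewrite eqr_div // h.
Qed.

Lemma rep_poly (a : {poly C}) : rep (tofrac a) (fun z => a.[z]).
Proof.
apply: (rep_ext (@rep_frac _ a 1 (oner_neq0 _) _)); first by rewrite tofrac1 divr1.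
by apply: cofinT => z; rewrite hornerC divr1.
Qed.

Lemma rep_const (c : C) : rep (fconst c) (fun=> c).
Proof. by apply: (rep_ext (rep_poly _)); apply: cofinT => z; rewrite hornerC. Qed.

Lemma rep_add f g F G : rep f F -> rep g G -> rep (f + g) (fun z => F z + G z).
Proof.
move=> hf hg.
have b0 := fden_neq0 f; have d0 := fden_neq0 g.
have h : rep (f + g) (fun z => (fnum f * fden g + fnum g * fden f).[z] / (fden f * fden g).[z]).
  apply: rep_frac; first exact: mulf_neq0.
  rewrite {1}[f]ratfun_numden {1}[g]ratfun_numden tofracD !tofracM.
  by rewrite addf_div ?tofrac_neq0.
apply: (rep_ext h); apply: cofinS (cofinI hf hg) => z [[h1 <-] [h2 <-]].
by rewrite /feval hornerD !hornerM; field; rewrite h1 h2.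
Qed.

Lemma rep_mul f g F G : rep f F -> rep g G -> rep (f * g) (fun z => F z * G z).
Proof.
move=> hf hg.
have b0 := fden_neq0 f; have d0 := fden_neq0 g.
have h : rep (f * g) (fun z => (fnum f * fnum g).[z] / (fden f * fden g).[z]).
  apply: rep_frac; first exact: mulf_neq0.
  by rewrite {1}[f]ratfun_numden {1}[g]ratfun_numden !tofracM mulf_div.
apply: (rep_ext h); apply: cofinS (cofinI hf hg) => z [[h1 <-] [h2 <-]].
by rewrite /feval !hornerM; field; rewrite h1 h2.
Qed.

Lemma rep_opp f F : rep f F -> rep (- f) (fun z => - F z).
Proof.
move=> hf; have h := rep_mul (rep_const (-1)) hf.
have e : fconst (-1) = -1 :> ratfun R by rewrite /fconst polyCN tofracN tofrac1.
rewrite e mulN1r in h.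
by apply: (rep_ext h); apply: cofinT => z; rewrite mulN1r.
Qed.

Lemma rep_inv f F : rep f F -> rep f^-1 (fun z => (F z)^-1).
Proof.
move=> hf; have [a0|a0] := eqVneq (fnum f) 0.
  have f0 : f = 0 by rewrite [f]ratfun_numden a0 tofrac0 mul0r.
  have e0 : (0 : ratfun R) = tofrac 0 by rewrite tofrac0.
  rewrite f0 invr0 e0; apply: (rep_ext (rep_poly 0)).
  apply: cofinS hf => z [_ <-]; rewrite /feval a0 !horner0 mul0r invr0 //.
have h : rep f^-1 (fun z => (fden f).[z] / (fnum f).[z]).
  by apply: rep_frac => //; rewrite {1}[f]ratfun_numden invf_div.
apply: (rep_ext h); apply: cofinS hf => z [_ <-].
by rewrite /feval invf_div.
Qed.

(** The cross products of numerators and denominators agree off a finite set, hence as polynomials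
    over an infinite field. *)
Lemma rep_uniq f g F : rep f F -> rep g F -> f = g.
Proof.
move=> hf hg.
have b0 := fden_neq0 f; have d0 := fden_neq0 g.
have e : fnum f * fden g = fnum g * fden f.
  have [D D0 hD] := cofinI hf hg.
  apply/eqP; rewrite -subr_eq0; apply: contrapT => /negP h.
  have [z] := poly_nonroot (mulf_neq0 D0 h).
  rewrite hornerM mulf_eq0 negb_or => /andP[/hD[[h1 e1] [h2 e2]]].
  rewrite hornerD hornerN !hornerM subr_eq0 => /negP; apply.
  by rewrite -eqr_div //; apply/eqP; rewrite -/(feval f z) -/(feval g z) e1 e2.
rewrite [f]ratfun_numden [g]ratfun_numden; apply/eqP.
by rewrite eqr_div ?tofrac_neq0 // -!tofracM e.
Qed.

Lemma rep_fcomp f g G : rep g G -> rep (fcomp f g) (fun z => feval f (G z)).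
Proof.
move=> hg.
have key (p : {poly C}) : rep (map_poly (@fconst R) p).[g] (fun z => p.[G z]).
  elim/poly_ind: p => [|p c ih].
    rewrite map_poly0 horner0 -tofrac0; apply: (rep_ext (rep_poly 0)).
    by apply: cofinT => z; rewrite !horner0.
  have -> : map_poly (@fconst R) (p * 'X + c%:P) = map_poly (@fconst R) p * 'X + (fconst c)%:P.
    apply/polyP => i; rewrite coef_map_id0 ?/fconst ?polyC0 ?tofrac0 //.
    rewrite !coefD !coefMX !coefC coef_map_id0 ?polyC0 ?tofrac0 //.
    by case: eqP => _; rewrite ?polyC0 ?tofrac0 ?add0r ?addr0.
  rewrite hornerMXaddC; apply: (rep_ext (rep_add (rep_mul ih hg) (rep_const c))).
  by apply: cofinT => z; rewrite hornerMXaddC.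
exact: rep_mul (key _) (rep_inv (key _)).
Qed.

Lemma feval_cder_fderiv f z : (fden f).[z] != 0 ->
  cder (feval f) z (((fnum f)^`() * fden f - fnum f * (fden f)^`()).[z] / (fden f).[z] ^+ 2).
Proof.
move=> h; have := cderM (cder_horner (fnum f) z) (cderV h (cder_horner (fden f) z)).
by congr (cder _ _ _); rewrite hornerD hornerN !hornerM; field.
Qed.

Lemma rep_fderiv f F F1 : rep f F -> cofin (fun z => cder F z (F1 z)) -> rep (fderiv f) F1.
Proof.
move=> hf hF.
have d0 : fden f ^+ 2 != 0 by rewrite expf_neq0 ?fden_neq0.
apply: (rep_ext (rep_frac d0 (erefl _))).
apply: cofinS (cofinI (cofin_nbhs hf) hF) => z [[r r0 h] hz].
have [hd _] := h z (ballC_center z r0).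
rewrite horner_exp; apply: cder_uniq (feval_cder_fderiv hd) _.
by apply: cder_ext hz; exists r => // w /h [_ ->].
Qed.

Lemma cofin_cder f F : rep f F -> cofin (fun z => cder F z (feval (fderiv f) z)).
Proof.
move=> hf.
have d0 : fden f ^+ 2 != 0 by rewrite expf_neq0 ?fden_neq0.
have h1 := rep_frac d0 (erefl (fderiv f)).
apply: cofinS (cofinI (cofin_nbhs hf) h1) => z [[r r0 h] [_ hz]].
have [hd _] := h z (ballC_center z r0).
have := feval_cder_fderiv hd; rewrite -horner_exp -hz => h2.
by apply: cder_ext h2; exists r => // w /h [_ ->].
Qed.

Local Notation nonconst := (@ramified_covering R).

Lemma nonconstP f : nonconst f <-> forall c, f <> fconst c.
Proof.
rewrite /ramified_covering /fdegree; split.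
  move=> h c e; move: h.
  have h : fnum f = c *: fden f.
    have := rep_const c; rewrite -e => hc.
    have := cofinI (rep_feval f) hc => -[D D0 hD].
    apply/eqP; rewrite -subr_eq0; apply: contrapT => /negP h.
    have [z] := poly_nonroot (mulf_neq0 D0 h).
    rewrite hornerM mulf_eq0 negb_or => /andP[/hD[[h1 _] [_ e2]]].
    by rewrite hornerD hornerN hornerZ -e2 /feval divfK // subrr eqxx.
  have := coprime_numden f; rewrite h.
  have [c0|c0] := eqVneq c 0.
    rewrite c0 scale0r coprime0p -size_poly_eq1 size_poly0 => /eqP ->.
    by rewrite maxnn.
  rewrite size_scale // coprimepZl // coprimepp => /eqP ->.
  by [].
move=> h; rewrite lt0n; apply/negP => /eqP h0.
have [a0 b0] : (size (fnum f) <= 1)%N /\ (size (fden f) <= 1)%N by lia.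
apply: (h ((fnum f)`_0 / (fden f)`_0)).
rewrite [LHS]ratfun_numden (size1_polyC a0) (size1_polyC b0) !coefC /= /fconst.
rewrite polyCM tofracM; congr (_ * _).
have b00 : (fden f)`_0 != 0.
  by have := fden_neq0 f; rewrite {1}(size1_polyC b0) polyC_eq0.
apply: (mulfI (tofrac_neq0 (_ : ((fden f)`_0)%:P != 0))); first by rewrite polyC_eq0.
by rewrite divff ?tofrac_neq0 ?polyC_eq0 // -tofracM -polyCM mulfV // tofrac1.
Qed.

Lemma nonconst_fiber f (c : C) : nonconst f -> fnum f - c *: fden f != 0.
Proof.
move=> /nonconstP h; rewrite subr_eq0; apply/eqP => e; apply: (h c).
rewrite [LHS]ratfun_numden e -mul_polyC tofracM mulfK // tofrac_neq0 ?fden_neq0 //.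
Qed.

(** A nonconstant rational function takes each value finitely often. *)
Lemma cofin_comp f (P : C -> Prop) : nonconst f -> cofin P -> cofin (fun z => P (feval f z)).
Proof.
move=> hf [D D0 hD].
have [rs e] := closed_field_poly_normal D.
suff : cofin (fun z => D.[feval f z] != 0) by apply: cofinS => z /hD.
have l0 : lead_coef D != 0 by rewrite lead_coef_eq0.
suff H : cofin (fun z => (\prod_(x <- rs) ('X - x%:P)).[feval f z] != 0).
  by apply: cofinS H => z hz; rewrite e hornerZ mulf_neq0.
elim: rs {e} => [|x rs ih]; first by apply: cofinT => z; rewrite big_nil hornerC oner_neq0.
have h := cofinI (cofin_poly (nonconst_fiber x hf)) (cofin_poly (fden_neq0 f)).
apply: cofinS (cofinI h ih) => z [[h1 h2] h3]; rewrite big_cons hornerM mulf_neq0 //.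
rewrite hornerXsubC subr_eq0; apply: contraNneq h1 => h4.
by rewrite hornerD hornerN hornerZ -h4 /feval divfK // subrr.
Qed.

Lemma rep_comp f g F G : nonconst g -> rep g G -> rep f F -> rep (fcomp f g) (fun z => F (G z)).
Proof.
move=> ng hg hf; apply: (rep_ext (rep_fcomp f hg)).
apply: cofinS (cofinI hg (cofin_comp ng hf)) => z [[_ <-]] [_ ->] //.
Qed.

(** If a / b is in lowest terms and a' b = a b', then a divides a' and b divides b', so both are
    constant by degree. *)
Lemma fderiv_nonconst f : nonconst f -> cofin (fun z => feval (fderiv f) z != 0).
Proof.
move=> hf; suff h : fderiv f != 0.
  have a0 : fnum (fderiv f) != 0.
    by apply: contraNneq h => h0; rewrite [fderiv f]ratfun_numden h0 tofrac0 mul0r.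
  apply: cofinS (cofinI (cofin_poly a0) (cofin_poly (fden_neq0 (fderiv f)))) => z [h1 h2].
  by rewrite /feval mulf_neq0 ?invr_eq0.
rewrite /fderiv mulf_neq0 ?invr_eq0 ?tofrac_neq0 ?expf_neq0 ?fden_neq0 //.
set a := fnum f; set b := fden f.
rewrite subr_eq0; apply/eqP => e.
have da : a %| a^`().
  by rewrite -(Gauss_dvdpl _ (coprime_numden f)) e dvdp_mulr.
have db : b %| b^`().
  have := coprime_numden f; rewrite coprimep_sym => h.
  by rewrite -(Gauss_dvdpr _ h) -/a -e dvdp_mull.
have small (p : {poly C}) : p %| p^`() -> (size p <= 1)%N.
  move=> dp; have [->|p0] := eqVneq p 0; first by rewrite size_poly0.
  have [h0|h0] := eqVneq p^`() 0; last first.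
    by have := dvdp_leq h0 dp; rewrite leqNgt lt_size_deriv.
  rewrite leqNgt; apply/negP => sp.
  move/polyP: h0 => /(_ (size p).-2); rewrite coef_deriv coef0.
  have -> : (size p).-2.+1 = (size p).-1 by lia.
  rewrite -/(lead_coef p) => /eqP; rewrite mulrn_eq0 lead_coef_eq0 (negPf p0) orbF; lia.
move: hf; rewrite /ramified_covering /fdegree -/a -/b.
by have := small _ da; have := small _ db; lia.
Qed.

Lemma rep_fderiv_fcomp f g F G : nonconst f -> nonconst g -> rep f F -> rep g G ->
  rep (fderiv (fcomp f g)) (fun z => feval (fderiv f) (G z) * feval (fderiv g) z).
Proof.
move=> nf ng hf hg; apply: (rep_fderiv (rep_comp ng hg hf)).
have h1 := cofin_comp ng (cofin_cder hf).
apply: cofinS (cofinI (cofinI h1 hg) (cofin_cder hg)) => z [[h [_ e]] h3].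
by apply: cder_comp h3 _; rewrite -e.
Qed.

Lemma rep_pcoef_pullback f E : nonconst f -> rep (pcoef (pullback f E))
  (fun z => feval (pcoef E) (feval f z) * feval (fderiv f) z
            - feval (fderiv (fderiv f)) z / feval (fderiv f) z).
Proof.
move=> nf; apply: rep_add.
  exact: rep_mul (rep_fcomp _ (rep_feval f)) (rep_feval _).
by apply: rep_opp; exact: rep_mul (rep_feval _) (rep_inv (rep_feval _)).
Qed.

Lemma rep_qcoef_pullback f E : nonconst f -> rep (qcoef (pullback f E))
  (fun z => feval (qcoef E) (feval f z) * feval (fderiv f) z ^+ 2).
Proof.
move=> nf; rewrite /= expr2.
exact: rep_mul (rep_fcomp _ (rep_feval f)) (rep_mul (rep_feval _) (rep_feval _)).
Qed.

Lemma equation_eq (E E' : equation R) : pcoef E = pcoef E' -> qcoef E = qcoef E' -> E = E'.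
Proof. by case: E E' => [p q] [p' q'] /= -> ->. Qed.

Lemma nonconst_fcomp f g : nonconst f -> nonconst g -> nonconst (fcomp f g).
Proof.
move=> nf ng; apply/nonconstP => c e.
have h1 := cofin_comp ng (fderiv_nonconst nf); have h2 := fderiv_nonconst ng.
have h3 := rep_fderiv_fcomp nf ng (rep_feval f) (rep_feval g).
have h4 : rep (fderiv (fcomp f g)) (fun=> 0).
  rewrite e; apply: (rep_fderiv (rep_const c)); apply: cofinT => z; exact: cder_cst.
have [z [[k1 k2] [[_ k3] [_ k4]]]] := cofin_ex (cofinI (cofinI h1 h2) (cofinI h3 h4)).
by move: (mulf_neq0 k1 k2); rewrite -k3 k4 eqxx.
Qed.

(** The chain rule for the first two derivatives of a composite, checked on values. *)
Lemma pullback_comp f g E : nonconst f -> nonconst g ->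
  pullback g (pullback f E) = pullback (fcomp f g) E.
Proof.
move=> nf ng; have nfg := nonconst_fcomp nf ng.
have rfg := rep_comp ng (rep_feval g) (rep_feval f).
have d1 := rep_fderiv_fcomp nf ng (rep_feval f) (rep_feval g).
have f1 := cofin_comp ng (fderiv_nonconst nf); have g1 := fderiv_nonconst ng.
have d2 : rep (fderiv (fderiv (fcomp f g))) (fun z =>
    feval (fderiv (fderiv f)) (feval g z) * feval (fderiv g) z * feval (fderiv g) z
    + feval (fderiv f) (feval g z) * feval (fderiv (fderiv g)) z).
  apply: (rep_fderiv d1).
  have c1 := cofin_comp ng (cofin_cder (rep_feval (fderiv f))).
  have c2 := cofin_cder (rep_feval g); have c3 := cofin_cder (rep_feval (fderiv g)).
  apply: cofinS (cofinI c1 (cofinI c2 c3)) => z [k1 [k2 k3]].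
  exact: cderM (cder_comp k2 k1) k3.
apply: equation_eq.
  apply: rep_uniq (rep_pcoef_pullback _ ng) _.
  apply: (rep_ext (rep_pcoef_pullback E nfg)).
  have c := cofin_comp ng (rep_pcoef_pullback E nf).
  apply: cofinS (cofinI (cofinI c (cofinI f1 g1)) (cofinI rfg (cofinI d1 d2))).
  move=> z [[[_ ->] [k1 k2]] [[_ ->] [[_ ->] [_ ->]]]].
  by field; rewrite k1 k2.
apply: rep_uniq (rep_qcoef_pullback _ ng) _.
apply: (rep_ext (rep_qcoef_pullback E nfg)).
have c := cofin_comp ng (rep_qcoef_pullback E nf).
apply: cofinS (cofinI c (cofinI rfg d1)) => z [[_ ->] [[_ ->] [_ ->]]].
ring.
Qed.

Lemma nonconstX : nonconst (tofrac 'X).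
Proof.
apply/nonconstP => c /eqP; rewrite tofrac_eq => /eqP /(congr1 (fun p : {poly C} => size p)).
by rewrite size_polyX size_polyC; case: (c == 0).
Qed.

Lemma nonconstV f : nonconst f -> nonconst f^-1.
Proof.
move=> /nonconstP h; apply/nonconstP => c e; apply: (h c^-1).
apply: rep_uniq (rep_const _); rewrite -[f]invrK e.
exact: rep_inv (rep_const c).
Qed.

Lemma pullbackX E : pullback (tofrac 'X) E = E.
Proof.
have rX := rep_poly 'X.
have d1 : rep (fderiv (tofrac 'X)) (fun=> 1).
  apply: (rep_fderiv rX); apply: cofinT => z.
  rewrite (_ : (fun z => _) = id); first exact: cder_id.
  by apply/funext => x; rewrite hornerX.
have d2 : rep (fderiv (fderiv (tofrac 'X))) (fun=> 0).
  by apply: (rep_fderiv d1); apply: cofinT => z; exact: cder_cst.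
apply: equation_eq.
  apply: rep_uniq (rep_feval (pcoef E)); apply: (rep_ext (rep_pcoef_pullback E nonconstX)).
  apply: cofinS (cofinI rX (cofinI d1 d2)) => z [[_ ->] [[_ ->] [_ ->]]].
  by rewrite hornerX mulr1 mul0r subr0.
apply: rep_uniq (rep_feval (qcoef E)); apply: (rep_ext (rep_qcoef_pullback E nonconstX)).
apply: cofinS (cofinI rX d1) => z [[_ ->] [_ ->]].
by rewrite hornerX expr1n mulr1.
Qed.

(** [f^-1] is [f] read in the coordinate 1/z of the target, and the two inversions cancel. *)
Lemma pullback_at_infinity f E : nonconst f -> pullback f^-1 (at_infinity E) = pullback f E.
Proof.
move=> nf; rewrite /at_infinity pullback_comp; last 2 first.
- exact/nonconstV/nonconstX.
- exact: nonconstV.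
congr pullback; apply: rep_uniq (rep_feval f).
have h := rep_comp (nonconstV nf) (rep_inv (rep_feval f)) (rep_inv (rep_poly 'X)).
by apply: (rep_ext h); apply: cofinT => z; rewrite hornerX invrK.
Qed.

Lemma at_infinity_pullback f E : nonconst f ->
  at_infinity (pullback f E) = pullback (fcomp f (tofrac 'X)^-1) E.
Proof. by move=> nf; rewrite /at_infinity pullback_comp //; exact/nonconstV/nonconstX. Qed.

End RationalEvaluation.

(** * Local monodromy and its behaviour under a ramified pullback *)

Section LocalMonodromy.
Variable R : realType.
Local Notation C := R[i].
Implicit Types (E : equation R) (F G : C -> 'M[C]_2) (f : ratfun R).

Definition cis (t : R) : C := cos t +i* sin t.

Lemma cisD s t : cis (s + t) = cis s * cis t.
Proof.
by apply: complex_ext; rewrite ?ReM ?ImM /= ?cosD ?sinD //; ring.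
Qed.

Lemma cis0 : cis 0 = 1.
Proof. by rewrite /cis cos0 sin0. Qed.

Lemma cisMn n t : cis (n%:R * t) = cis t ^+ n.
Proof.
elim: n => [|n ih]; first by rewrite mul0r cis0 expr0.
by rewrite -natr1 mulrDl mul1r cisD ih exprSr.
Qed.

Lemma nm_cis t : nm (cis t) = 1.
Proof. by rewrite /nm /= cos2Dsin2 sqrtr1. Qed.

Lemma cis_pihalfN : cis (- (pi / 2)) = - 'i.
Proof. by rewrite /cis cosN sinN cos_pihalf sin_pihalf; apply: complex_ext; rewrite /= ?oppr0. Qed.

Lemma cis_2pi n : cis (n%:R * (2 * pi)) = 1.
Proof. by rewrite cisMn /cis mulrC mulr_natr cos2pi sin2pi -[1 +i* 0]/(1 : C) expr1n. Qed.

Lemma polar (w : C) : w != 0 -> exists2 a : R, 0 <= a & w = (nm w)%:C * cis a.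
Proof.
move=> w0; have n0 : 0 < nm w by rewrite nm_gt0.
have nN0 := lt0r_neq0 n0.
pose x := Re w / nm w; pose y := Im w / nm w.
have xy : x ^+ 2 + y ^+ 2 = 1.
  by rewrite !expr_div_n -mulrDl -nm_sqr mulfV // expf_neq0.
have x1 : -1 <= x <= 1.
  have h : x ^+ 2 <= 1 by rewrite -xy lerDl sqr_ge0.
  by rewrite -ler_norml -(ler_pXn2r (n := 2)) ?nnegrE // expr1n real_normK ?num_real.
have key (a : R) : cos a = x -> sin a = y -> w = (nm w)%:C * cis a.
  move=> ca sa; apply: complex_ext; rewrite ?ReM ?ImM /= ?ca ?sa !mul0r ?subr0 ?addr0 /x /y;
  by field.
have sE : Num.sqrt (1 - x ^+ 2) = `|y|.
  by rewrite -xy addrC addKr sqrtr_sqr.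
have [a0 a1] := acos_def x1.
move: a0 => /andP[a0 api].
have [y0|y0] := leP 0 y.
  by exists (acos x) => //; apply: key => //; rewrite sin_acos // sE ger0_norm.
exists (2 * pi - acos x); first by have := pi_ge0 R; lra.
have h : 2 * pi = pi *+ 2 :> R by rewrite mulr_natl.
apply: key; first by rewrite h cosB cos2pi sin2pi mul1r mul0r addr0.
by rewrite h sinB cos2pi sin2pi mul1r mul0r sub0r sin_acos // sE ltr0_norm // opprK.
Qed.

Lemma circleE (z : C) (r t : R) : circle z r t = z + r%:C * cis (2 * pi * t).
Proof. by rewrite /circle /cis; congr (_ + _); apply: complex_ext; rewrite ?ReM ?ImM /= !mul0r ?subr0 ?addr0. Qed.

Lemma nm_circle (z : C) (r t : R) : 0 < r -> nm (circle z r t - z) = r.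
Proof. by move=> r0; rewrite circleE addrC addKr nmM nm_real nm_cis mulr1 gtr0_norm. Qed.

Lemma circle01 (z : C) (r : R) : circle z r 0 = circle z r 1.
Proof. by have := cis_2pi 1; rewrite mul1r => e; rewrite !circleE mulr0 cis0 [2 * pi * 1]mulr1 e. Qed.

Lemma pcont_circle (z : C) (r : R) : pcont (circle z r).
Proof.
move=> t _ e e0.
have c1 : {for t, continuous (fun s : R => r * cos (2 * pi * s))}.
  apply: continuousM; first exact: cvg_cst.
  apply: continuous_comp; last exact: continuous_cos.
  by apply: continuousM; [exact: cvg_cst|exact: cvg_id].
have c2 : {for t, continuous (fun s : R => r * sin (2 * pi * s))}.
  apply: continuousM; first exact: cvg_cst.
  apply: continuous_comp; last exact: continuous_sin.
  by apply: continuousM; [exact: cvg_cst|exact: cvg_id].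
have e2 : 0 < e / 2 by rewrite divr_gt0.
have [d1 d10 h1] : exists2 d : R, 0 < d & forall s, `|s - t| < d ->
    `|r * cos (2 * pi * t) - r * cos (2 * pi * s)| < e / 2.
  by apply/nearR; move/cvgrPdist_lt: c1 => /(_ _ e2).
have [d2 d20 h2] : exists2 d : R, 0 < d & forall s, `|s - t| < d ->
    `|r * sin (2 * pi * t) - r * sin (2 * pi * s)| < e / 2.
  by apply/nearR; move/cvgrPdist_lt: c2 => /(_ _ e2).
exists (Num.min d1 d2); first by rewrite lt_min d10.
move=> s _; rewrite lt_min => /andP[/h1 k1 /h2 k2].
apply: (le_lt_trans (nm_le _)); rewrite (splitr e) /circle ReB ImB !ReD !ImD /=.
have k (p q b : R) : `|p + q - (p + b)| = `|b - q|.
  by rewrite opprD addrACA subrr add0r distrC.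
by rewrite !k ltrD.
Qed.

(** Half-discs turning counterclockwise with [k] by quarter turns. Each is convex and avoids [c],
    and consecutive ones overlap in a quarter of the disc. *)
Definition hd (v c : C) (r : R) (k : nat) : C -> Prop :=
  fun z => nm (z - c) < r /\ 0 < Re (v * (- 'i) ^+ k * (z - c)).

Lemma cvx_halfplane (u c : C) : cvx (fun z => 0 < Re (u * (z - c))).
Proof.
move=> a b t ha hb /andP[t0 t1].
have -> : u * (a + t%:C * (b - a) - c) = (1 - t)%:C * (u * (a - c)) + t%:C * (u * (b - c)).
  by rewrite rmorphB /=; ring.
rewrite ReD !(ReM _%:C) /= !mul0r !subr0.
have [->|tN0] := eqVneq t 0; first by rewrite mul0r addr0 subr0 mul1r.
have tp : 0 < t by rewrite lt_neqAle eq_sym tN0.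
by rewrite ltr_wpDl ?mulr_gt0 // mulr_ge0 ?subr_ge0 // ltW.
Qed.

Lemma opn_halfplane (u c : C) : opn (fun z => 0 < Re (u * (z - c))).
Proof.
move=> w hw; have u0 : 0 < nm u + 1 by rewrite ltr_wpDl ?nm_ge0.
exists (Re (u * (w - c)) / (nm u + 1)); first by rewrite divr_gt0.
move=> z; rewrite /ballC ltr_pdivlMr // => hz.
have -> : u * (z - c) = u * (w - c) + u * (z - w) by ring.
rewrite ReD; have := nm_Re (u * (z - w)); rewrite nmM ler_norml => /andP[h _].
have h2 : nm u * nm (z - w) <= nm (z - w) * (nm u + 1).
  by rewrite mulrC ler_wpM2l ?nm_ge0 // lerDl.
by move: h h2 hz; lra.
Qed.

Lemma cvx_hd v c (r : R) k : cvx (hd v c r k).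
Proof. exact: cvxI (@cvx_ball _ c r) (@cvx_halfplane _ _). Qed.

Lemma opn_hd v c (r : R) k : opn (hd v c r k).
Proof. exact: opnI (@opn_ball _ c r) (@opn_halfplane _ _). Qed.

Lemma hd_neq v c (r : R) k z : hd v c r k z -> z != c.
Proof. by move=> [_]; apply: contraTneq => ->; rewrite subrr mulr0 ltxx. Qed.

Lemma i4 : (- 'i : C) ^+ 4 = 1.
Proof. by rewrite -[4%N]/(2 * 2)%N exprM sqrrN sqr_i sqrrN expr1n. Qed.

Lemma hdS4 v c (r : R) k z : hd v c r (k + 4) z <-> hd v c r k z.
Proof. by rewrite /hd exprD i4 mulr1. Qed.

(* The family [Gam k] of fundamental matrices on half-discs around [c],      *)
(* each turned by a quarter from the previous one, is obtained by analytic   *)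
(* continuation around [c]; a full turn multiplies it by [A].                *)
Record ldat E (v c : C) (r : R) (Gam : nat -> C -> 'M[C]_2) (A : 'M[C]_2) : Prop := Ldat {
  ld_v : v != 0;
  ld_r : 0 < r;
  ld_reg : forall z, nm (z - c) < r -> z != c -> reg E z;
  ld_sol : forall k, fsol E (hd v c r k) (Gam k);
  ld_unit : forall k z, hd v c r k z -> Gam k z \in unitmx;
  ld_next : forall k z, hd v c r k z -> hd v c r k.+1 z -> Gam k z = Gam k.+1 z;
  ld_turn : forall k z, hd v c r k z -> Gam (k + 4)%N z = A *m Gam k z }.

Lemma ld_turnX E v c (r : R) Gam A : ldat E v c r Gam A ->
  forall n k z, hd v c r k z -> Gam (k + 4 * n)%N z = A ^+ n *m Gam k z.
Proof.
move=> H n k z hz; elim: n => [|n ih]; first by rewrite muln0 addn0 expr0 mul1mx.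
rewrite mulnS addnCA addnC (ld_turn H) ?ih ?exprS -?mulmxE ?mulmxA //.
by elim: n {ih} => [|n ih]; rewrite ?muln0 ?addn0 // mulnS addnCA addnC; apply/hdS4.
Qed.

Definition dgmx (d : C) : 'M[C]_2 := diag_mx (\row_j if j == 0 then 1 else d).

(** The chain rule in matrix form: composition with [f] multiplies the column of derivatives by
    f'. *)
Definition pbmx f F : C -> 'M[C]_2 := fun z => F (feval f z) *m dgmx (feval (fderiv f) z).

Lemma pbmx0 f F z i : pbmx f F z i 0 = F (feval f z) i 0.
Proof. by rewrite /pbmx mul_mx_diag !mxE mulr1. Qed.

Lemma pbmx1 f F z i : pbmx f F z i 1 = F (feval f z) i 1 * feval (fderiv f) z.
Proof. by rewrite /pbmx mul_mx_diag !mxE. Qed.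

Lemma dgmx_unit d : d != 0 -> dgmx d \in unitmx.
Proof.
by move=> d0; rewrite unitmxE det_diag unitfE big_ord_recl big_ord1 !mxE /= mul1r.
Qed.

(** [fsol] on a one-point set is the differential equation at that point alone, so the pullback can
    be verified point by point. *)
Lemma pullback_cofin f E : ramified_covering f -> cofin (fun z =>
  [/\ reg (pullback f E) z, (fden f).[z] != 0, feval (fderiv f) z != 0 &
   forall F, fsol E (fun w => w = feval f z) F -> fsol (pullback f E) (fun x => x = z) (pbmx f F)]).
Proof.
move=> nf.
have h1 : cofin (fun z => reg (pullback f E) z).
  apply: cofinS (cofinI (cofin_poly (fden_neq0 (pcoef (pullback f E))))
    (cofin_poly (fden_neq0 (qcoef (pullback f E))))) => z [a b]; exact/andP.
have h2 := cofinI (rep_pcoef_pullback E nf) (rep_qcoef_pullback E nf).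
have h3 := cofinI (cofin_cder (rep_feval f)) (cofin_cder (rep_feval (fderiv f))).
have h4 := cofinI (fderiv_nonconst nf) (cofin_poly (fden_neq0 f)).
apply: cofinS (cofinI (cofinI h1 h4) (cofinI h2 h3)).
move=> z [[rz [d0 fz]] [[[_ hp] [_ hq]] [c1 c2]]]; split=> // F hF w -> {w} i.
have [s1 s2] := hF (feval f z) erefl i.
have k1 := cder_comp c1 s1; have k2 := cderM (cder_comp c1 s2) c2.
rewrite pbmx1 pbmx0 hp hq; split.
  by rewrite (_ : (fun z => _) = fun z => F (feval f z) i 0) //; apply/funext => x; exact: pbmx0.
rewrite (_ : (fun z => _) = fun z => F (feval f z) i 1 * feval (fderiv f) z); last first.
  by apply/funext => x; exact: pbmx1.
by move: k2; congr cder; field.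
Qed.

Lemma nearR_right (P : R -> Prop) : (\forall r \near (0 : R)^'+, P r) <->
  exists2 d : R, 0 < d & forall r, 0 < r < d -> P r.
Proof.
split.
  move=> /nearR[d d0 h]; exists d => // r /andP[r0 rd]; apply: h => //.
  by rewrite subr0 gtr0_norm.
move=> [d d0 h]; near=> r; apply: h; apply/andP; split; near: r.
  exact: nbhs_right_gt.
exact: nbhs_right_lt.
Unshelve. all: by end_near.
Qed.

Section Turns.
Variables (E : equation R) (v c : C) (r : R) (Gam : nat -> C -> 'M[C]_2) (A : 'M[C]_2).
Hypothesis D : ldat E v c r Gam A.
Variables (f : ratfun R) (x a : C) (e : nat) (h : C -> C).
Hypothesis nf : ramified_covering f.
Hypothesis e0 : (0 < e)%N.
Hypothesis a0 : a != 0.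
Hypothesis hf : forall eps : R, 0 < eps -> exists2 d : R, 0 < d & forall z, ballC x d z -> z != x ->
  feval f z = c + (z - x) ^+ e * h z /\ nm (h z - a) < eps.

Local Notation E' := (pullback f E).

(** A vector within 3/4 of a quarter turn, that is 3 pi / 8, of the axis of a half-disc has at least
    this cosine, so it stays on the right side under a relative perturbation smaller than [kap]. *)
Let kap : R := cos (3 * pi / 8).

Let kap_gt0 : 0 < kap.
Proof. by apply: cos_gt0_pihalf; have := pi_gt0 R; lra. Qed.

Let cos_kap (b : R) : `|b| <= 3 * pi / 8 -> kap <= cos b.
Proof.
move=> hb; have p0 := pi_gt0 R.
have -> : cos b = cos `|b| by case: (ger0P b) => _ //; rewrite cosN.
rewrite leNgt ltr_cos ?in_itv /= -?leNgt //.
  by apply/andP; split; lra.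
by rewrite normr_ge0 /=; lra.
Qed.

Let good (d : R) : Prop := [/\ 0 < d, d <= 1 & forall z, ballC x d z -> z != x ->
  [/\ feval f z = c + (z - x) ^+ e * h z, nm (h z - a) < kap * nm a, nm (feval f z - c) < r,
      reg E' z & [/\ (fden f).[z] != 0, feval (fderiv f) z != 0 &
   forall F, fsol E (fun w => w = feval f z) F -> fsol E' (fun x => x = z) (pbmx f F)]]].

Let na0 : 0 < nm a. Proof. by rewrite nm_gt0. Qed.

Let good_ex : exists d, good d.
Proof.
have [|d1 d10 h1] := hf (eps := kap * nm a); first by rewrite mulr_gt0.
have [d2 d20 h2] := cofin_punctured x (pullback_cofin E nf).
have r0 := ld_r D.
pose d3 := r / (2 * nm a).
have d30 : 0 < d3 by rewrite divr_gt0 // mulr_gt0.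
exists (Num.min 1 (Num.min d1 (Num.min d2 d3))); split.
- by rewrite !lt_min ltr01 d10 d20.
- by rewrite ge_min lexx.
move=> z; rewrite /ballC !lt_min => /and4P[z1 zd1 zd2 zd3] zx.
have [e1 e2] := h1 z zd1 zx; have [k1 k2 k3 k4] := h2 z zd2 zx; split=> //.
rewrite e1 addrC addKr nmM nmX.
have kap1 : kap <= 1 by exact: cos_le1.
have hh : nm (h z) <= 2 * nm a.
  rewrite -[h z](subrK a); apply: (le_trans (nmD _ _)).
  have : kap * nm a <= nm a by rewrite ler_piMl // ltW.
  by move=> k; have := ltW e2; lra.
have z0 := nm_ge0 (z - x).
apply: (@le_lt_trans _ _ (nm (z - x) * (2 * nm a))).
  apply: ler_pM; rewrite ?exprn_ge0 ?nm_ge0 //.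
  by case: e e0 => // n _; rewrite exprS ler_piMr // exprn_ile1 // ltW.
by rewrite -ltr_pdivlMr // mulr_gt0.
Qed.

Let al := sval (cid2 (polar (mulf_neq0 (ld_v D) a0))).

Let al_ge0 : 0 <= al.
Proof. by rewrite /al; case: cid2. Qed.

Let alE : v * a = (nm (v * a))%:C * cis al.
Proof. by rewrite /al; case: cid2. Qed.

(** The argument of v a (z - x)^e on the circle, counted in quarter turns; one turn adds 4 e. As
    [al] is nonnegative, the truncation in [kk] is a floor. *)
Let y (s : R) : R := 4 * e%:R * s + al / (pi / 2).

Let pi0 : 0 < (pi : R) := pi_gt0 R.

Let in_sector d rho s k : good d -> 0 < rho < d -> `|y s - k%:R| <= 3 / 4 ->
  hd v c r k (feval f (circle x rho s)).
Proof.
move=> [d0 d1 gd] /andP[rho0 rhod] hk.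
set z := circle x rho s.
have zx : nm (z - x) = rho by exact: nm_circle.
have zN : z != x by rewrite -subr_eq0 -nm_eq0 zx lt0r_neq0.
have zd : ballC x d z by rewrite /ballC zx.
have [e1 e2 e3 _ _] := gd z zd zN; split=> //.
rewrite e1 addrC addKr.
have -> : z - x = rho%:C * cis (2 * pi * s) by rewrite /z circleE addrC addKr.
rewrite -cis_pihalfN -cisMn exprMn -cisMn.
set b := k%:R * - (pi / 2); set g := e%:R * (2 * pi * s).
have -> : v * cis b * (rho%:C ^+ e * cis g * h z) =
   rho%:C ^+ e * ((nm (v * a))%:C * cis (al + b + g) + cis (b + g) * (v * (h z - a))).
  rewrite !cisD -[cis al * _ * _]mulrA [(nm (v * a))%:C * _]mulrA -alE; ring.
rewrite -rmorphXn /= ReM /= mul0r subr0 mulr_gt0 ?exprn_gt0 // ReD ReM /= mul0r subr0.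
have hc : kap <= cos (al + b + g).
  apply: cos_kap.
  have -> : al + b + g = (y s - k%:R) * (pi / 2).
    have eal : al = al / (pi / 2) * (pi / 2) by rewrite divfK // lt0r_neq0 // divr_gt0.
    by rewrite /b /g /y [X in X + _ + _ = _]eal; move: (al / (pi / 2)) => q; field.
  have -> : 3 * pi / 8 = 3 / 4 * (pi / 2) :> R by field.
  by rewrite normrM [X in _ * X]gtr0_norm ?divr_gt0 // ler_pM2r // divr_gt0.
have hr : - (nm v * (kap * nm a)) < Re (cis (b + g) * (v * (h z - a))).
  have := nm_Re (cis (b + g) * (v * (h z - a))); rewrite !nmM nm_cis mul1r ler_norml => /andP[h1 _].
  apply: lt_le_trans h1; rewrite ltrN2 ltr_pM2l // nm_gt0; exact: (ld_v D).
rewrite nmM; have va0 : 0 < nm v * nm a by rewrite -nmM nm_gt0 mulf_neq0 // (ld_v D).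
have : nm v * nm a * kap <= nm v * nm a * cos (al + b + g) by rewrite ler_pM2l.
by lra.
Qed.

(** Rounding to the nearest half-disc leaves an offset of at most 1/2, hence a margin of 1/4 below
    the tolerance 3/4 of [in_sector]. *)
Let kk (s : R) : nat := Num.truncn (y s + 1 / 2).

Let y_ge0 s : 0 <= s -> 0 <= y s.
Proof.
move=> s0; apply: addr_ge0; first by rewrite !mulr_ge0.
by rewrite divr_ge0 // divr_ge0 // ltW.
Qed.

Let kkP s : 0 <= s -> `|y s - (kk s)%:R| <= 1 / 2.
Proof.
move=> s0; have h1 : 0 <= y s + 1 / 2 by rewrite addr_ge0 ?y_ge0.
have /andP[k1 k2] := truncn_itv h1.
rewrite -/(kk s) in k1 k2; rewrite -[(kk s).+1%:R]natr1 in k2.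
by rewrite ler_norml; apply/andP; split; lra.
Qed.

Let kk1 : kk 1 = (kk 0 + 4 * e)%N.
Proof.
have h1 : 0 <= y 0 + 1 / 2 by rewrite addr_ge0 ?y_ge0.
rewrite /kk; apply: truncn_def; have /andP[k1 k2] := truncn_itv h1.
rewrite -addSn natrD [(_ + 4 * e)%:R]natrD natrM.
have -> : y 1 = y 0 + 4 * e%:R by rewrite /y mulr0 mulr1 add0r addrC.
by apply/andP; split; lra.
Qed.

Let ee_gt0 : 0 < 4 * e%:R :> R.
Proof. by rewrite mulr_gt0 // ltr0n. Qed.

Let Gt (t : R) : C -> 'M[C]_2 := pbmx f (Gam (kk t)).

Let circ_reg d rho : good d -> 0 < rho < d -> forall t : R, reg E' (circle x rho t).
Proof.
move=> [d0 d1 gd] /andP[rho0 rhod] t; have zx : nm (circle x rho t - x) = rho by exact: nm_circle.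
have zN : circle x rho t != x by rewrite -subr_eq0 -nm_eq0 zx lt0r_neq0.
by have [] := gd (circle x rho t) _ zN; rewrite /ballC ?zx.
Qed.

Let circ_ok d rho : good d -> 0 < rho < d -> forall t : R,
  (fden f).[circle x rho t] != 0 /\ feval (fderiv f) (circle x rho t) != 0.
Proof.
move=> [d0 d1 gd] /andP[rho0 rhod] t; have zx : nm (circle x rho t - x) = rho by exact: nm_circle.
have zN : circle x rho t != x by rewrite -subr_eq0 -nm_eq0 zx lt0r_neq0.
have zd : ballC x d (circle x rho t) by rewrite /ballC zx.
by have [_ _ _ _ [h1 h2 _]] := gd _ zd zN.
Qed.

Let G_sol d rho : good d -> 0 < rho < d -> forall t : R, 0 <= t <= 1 ->
  gsol E' (circle x rho t) (Gt t).
Proof.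
move=> gd hrho t /andP[t0 t1]; set z := circle x rho t.
have hs : hd v c r (kk t) (feval f z).
  by apply: (in_sector gd hrho); apply: (le_trans (kkP t0)); lra.
have [fz _] := circ_ok gd hrho t.
have [l hl] := feval_cder fz.
have [s s0 hs'] := @opn_hd v c r (kk t) _ hs.
have [q q0 hq] := cder_cont hl s0.
case/andP: hrho => rho0 rhod; case: gd => d0 d1 gd.
have zx : nm (z - x) = rho by exact: nm_circle.
have [q' q'0 hq'] : exists2 q', 0 < q' & forall w, ballC z q' w -> ballC x d w /\ w != x.
  exists (Num.min (d - rho) rho); first by rewrite lt_min subr_gt0 rhod.
  move=> w; rewrite /ballC lt_min => /andP[w1 w2]; split.
    rewrite (_ : w - x = (w - z) + (z - x)); last by ring.
    by apply: (le_lt_trans (nmD _ _)); rewrite zx -ltrBrDr.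
  by apply: contraTneq w2 => ->; rewrite nmB zx ltxx.
exists (Num.min q q'); first by rewrite lt_min q0.
move=> w /ballC_min[wq wq']; have [wd wx] := hq' w wq'.
have [_ _ _ _ [_ _ key]] := gd w wd wx.
apply: (key (Gam (kk t)) _ w erefl) => u -> {u}.
by apply: (ld_sol D); apply: hs'; exact: hq.
Qed.

Let G_unit d rho : good d -> 0 < rho < d -> forall t : R, 0 <= t ->
  Gt t (circle x rho t) \in unitmx.
Proof.
move=> gd hrho t t0; rewrite /Gt /pbmx unitmx_mul dgmx_unit ?andbT; last first.
  by case: (circ_ok gd hrho t).
apply: (ld_unit D); apply: (in_sector gd hrho); apply: (le_trans (kkP t0)); lra.
Qed.

(** For s near t the arguments differ by at most 1/4, so the image point lies in both chosen
    half-discs, which are equal or adjacent. *)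
Let G_step d rho : good d -> 0 < rho < d -> forall t : R, 0 <= t <= 1 ->
  exists2 q : R, 0 < q & forall s : R, 0 <= s <= 1 -> `|s - t| < q ->
     Gt s (circle x rho s) = Gt t (circle x rho s).
Proof.
move=> gd hrho t /andP[t0 t1]; exists ((4 * (4 * e%:R))^-1); first by rewrite invr_gt0 mulr_gt0.
move=> s /andP[s0 s1] hst.
have hys : `|y s - y t| <= 1 / 4.
  have -> : y s - y t = 4 * e%:R * (s - t) by rewrite /y; ring.
  rewrite normrM gtr0_norm // mulrC -ler_pdivlMr //; apply: (le_trans (ltW hst)).
  by rewrite invfM mul1r.
have ks := kkP s0; have kt := kkP t0.
have hs : hd v c r (kk s) (feval f (circle x rho s)).
  by apply: (in_sector gd hrho); apply: (le_trans ks); lra.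
have ht : hd v c r (kk t) (feval f (circle x rho s)).
  apply: (in_sector gd hrho).
  rewrite (_ : y s - _ = (y s - y t) + (y t - (kk t)%:R)); last by ring.
  by apply: (le_trans (ler_normD _ _)); lra.
have close : `|(kk s)%:R - (kk t)%:R| < 2 :> R.
  rewrite (_ : _ - _ = - (y s - (kk s)%:R) + ((y s - y t) + (y t - (kk t)%:R))); last by ring.
  apply: (le_lt_trans (ler_normD _ _)); rewrite normrN.
  by apply: (le_lt_trans (lerD ks (ler_normD _ _))); lra.
rewrite /Gt /pbmx; congr (_ *m _).
have [lt|gt|->] := ltngtP (kk s) (kk t); last by [].
  have e1 : kk t = (kk s).+1.
    apply/eqP; rewrite eqn_leq lt andbT leqNgt; apply/negP => l2.
    move: close; rewrite ltr_norml => /andP[k1 _].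
    have : (kk s).+2%:R <= (kk t)%:R :> R by rewrite ler_nat.
    by rewrite -!natr1; lra.
  by rewrite e1; apply: (ld_next D) => //; rewrite -e1.
have e1 : kk s = (kk t).+1.
  apply/eqP; rewrite eqn_leq gt andbT leqNgt; apply/negP => l2.
  move: close; rewrite ltr_norml => /andP[_ k1].
  have : (kk t).+2%:R <= (kk s)%:R :> R by rewrite ler_nat.
  by rewrite -!natr1; lra.
by rewrite e1; apply/esym/(ld_next D) => //; rewrite -e1.
Qed.

Let G_end d rho : good d -> 0 < rho < d ->
  Gt 1 (circle x rho 1) = A ^+ e *m Gt 0 (circle x rho 1).
Proof.
move=> gd hrho; rewrite /Gt /pbmx mulmxA; congr (_ *m _).
rewrite kk1 (ld_turnX D) // -circle01; apply: (in_sector gd hrho).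
by apply: (le_trans (kkP (lexx 0))); lra.
Qed.

Let h01 : 0 <= (0 : R) <= 1.
Proof. by rewrite lexx ler01. Qed.

(** One turn around [x] is [e] turns around [c], so along every small circle the monodromy is
    conjugate to A^e, and conjugation preserves scalar matrices. *)
Lemma trivial_monodromy_pullback : trivial_local_monodromy E' x <-> is_scalar_mx (A ^+ e).
Proof.
have [d gd] := good_ex; have d0 : 0 < d by case: gd.
split.
  move=> /nearR_right[d' d'0 H].
  pose rho := Num.min d d' / 2.
  have m0 : 0 < Num.min d d' by rewrite lt_min d0.
  have hm : rho < Num.min d d' by rewrite ltr_pdivrMr // ltr_pMr // ltr1n.
  have rho0 : 0 < rho by rewrite divr_gt0.
  have hrho : 0 < rho < d by rewrite rho0 (lt_le_trans hm) // ge_min lexx.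
  have hrho' : 0 < rho < d' by rewrite rho0 (lt_le_trans hm) // ge_min lexx orbT.
  have mon := monodromy_along_intro (@pcont_circle x rho) (circle01 x rho)
    (fun t _ => circ_reg gd hrho t) (G_sol gd hrho) (G_step gd hrho) (G_end gd hrho).
  apply: (H rho hrho' _ _ _ mon).
  apply/solution_basisP; first exact: (circ_reg gd hrho).
  have [q q0 hq] := G_sol gd hrho h01.
  have eq0 := fundmx_near hq (f := fun i z => Gt 0 z i 0) (fun z _ j => erefl).
  split; first by exists q => //; apply: (fsol_ext (@opn_ball _ _ _) _ hq) => z /eq0.
  by rewrite eq0; [exact: (G_unit gd hrho)|exact: ballC_center].
move=> /is_scalar_mxP[lam hlam].
apply/nearR_right; exists d => // rho hrho g M.
have rc := circ_reg gd hrho.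
move=> /(solution_basisP _ (rc 0))[gg ug] mon.
have [_ _ _ [Y [Ys Yl Y0 Y1]]] := monodromy_alongE gg mon.
pose Dm := fundmx g (circle x rho 0) *m invmx (Gt 0 (circle x rho 0)).
have uG : Gt 0 (circle x rho 0) \in unitmx by exact: (G_unit gd hrho).
have Y0' : Y 0 (circle x rho 0) = Dm *m Gt 0 (circle x rho 0) by rewrite Y0 mulmxKV.
have [||t ht|B ->] := loop_transport (H := fun B => B = 1%:M) (@pcont_circle x rho) (fun t _ => rc t)
   erefl _ _ (G_sol gd hrho) Ys _ Yl Y0'.
- by move=> B B' -> ->; rewrite mulmx1.
- by move=> B ->; rewrite unitmx1 invmx1.
- have [q q0 hq] := G_step gd hrho ht; exists q => // s hs hst.
  by exists 1%:M; [|rewrite mul1mx; exact: hq].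
rewrite mulmx1 (G_end gd hrho) hlam Y1 -circle01 -[fundmx g _](mulmxKV uG) -/Dm.
rewrite mul_scalar_mx -scalemxAr scalemxAl mulmxA => /(can_inj (mulmxK uG)) hM.
have uD : Dm \in unitmx by rewrite unitmx_mul ug unitmx_inv.
apply/is_scalar_mxP; exists lam; apply: (can_inj (mulmxK uD)).
by rewrite hM mul_scalar_mx.
Qed.

End Turns.

End LocalMonodromy.

(** * Construction of local monodromy data, also at infinity *)

Section Data.
Variable R : realType.
Local Notation C := R[i].
Implicit Types (E : equation R) (F G : C -> 'M[C]_2) (f : ratfun R).

Lemma hd_mod v c (r : R) k z : hd v c r (k %% 4) z <-> hd v c r k z.
Proof.
rewrite {2}(divn_eq k 4) addnC; elim: (k %/ 4)%N => [|n ih]; first by rewrite mul0n addn0.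
rewrite ih (_ : (k %% 4 + n.+1 * 4) = (k %% 4 + n * 4) + 4)%N; last by lia.
exact: iff_sym (hdS4 _ _ _ _ _).
Qed.

Lemma unitmxX (A : 'M[C]_2) n : A \in unitmx -> A ^+ n \in unitmx.
Proof.
move=> uA; elim: n => [|n ih]; first by rewrite expr0 -[1]/(1%:M) unitmx1.
by rewrite exprS -mulmxE unitmx_mul uA.
Qed.

(** Four half-discs make a full turn, so four solutions determine the whole family, repeated with a
    factor [A] at each turn. *)
Lemma ldat_intro E v c (r : R) (B : nat -> C -> 'M[C]_2) (A : 'M[C]_2) :
  v != 0 -> 0 < r -> (forall z, nm (z - c) < r -> z != c -> reg E z) ->
  (forall k, (k < 4)%N -> fsol E (hd v c r k) (B k)) ->
  (forall k z, (k < 4)%N -> hd v c r k z -> B k z \in unitmx) ->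
  (forall k z, (k < 3)%N -> hd v c r k z -> hd v c r k.+1 z -> B k z = B k.+1 z) ->
  (forall z, hd v c r 3 z -> hd v c r 0 z -> B 3 z = A *m B 0%N z) -> A \in unitmx ->
  ldat E v c r (fun k z => A ^+ (k %/ 4) *m B (k %% 4)%N z) A.
Proof.
move=> v0 r0 rE hB uB e012 e3 uA; have l4 k : (k %% 4 < 4)%N by rewrite ltn_mod.
split=> //.
- move=> k; apply: fsol_mul; apply: fsol_sub (hB _ (l4 k)) => z; exact: (hd_mod v c r k z).2.
- by move=> k z /hd_mod h; rewrite unitmx_mul unitmxX // uB.
- move=> k z; rewrite -hd_mod -[hd _ _ _ k.+1 z]hd_mod.
  have [k3|k3] := ltnP (k %% 4) 3.
    have -> : (k.+1 %% 4)%N = (k %% 4).+1 by lia.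
    have -> : (k.+1 %/ 4)%N = (k %/ 4)%N by lia.
    by move=> h1 h2; rewrite e012.
  have -> : (k.+1 %% 4)%N = 0%N by lia.
  have -> : (k.+1 %/ 4)%N = (k %/ 4).+1 by lia.
  have -> : (k %% 4)%N = 3%N by lia.
  by move=> h1 h2; rewrite e3 // exprSr -mulmxE mulmxA.
move=> k z hz; have -> : ((k + 4) %/ 4)%N = (k %/ 4).+1 by lia.
have -> : ((k + 4) %% 4)%N = (k %% 4)%N by lia.
by rewrite exprS -mulmxE mulmxA.
Qed.

(* Inversion maps a half-plane not containing 0 onto a disc. *)
Lemma ball_inv (g z : C) (M : R) : 0 < M ->
  ballC ((2 * M)^-1%:C * g) (nm g * (2 * M)^-1) z <-> z != 0 /\ M < Re (g * z^-1).
Proof.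
move=> M0; set t := (2 * M)^-1.
have t0 : 0 < t by rewrite invr_gt0 mulr_gt0.
have [->|z0] := eqVneq z 0.
  split; last by case.
  by rewrite /ballC sub0r nmN nmM nm_real gtr0_norm // mulrC ltxx.
have nz : 0 < nm z ^+ 2 by rewrite exprn_gt0 // nm_gt0.
have key : Re (g * z^-1) = (Re g * Re z + Im g * Im z) / nm z ^+ 2.
  by rewrite nm_sqr; case: g z {z0 nz} => [a b] [c d] /=; ring.
have -> : ballC (t%:C * g) (nm g * t) z <-> nm (z - t%:C * g) ^+ 2 < (nm g * t) ^+ 2.
  rewrite /ballC ltr_pXn2r ?nnegrE ?nm_ge0 //.
  by rewrite mulr_ge0 ?nm_ge0 // ltW.
have -> : nm (z - t%:C * g) ^+ 2 = nm z ^+ 2 - 2 * t * (Re g * Re z + Im g * Im z)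
   + (nm g * t) ^+ 2.
  by rewrite exprMn !nm_sqr ReB ImB ReM ImM /=; ring.
have e2 : 2 * t = M^-1 by rewrite /t; field; rewrite lt0r_neq0.
rewrite key e2 ltr_pdivlMr // gtrDr subr_lt0 mulrC ltr_pdivlMr // mulrC.
by split=> [h|[]].
Qed.

Lemma Re_conjM (g z : C) : Re (conjc g * z) = Re g * Re z + Im g * Im z.
Proof. by case: g z => [a b] [c d] /=; ring. Qed.

Lemma Re_div (g z : C) : Re (g * z^-1) = Re (conjc g * z) / nm z ^+ 2.
Proof. by rewrite Re_conjM nm_sqr; case: g z => [a b] [c d] /=; ring. Qed.

(** The far half-planes turn clockwise with [j], hence counterclockwise around 0 in the coordinate
    1/z. For a larger constant they become discs inside the half-discs at 0, from which the
    solutions extend. *)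
Lemma ldat_at_infinity E (u : C) (M : R) (Psi : nat -> C -> 'M[C]_2) (A : 'M[C]_2) :
  let far j w := M < Re (- u * 'i ^+ j * w) in
  u != 0 -> 0 < M ->
  (forall j, (j < 4)%N -> fsol E (far j) (Psi j)) ->
  (forall j w, (j < 4)%N -> far j w -> Psi j w \in unitmx) ->
  (forall j w, (j < 3)%N -> far j w -> far j.+1 w -> Psi j w = Psi j.+1 w) ->
  (forall w, far 3%N w -> far 0%N w -> Psi 3%N w = A *m Psi 0%N w) -> A \in unitmx ->
  exists v r Gam, ldat (at_infinity E) v 0 r Gam A.
Proof.
move=> far u0 M0 sP uP e012 e3 uA.
pose f : ratfun R := (FracField.tofrac 'X)^-1.
have nf : ramified_covering f by exact/nonconstV/nonconstX.
have rf := rep_inv (rep_poly ('X : {poly C})).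
have [r r0 hr] := cofin_punctured 0 (cofinI (pullback_cofin E nf) rf).
have {hr} hr z : nm z < r -> z != 0 -> [/\ reg (at_infinity E) z, feval f z = z^-1,
   feval (fderiv f) z != 0 & forall F, fsol E (fun w => w = z^-1) F ->
   fsol (at_infinity E) (fun x => x = z) (pbmx f F)].
  move=> zr z0; have [||[h1 h2 h3 h4] [_ h5]] := hr z; rewrite /ballC ?subr0 //.
  by rewrite hornerX in h5; split=> // F; rewrite -h5; exact: h4.
pose v := conjc (- u); pose g j := - u * 'i ^+ j.
have v0 : v != 0 by rewrite conjc_eq0 oppr_eq0.
have vg j : v * (- 'i) ^+ j = conjc (g j).
  rewrite /v /g rmorphM rmorphXn /=; congr (_ * _ ^+ _).
  by apply: complex_ext; rewrite /= ?oppr0.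
have ng j : nm (g j) = nm u by rewrite /g nmM nmX nm_i expr1n mulr1 nmN.
have g0 j : g j != 0 by rewrite -nm_eq0 ng nm_eq0.
have nu : 0 < nm u by rewrite nm_gt0.
(* The second bound puts the inverted half-planes within distance [r] of 0. *)
pose M' := Num.max M (nm u / r).
have M'0 : 0 < M' by rewrite lt_max M0.
pose P j z := z != 0 /\ M' < Re (g j * z^-1).
have farP j z : P j z -> far j z^-1.
  by move=> [_ h]; apply: le_lt_trans h; rewrite le_max lexx.
have Pr j z : P j z -> nm z < r.
  move=> [z0 h]; have nz : 0 < nm z by rewrite nm_gt0.
  have h1 : nm u / r < nm u / nm z.
    apply: (@le_lt_trans _ _ M'); first by rewrite le_max lexx orbT.
    apply: (lt_le_trans h); apply: (le_trans (ler_norm _)); apply: (le_trans (nm_Re _)).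
    by rewrite nmM nmV ng.
  by move: h1; rewrite ltr_pM2l // ltf_pV2.
have Phd j z : P j z -> hd v 0 r j z.
  move=> h; split; first by rewrite subr0; exact: (Pr j).
  case: h => z0; rewrite vg subr0 Re_div ltr_pdivlMr ?exprn_gt0 ?nm_gt0 //.
  by apply: lt_trans; rewrite mulr_gt0 // exprn_gt0 // nm_gt0.
have Pball j z : ballC ((2 * M')^-1%:C * g j) (nm (g j) * (2 * M')^-1) z <-> P j z.
  exact: ball_inv.
have cP j : cvx (P j).
  move=> a b t /Pball ha /Pball hb ht; apply/Pball; exact: cvx_ball.
have hreg j z : hd v 0 r j z -> reg (at_infinity E) z.
  by move=> h; have z0 := hd_neq h; case: h; rewrite subr0 => h _; case: (hr z h z0).
have pb j z : (j < 4)%N -> P j z -> fsol (at_infinity E) (fun x => x = z) (pbmx f (Psi j)).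
  move=> j4 hz; have [] := hr z (Pr j z hz) hz.1 => _ _ _; apply=> w ->.
  by apply: sP => //; exact: farP.
have pu j z : (j < 4)%N -> P j z -> pbmx f (Psi j) z \in unitmx.
  move=> j4 hz; have [_ e d _] := hr z (Pr j z hz) hz.1.
  by rewrite /pbmx unitmx_mul dgmx_unit // andbT e uP //; exact: farP.
pose zt (x : C) j : C := (x / g j)^-1.
have Pzt (x : C) j : M' < Re x -> P j (zt x j).
  move=> hx; have x0 : x != 0.
    by apply: contraTneq hx => ->; rewrite -leNgt ltW.
  by split; rewrite /zt ?invr_eq0 ?mulf_neq0 ?invr_eq0 // invrK mulrC divfK.
have H j : exists Bj : C -> 'M[C]_2, (j < 4)%N ->
    [/\ fsol (at_infinity E) (hd v 0 r j) Bj, forall z, P j z -> Bj z = pbmx f (Psi j) z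
      & forall z, hd v 0 r j z -> Bj z \in unitmx].
  have [j4|j4] := ltnP j 4; last by exists (fun=> 0).
  have h2 : P j (zt (2 * M')%:C j) by apply: Pzt => /=; lra.
  have [Bj [s1 s2]] := fsol_exists (pbmx f (Psi j) (zt (2 * M')%:C j)) (@cvx_hd _ v 0 r j)
    (@opn_hd _ v 0 r j) (hreg j) (Phd _ _ h2).
  exists Bj => _; split=> //.
    apply: (@fsol_uniq _ (at_infinity E) (P j) _ _ _ (cP j) _ _ _ h2 s2).
    - by move=> z /Phd /hreg.
    - by apply: fsol_sub s1 => z /Phd.
    by move=> z hz i; exact: (pb j z j4 hz z erefl i).
  apply: (fsol_unit (@cvx_hd _ v 0 r j) (hreg j) s1 (Phd _ _ h2)).
  by rewrite s2; exact: pu.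
have [B hB] := choice H.
have overlap j k x A' : (j < 4)%N -> (k < 4)%N -> M' < Re x -> M' < Re (x * 'i) ->
    g k = g j * 'i -> (forall w, far j w -> far k w -> Psi j w = A' *m Psi k w) ->
    forall z, hd v 0 r j z -> hd v 0 r k z -> B j z = A' *m B k z.
  move=> j4 k4 hx hxi gk he z zj zk.
  have pj : P j (zt x j) by exact: Pzt.
  have pk : P k (zt x j).
    have e : g k * (zt x j)^-1 = x * 'i by rewrite /zt invrK gk; field; exact: g0.
    by case: pj => z0 h; split=> //; rewrite e.
  have [s1 t1 _] := hB j j4; have [s2 t2 _] := hB k k4.
  apply: (@fsol_uniq _ (at_infinity E) _ (B j) (fun z => A' *m B k z) (zt x j)
    (cvxI (@cvx_hd _ v 0 r j) (@cvx_hd _ v 0 r k)) _ _ _ _ _ _ (conj zj zk)).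
  - by move=> w [/hreg].
  - by apply: fsol_sub s1 => w [].
  - by apply: fsol_sub (fsol_mul A' s2) => w [].
  - by split; exact: Phd.
  rewrite t1 // t2 // /pbmx mulmxA; congr (_ *m _).
  have [_ -> _ _] := hr _ (Pr j _ pj) pj.1.
  by apply: he; apply: farP.
(* A common point of consecutive discs: x = 2 M' (1 - i) and i x = 2 M' (1 + i) both have real part
   2 M'. *)
have hx1 : M' < Re ((2 * M')%:C * (1 - 'i)).
  by rewrite ReM /=; lra.
have hx2 : M' < Re ((2 * M')%:C * (1 - 'i) * 'i).
  by rewrite ReM ReM ImM /=; lra.
exists v, r, (fun k z => A ^+ (k %/ 4) *m B (k %% 4)%N z).
apply: ldat_intro => //.
- by move=> z; rewrite subr0 => h z0; case: (hr z h z0).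
- by move=> k /hB[].
- by move=> k z /hB[_ _ h] /h.
- move=> k z k3 h1 h2; rewrite -[B k.+1 z]mul1mx.
  apply: (overlap _ _ _ _ _ _ hx1 hx2 _ _ z h1 h2); rewrite ?(leqW k3) //.
    by rewrite /g exprSr mulrA.
  by move=> w; rewrite mul1mx; exact: e012.
move=> z h1 h2; apply: (overlap _ _ _ _ _ _ hx1 hx2 _ e3 z h1 h2) => //.
rewrite /g expr0 mulr1 -mulrA -exprSr -[4%N]/(2 * 2)%N exprM sqr_i.
by rewrite sqrrN expr1n mulr1.
Qed.

End Data.

(** * Strips between the singular points and generators of the monodromy *)

Section Strips.
Variable R : realType.
Local Notation C := R[i].
Implicit Types (F G : C -> 'M[C]_2).

Definition hp (c a : C) : C -> Prop := fun w => 0 < Re (c * (w - a)).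

Lemma cvx_hp c a : cvx (hp c a). Proof. exact: cvx_halfplane. Qed.
Lemma opn_hp c a : opn (hp c a). Proof. exact: opn_halfplane. Qed.

Lemma cvx_imp (b : bool) (U : C -> Prop) : cvx U -> cvx (fun z => b -> U z).
Proof. by move=> h x y t hx hy ht hb; apply: h => //; [exact: hx|exact: hy]. Qed.

Lemma opn_imp (b : bool) (U : C -> Prop) : opn U -> opn (fun z => b -> U z).
Proof.
case: b => h w hw; last by exists 1.
by have [r r0 hr] := h w (hw isT); exists r => // z /hr.
Qed.

Lemma fsol_extend E (U V : C -> Prop) F p : cvx U -> cvx V -> opn V ->
  (forall z, U z -> reg E z) -> (forall z, V z -> reg E z) ->
  U p -> V p -> fsol E U F -> (forall z, U z -> F z \in unitmx) ->
  exists G, [/\ fsol E V G, forall z, V z -> G z \in unitmx & forall z, U z -> V z -> G z = F z].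
Proof.
move=> cU cV oV rU rV Up Vp hF uF.
have [G [hG Gp]] := fsol_exists (F p) cV oV rV Vp; exists G; split=> //.
  by apply: (fsol_unit cV rV hG Vp); rewrite Gp uF.
move=> z Uz Vz; apply: (@fsol_uniq _ E (fun z => U z /\ V z) G F p (cvxI cU cV)) => //.
- by move=> w [/rU].
- by apply: fsol_sub hG => w [].
by apply: fsol_sub hF => w [].
Qed.

Fixpoint mxprod (T : nat -> 'M[C]_2) (k : nat) : 'M[C]_2 :=
  if k is k'.+1 then mxprod T k' *m T k' else 1%:M.

Inductive mxgen (P : 'M[C]_2 -> Prop) : 'M[C]_2 -> Prop :=
| mxgen1 : mxgen P 1%:M
| mxgenM A B : mxgen P A -> mxgen P B -> mxgen P (A *m B)
| mxgenG A : P A -> mxgen P A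
| mxgenV A : P A -> mxgen P (invmx A).

Lemma invmx_mul (A B : 'M[C]_2) : A \in unitmx -> B \in unitmx -> invmx (A *m B) = invmx B *m invmx A.
Proof.
move=> a b; have u : A *m B \in unitmx by rewrite unitmx_mul a.
by apply: (can_inj (mulKmx u)); rewrite (mulmxV u) mulmxA (mulmxK b) (mulmxV a).
Qed.

Lemma mxgen_unit P A : (forall B, P B -> B \in unitmx) -> mxgen P A ->
  A \in unitmx /\ mxgen P (invmx A).
Proof.
move=> hP; elim=> [|B B' _ [uB iB] _ [uB' iB']|B hB|B hB].
- by rewrite unitmx1 invmx1; split=> //; exact: mxgen1.
- by split; [rewrite unitmx_mul uB|rewrite invmx_mul //; exact: mxgenM].
- by split; [exact: hP|exact: mxgenV].
by rewrite unitmx_inv invmxK; split; [exact: hP|exact: mxgenG].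
Qed.

Variables (E : equation R) (u : C) (N : nat) (s : nat -> C).
Hypothesis u0 : u != 0.
Hypothesis regE : forall z, reg E z <-> (forall k, (k < N)%N -> z != s k).
Hypothesis s_incr : forall j k, (j < k)%N -> (k < N)%N -> Re (u * s j) < Re (u * s k).

(* V k is the strip between the singular points s (k - 1) and s k, in the direction given by u; *)
(* H sg k is the half, above s k for sg = -'i and below it for sg = 'i, of the strip that      *)
(* joins V k to V (k + 1).                                                                      *)
Let V k w := ((0 < k)%N -> hp u (s k.-1) w) /\ ((k < N)%N -> hp (- u) (s k) w).
Let H (sg : C) k w := ((0 < k)%N -> hp u (s k.-1) w) /\
  (((k.+1 < N)%N -> hp (- u) (s k.+1) w) /\ hp (sg * u) (s k) w).

Let hpP (a w : C) : hp u a w <-> Re (u * a) < Re (u * w).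
Proof. by rewrite /hp mulrBr ReB subr_gt0. Qed.

Let hpN (a w : C) : hp (- u) a w <-> Re (u * w) < Re (u * a).
Proof. by rewrite /hp mulNr -mulrN opprB mulrBr ReB subr_gt0. Qed.

Let hp_up (a w : C) : hp (- 'i * u) a w <-> Im (u * a) < Im (u * w).
Proof. by rewrite /hp -mulrA mulrBr !ReM !ReB ImB /= oppr0 mul0r sub0r mulN1r opprK subr_gt0. Qed.

Let hp_down (a w : C) : hp ('i * u) a w <-> Im (u * w) < Im (u * a).
Proof. by rewrite /hp -mulrA mulrBr !ReM !ReB ImB /= mul0r sub0r mul1r oppr_gt0 subr_lt0. Qed.

Let s_le j k : (j <= k)%N -> (k < N)%N -> Re (u * s j) <= Re (u * s k).
Proof. by rewrite leq_eqVlt => /orP[/eqP -> //|jk] kN; apply/ltW; exact: s_incr. Qed.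

Let after j k w : (j < k)%N -> (k <= N)%N -> ((0 < k)%N -> hp u (s k.-1) w) ->
  Re (u * s j) < Re (u * w).
Proof.
case: k => // k; rewrite ltnS => jk kN /(_ isT) /hpP; apply: le_lt_trans; exact: s_le.
Qed.

Let before j k w : (k <= j)%N -> (j < N)%N -> ((k < N)%N -> hp (- u) (s k) w) ->
  Re (u * w) < Re (u * s j).
Proof.
move=> kj jN /(_ (leq_ltn_trans kj jN)) /hpN /lt_le_trans; apply; exact: s_le.
Qed.

Let cV k : cvx (V k).
Proof. by apply: cvxI; apply: cvx_imp; exact: cvx_hp. Qed.
Let oV k : opn (V k).
Proof. by apply: opnI; apply: opn_imp; exact: opn_hp. Qed.
Let cH sg k : cvx (H sg k).
Proof.
by apply: cvxI; [apply: cvx_imp; exact: cvx_hp|apply: cvxI; [apply: cvx_imp|]; exact: cvx_hp].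
Qed.
Let oH sg k : opn (H sg k).
Proof.
by apply: opnI; [apply: opn_imp; exact: opn_hp|apply: opnI; [apply: opn_imp|]; exact: opn_hp].
Qed.

Let rV k z : (k <= N)%N -> V k z -> reg E z.
Proof.
move=> kN [h1 h2]; apply/regE => j jN; apply/negP => /eqP ez; subst z.
by have [jk|kj] := ltnP j k; [have := after jk kN h1|have := before kj jN h2]; rewrite ltxx.
Qed.

Let rH sg k z : (k < N)%N -> H sg k z -> reg E z.
Proof.
move=> kN [h1 [h2 h3]]; apply/regE => j jN; apply/negP => /eqP ez; subst z.
have [jk|kj|jk] := ltngtP j k; last by move: h3; rewrite jk /hp subrr mulr0 ltxx.
  by have := after jk (ltnW kN) h1; rewrite ltxx.
by have := before kj jN h2; rewrite ltxx.
Qed.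

(** In the coordinate u z the strips are vertical; this is the point with coordinates a and b
    there. *)
Let pt (a b : R) : C := (a +i* b) / u.

Let u_pt a b : u * pt a b = a +i* b.
Proof. by rewrite /pt mulrC divfK. Qed.

(** An abscissa inside strip [k]: one unit beyond an extreme singular point, or a midpoint between
    two consecutive ones. *)
Let ly k : R := if k == 0%N then Re (u * s 0%N) - 1 else
  if k == N then Re (u * s N.-1) + 1 else (Re (u * s k.-1) + Re (u * s k)) / 2.

Let lyP k : (k <= N)%N -> ((0 < k)%N -> Re (u * s k.-1) < ly k) /\ ((k < N)%N -> ly k < Re (u * s k)).
Proof.
move=> kN; rewrite /ly; case: eqP => [->|/eqP k0].
  by split=> // _; rewrite ltrBlDr ltrDl.
case: eqP => [->|/eqP kN']; first by split=> [_|]; rewrite ?ltnn // ltrDl.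
have k1 : (0 < k)%N by rewrite lt0n.
have k2 : (k < N)%N by rewrite ltn_neqAle kN'.
have h : Re (u * s k.-1) < Re (u * s k) by apply: s_incr => //; rewrite prednK.
by split=> _; lra.
Qed.

Let V_pt k b : (k <= N)%N -> V k (pt (ly k) b).
Proof.
move=> /lyP[h1 h2]; split=> hk.
  by apply/hpP; rewrite u_pt; exact: h1.
by apply/hpN; rewrite u_pt; exact: h2.
Qed.

Let H_pt sg k b : (k < N)%N -> hp (sg * u) (s k) (pt (ly k) b) -> H sg k (pt (ly k) b).
Proof.
move=> kN hs; have [h1 h2] := lyP (ltnW kN); split=> [hk|].
  by apply/hpP; rewrite u_pt; exact: h1.
split=> // k1; apply/hpN; rewrite u_pt /=.
by apply: (lt_trans (h2 kN)); apply: s_incr.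
Qed.

Let H_pt1 sg k b : (k < N)%N -> hp (sg * u) (s k) (pt (ly k.+1) b) -> H sg k (pt (ly k.+1) b).
Proof.
move=> kN hs; have [h1 h2] := lyP kN; split=> [hk|].
  apply/hpP; rewrite u_pt /=; apply: lt_trans (h1 isT) => /=.
  by apply: s_incr => //; rewrite prednK.
by split=> // k1; apply/hpN; rewrite u_pt; exact: h2.
Qed.

(** Passage to the next strip: [F'] continues [F] above the singular point, and the continuation
    below it is T F'. *)
Let stepP k F (X : (C -> 'M[C]_2) * (C -> 'M[C]_2) * (C -> 'M[C]_2) * 'M[C]_2) :=
  let: (F', Up, Lo, T) := X in
  [/\ fsol E (V k.+1) F', forall z, V k.+1 z -> F' z \in unitmx,
      [/\ fsol E (H (- 'i) k) Up, forall z, H (- 'i) k z -> Up z \in unitmx,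
          forall z, V k z -> H (- 'i) k z -> Up z = F z &
          forall z, V k.+1 z -> H (- 'i) k z -> Up z = F' z],
      [/\ fsol E (H 'i k) Lo, forall z, H 'i k z -> Lo z \in unitmx,
          forall z, V k z -> H 'i k z -> Lo z = F z &
          forall z, V k.+1 z -> H 'i k z -> Lo z = T *m F' z] & T \in unitmx].

Let step_ex k F : (k < N)%N -> fsol E (V k) F -> (forall z, V k z -> F z \in unitmx) ->
  exists X, stepP k F X.
Proof.
move=> kN hF uF; have kN' := ltnW kN.
pose bu := Im (u * s k) + 1; pose bl := Im (u * s k) - 1.
have up a : hp (- 'i * u) (s k) (pt a bu) by apply/hp_up; rewrite u_pt /= ltrDl.
have dn a : hp ('i * u) (s k) (pt a bl) by apply/hp_down; rewrite u_pt /= ltrBlDr ltrDl.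
have rV1 z : V k z -> reg E z by exact: rV.
have rV2 z : V k.+1 z -> reg E z by exact: rV.
have rU z : H (- 'i) k z -> reg E z by exact: rH.
have rL z : H 'i k z -> reg E z by exact: rH.
have [Up [hU uU eU]] := fsol_extend (@cV k) (@cH (- 'i) k) (@oH (- 'i) k) rV1 rU
  (V_pt bu kN') (H_pt kN (up _)) hF uF.
have [F' [hF' uF' eF']] := fsol_extend (@cH (- 'i) k) (@cV k.+1) (@oV k.+1) rU rV2
  (H_pt1 kN (up _)) (V_pt bu kN) hU uU.
have [Lo [hL uL eL]] := fsol_extend (@cV k) (@cH 'i k) (@oH 'i k) rV1 rL
  (V_pt bl kN') (H_pt kN (dn _)) hF uF.
pose p := pt (ly k.+1) bl.
have pV : V k.+1 p by exact: V_pt.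
have pH : H 'i k p by exact: H_pt1.
exists (F', Up, Lo, Lo p *m invmx (F' p)); split=> //.
- by split=> // z Vz Hz; rewrite eF'.
- split=> // z Vz Hz.
  apply: (@fsol_transition _ E (fun z => V k.+1 z /\ H 'i k z) F' Lo p (cvxI (@cV k.+1) (@cH 'i k))) => //.
  - by move=> w [/rV2].
  - by apply: fsol_sub hF' => w [].
  - by apply: fsol_sub hL => w [].
  exact: uF'.
by rewrite unitmx_mul unitmx_inv uL ?uF'.
Qed.

Lemma strip_system : exists (F Up Lo : nat -> C -> 'M[C]_2) (T : nat -> 'M[C]_2),
  (forall k, (k <= N)%N -> fsol E (V k) (F k) /\ forall z, V k z -> F k z \in unitmx) /\
  (forall k, (k < N)%N -> stepP k (F k) (F k.+1, Up k, Lo k, T k)).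
Proof.
have A kF : exists X, (kF.1 < N)%N -> fsol E (V kF.1) kF.2 ->
    (forall z, V kF.1 z -> kF.2 z \in unitmx) -> stepP kF.1 kF.2 X.
  case: (pselect [/\ (kF.1 < N)%N, fsol E (V kF.1) kF.2 & forall z, V kF.1 z -> kF.2 z \in unitmx]).
    by move=> [h1 h2 h3]; have [X hX] := step_ex h1 h2 h3; exists X.
  by move=> h; exists (kF.2, kF.2, kF.2, 0) => h1 h2 h3; case: h.
have [st hst] := choice A.
have [F0 [hF0 eF0]] := fsol_exists 1%:M (@cV 0) (@oV 0) (fun z => @rV 0 z (leq0n N)) (V_pt 0 (leq0n N)).
pose F := fix F k := if k is k'.+1 then (st (k', F k')).1.1.1 else F0.
have hF k : (k <= N)%N -> fsol E (V k) (F k) /\ forall z, V k z -> F k z \in unitmx.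
  elim: k => [_|k ih kN].
    split=> //; apply: (fsol_unit (@cV 0) (fun z => @rV 0 z (leq0n N)) hF0 (V_pt 0 (leq0n N))).
    by rewrite eF0 unitmx1.
  have [h1 h2] := ih (ltnW kN); have := hst (k, F k) kN h1 h2.
  by rewrite /=; case: (st (k, F k)) => [[[F' U'] L'] T'] [].
exists F, (fun k => (st (k, F k)).1.1.2), (fun k => (st (k, F k)).1.2), (fun k => (st (k, F k)).2).
split=> // k kN; have [h1 h2] := hF k (ltnW kN); have := hst (k, F k) kN h1 h2.
by rewrite /=; case: (st (k, F k)) => [[[F' U'] L'] T'].
Qed.

Variables (F Up Lo : nat -> C -> 'M[C]_2) (T : nat -> 'M[C]_2).
Hypothesis hF : forall k, (k <= N)%N -> fsol E (V k) (F k) /\ forall z, V k z -> F k z \in unitmx.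
Hypothesis hS : forall k, (k < N)%N -> stepP k (F k) (F k.+1, Up k, Lo k, T k).

Let Tgen := mxgen (fun A => exists2 k, (k < N)%N & A = T k).

Let uT k : (k < N)%N -> T k \in unitmx.
Proof. by move=> /hS[]. Qed.

(** A branch at each regular point: the strip solution inside a strip, the upper or lower
    continuation on a line through a singular point. *)
Let spec w G := (exists2 k, (k <= N)%N & V k w /\ G = F k) \/
  (exists2 k, (k < N)%N & Re (u * w) = Re (u * s k) /\
     ((hp (- 'i * u) (s k) w /\ G = Up k) \/ (hp ('i * u) (s k) w /\ G = Lo k))).

Let spec_ex w : reg E w -> exists G, spec w G.
Proof.
move=> /regE hw.
pose P k := (k == N) || (Re (u * w) <= Re (u * s k)).
have ex : exists k, P k by exists N; rewrite /P eqxx.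
case: (ex_minnP ex) => k hk hmin.
have kN : (k <= N)%N by apply: hmin; rewrite /P eqxx.
have lo : (0 < k)%N -> hp u (s k.-1) w.
  move=> k0; apply/hpP; rewrite ltNge; apply/negP => h.
  by have := hmin k.-1; rewrite /P h orbT => /(_ isT); rewrite leqNgt prednK ?leqnn.
move: hk; rewrite /P; have [kN'|kN'] /= := eqVneq k N.
  by move=> _; exists (F k); left; exists k => //; split=> //; split=> //; rewrite kN' ltnn.
rewrite le_eqVlt => /orP[/eqP e|hlt]; last first.
  by exists (F k); left; exists k => //; split=> //; split=> // _; exact/hpN.
have kN1 : (k < N)%N by rewrite ltn_neqAle kN'.
have : Im (u * w) != Im (u * s k).
  apply: contraNneq (hw k kN1) => e2; apply/eqP/(mulfI u0); exact: complex_ext.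
case: (ltgtP (Im (u * w)) (Im (u * s k))) => // h _.
  by exists (Lo k); right; exists k => //; split=> //; right; split=> //; exact/hp_down.
by exists (Up k); right; exists k => //; split=> //; left; split=> //; exact/hp_up.
Qed.

Let V_uniq j k w : (j <= N)%N -> (k <= N)%N -> V j w -> V k w -> j = k.
Proof.
wlog jk : j k / (j < k)%N.
  move=> h jN kN hj hk; have [l|l|//] := ltngtP j k; first exact: h.
  by apply/esym/h.
move=> jN kN [_ h1] [h2 _].
by have := lt_trans (after jk kN h2) (before (leqnn j) (leq_trans jk kN) h1); rewrite ltxx.
Qed.

Let V_H sg j k w : (j <= N)%N -> (k < N)%N -> V j w -> H sg k w -> j = k \/ j = k.+1.
Proof.
move=> jN kN [h1 h2] [h3 [h4 _]].
have [jk|kj|->] := ltngtP j k; [|  |by left].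
  by have := lt_trans (after jk (ltnW kN) h3) (before (leqnn j) (ltn_trans jk kN) h2); rewrite ltxx.
right; apply/eqP; rewrite eqn_leq kj andbT leqNgt; apply/negP => kj2.
by have := lt_trans (after kj2 jN h1) (before (leqnn _) (leq_trans kj2 jN) h4); rewrite ltxx.
Qed.

Let line_H sg j k w : (j < N)%N -> (k < N)%N -> Re (u * w) = Re (u * s j) -> H sg k w -> j = k.
Proof.
move=> jN kN e [h3 [h4 _]]; have [jk|kj|//] := ltngtP j k.
  by have := after jk (ltnW kN) h3; rewrite e ltxx.
by have := before kj jN h4; rewrite e ltxx.
Qed.

Let line_V j k w : (j < N)%N -> (k <= N)%N -> Re (u * w) = Re (u * s j) -> V k w -> False.
Proof.
move=> jN kN e [h1 h2].
by have [jk|kj] := ltnP j k; [have := after jk kN h1|have := before kj jN h2]; rewrite e ltxx.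
Qed.

Let H_line sg k w : (k < N)%N -> Re (u * w) = Re (u * s k) -> hp (sg * u) (s k) w -> H sg k w.
Proof.
move=> kN e h; split.
  move=> k0; apply/hpP; rewrite e; apply: s_incr => //; by rewrite prednK.
by split=> // k1; apply/hpN; rewrite e; exact: s_incr.
Qed.

Let up_down w k : hp (- 'i * u) (s k) w -> hp ('i * u) (s k) w -> False.
Proof. by move=> /hp_up a /hp_down b; move: (lt_trans a b); rewrite ltxx. Qed.

(** Branches near [w] differ by an element of the generated group. Only on the lower part of a line
    is it nontrivial: there Lo equals F_k on the left and T_k F_{k+1} on the right. *)
Let spec_local w G : spec w G -> exists r, [/\ 0 < r, fsol E (ballC w r) G,
  G w \in unitmx & forall w' G', ballC w r w' -> spec w' G' ->
   exists2 A, Tgen A & G' w' = A *m G w'].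
Proof.
move=> [[k kN [Vw ->]]|[k kN [e [[h ->]|[h ->]]]]].
- have [r r0 hr] := oV Vw; have [h1 h2] := hF kN.
  exists r; split=> //; [by apply: fsol_sub h1|exact: h2|].
  move=> w' G' /hr Vw'; case=> [[j jN [Vj ->]]|[j jN [ej _]]].
    by rewrite (V_uniq jN kN Vj Vw'); exists 1%:M; [exact: mxgen1|rewrite mul1mx].
  by case: (line_V jN kN ej Vw').
- have Hw := H_line kN e h; have [r r0 hr] := oH Hw.
  have [_ _ [s1 s2 s3 s4] _ _] := hS kN.
  exists r; split=> //; [by apply: fsol_sub s1|exact: s2|].
  move=> w' G' /hr Hw' hsp; exists 1%:M; [exact: mxgen1|rewrite mul1mx].
  case: hsp => [[j jN [Vj ->]]|[j jN [ej]]].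
    by case: (V_H jN kN Vj Hw') => ej; rewrite ej in Vj *; [rewrite s3|rewrite s4].
  rewrite (line_H jN kN ej Hw') => -[[_ -> //]|[h' _]].
  by case: Hw' => _ [_ h'']; case: (up_down h'' h').
have Hw := H_line kN e h; have [r r0 hr] := oH Hw.
have [_ _ _ [s1 s2 s3 s4] uTk] := hS kN.
exists r; split=> //; [by apply: fsol_sub s1|exact: s2|].
move=> w' G' /hr Hw' [[j jN [Vj ->]]|[j jN [ej]]].
  case: (V_H jN kN Vj Hw') => ej; rewrite ej in Vj *.
    by exists 1%:M; [exact: mxgen1|rewrite mul1mx s3].
  by exists (invmx (T k)); [apply: mxgenV; exists k|rewrite s4 // mulKmx].
rewrite (line_H jN kN ej Hw') => -[[h' _]|[_ ->]].
  by case: Hw' => _ [_ h'']; case: (up_down h' h'').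
by exists 1%:M; [exact: mxgen1|rewrite mul1mx].
Qed.

(** The branches of [spec] jump only within the group generated by the T_k, so [loop_transport]
    applies to every loop. *)
Lemma monodromy_strips (b : C) (f : 'I_2 -> C -> C) : ordinary E b -> solution_basis E b f ->
  exists2 D, D \in unitmx & forall M, monodromy_group E b f M ->
    exists2 A, Tgen A & M = D *m A *m invmx D.
Proof.
move=> /regP rb /(solution_basisP _ rb)[gf uf].
have A w : exists G, reg E w -> spec w G.
  case: (pselect (reg E w)) => [h|h]; last by exists (F 0).
  by have [G hG] := spec_ex h; exists G.
have [G hG] := choice A.
have gG w : reg E w -> gsol E w (G w).
  by move=> /hG /spec_local[r [r0 h _ _]]; exists r.
have [_ [_ _ uG _]] := spec_local (hG b rb).
pose D := fundmx f b *m invmx (G b b).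
have uD : D \in unitmx by rewrite unitmx_mul uf unitmx_inv.
exists D => // M [gam [gb mon]]; subst b.
have [cg e01 rg [Y [Ys Yl Y0 Y1]]] := monodromy_alongE gf mon.
have Y0' : Y 0 (gam 0) = D *m G (gam 0) (gam 0) by rewrite Y0 mulmxKV.
have [|||||B hB hY] := loop_transport (H := Tgen) (G := fun t => G (gam t)) cg rg _ _ _ _ Ys _ Yl Y0'.
- exact: mxgen1.
- by move=> B B'; exact: mxgenM.
- by move=> B; apply: mxgen_unit => B' [k kN ->]; exact: uT.
- by move=> t ht; exact/gG/rg.
- move=> t ht; have [r [r0 _ _ h]] := spec_local (hG _ (rg t ht)).
  have [d d0 hd'] := cg t ht r r0; exists d => // t' ht' htt.
  by apply: h; [exact: hd'|exact/hG/rg].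
exists B => //.
move: hY; rewrite Y1 -e01 -[fundmx f (gam 0)](mulmxKV uG) -/D mulmxA => /(can_inj (mulmxK uG)) <-.
by rewrite mulmxK.
Qed.

(** Around s_k the half-discs point left, down, right and up in the coordinate u z. There F_k, Lo,
    T_k F_{k+1} and T_k Up continue one another, and the turn closes with T_k F_k. *)
Lemma ldat_strips k : (k < N)%N -> exists v r Gam, ldat E v (s k) r Gam (T k).
Proof.
move=> kN.
pose W w := ((0 < k)%N -> hp u (s k.-1) w) /\ ((k.+1 < N)%N -> hp (- u) (s k.+1) w).
have oW : opn W by apply: opnI; apply: opn_imp; exact: opn_hp.
have Wk : W (s k).
  split=> h; first by apply/hpP; apply: s_incr => //; rewrite prednK.
  by apply/hpN; exact: s_incr.
have [r r0 hr] := oW _ Wk.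
have [s1 uF1 [a1 a2 a3 a4] [b1 b2 b3 b4] uTk] := hS kN.
have [f1 f2] := hF (ltnW kN).
pose B j : C -> 'M[C]_2 := match j with
  | 0 => F k | 1 => Lo k | 2 => (fun z => T k *m F k.+1 z) | _ => (fun z => T k *m Up k z) end.
have i2 : (- 'i : C) * - 'i = -1 by rewrite mulrNN -expr2 sqr_i.
have h0 z : hd (- u) (s k) r 0 z -> V k z.
  move=> [/hr[w1 w2]]; rewrite expr0 mulr1 => h; split=> //.
have h1 z : hd (- u) (s k) r 1 z -> H 'i k z.
  move=> [/hr[w1 w2]]; rewrite expr1 mulrNN mulrC [u * 'i]mulrC => h; split=> //; split=> //.
  by rewrite /hp mulrC.
have h2 z : hd (- u) (s k) r 2 z -> V k.+1 z.
  move=> [/hr[w1 w2]]; rewrite expr2 i2 mulrN1 opprK => h; split=> //.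
have h3 z : hd (- u) (s k) r 3 z -> H (- 'i) k z.
  move=> [/hr[w1 w2]]; rewrite !exprS expr0 mulr1 i2 => h; split=> //; split=> //.
  by rewrite (_ : - u * (- 'i * -1) = - 'i * u) in h; last by ring.
exists (- u), r, (fun j z => T k ^+ (j %/ 4) *m B (j %% 4)%N z).
apply: ldat_intro => //.
- by rewrite oppr_eq0.
- move=> z /hr[w1 w2] zk; apply/regE => j jN; apply/negP => /eqP ez.
  have [jk|kj|jk] := ltngtP j k; last by move: zk; rewrite ez jk eqxx.
    by have := after jk (ltnW kN) w1; rewrite ez ltxx.
  by have := before kj jN w2; rewrite ez ltxx.
- move=> [|[|[|[|//]]]] _ /=.
  - by apply: fsol_sub f1 => z /h0.
  - by apply: fsol_sub b1 => z /h1.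
  - by apply: fsol_sub (fsol_mul (T k) s1) => z /h2.
  by apply: fsol_sub (fsol_mul (T k) a1) => z /h3.
- move=> [|[|[|[|//]]]] z _ /=.
  - by move=> /h0 /f2.
  - by move=> /h1 /b2.
  - by move=> /h2 /uF1 h; rewrite unitmx_mul uTk.
  by move=> /h3 /a2 h; rewrite unitmx_mul uTk.
- move=> [|[|[|//]]] z _ /=.
  - by move=> /h0 x0 /h1 x1; rewrite b3.
  - by move=> /h1 x0 /h2 x1; rewrite b4.
  by move=> /h2 x0 /h3 x1; rewrite a4.
by move=> z /h3 x3 /h0 x0 /=; rewrite a3.
Qed.

Let Q := mxprod T.

Let farE (M : R) (c : C) w : c != 0 -> M < Re (c * w) <-> hp c (M%:C / c) w.
Proof. by move=> c0; rewrite /hp mulrBr [c * (_ / _)]mulrC divfK // ReB subr_gt0. Qed.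

(* A solution near infinity on one side agrees, strip after strip, with the strip solutions. *)
Let far_strips (c sg : C) (M b : R) (Phi : C -> 'M[C]_2) (X : nat -> C -> 'M[C]_2) (T' : nat -> 'M[C]_2) :
  c != 0 -> (forall a, M < Re (c * pt a b)) ->
  (forall w, M < Re (c * w) -> reg E w) ->
  fsol E (fun w => M < Re (c * w)) Phi ->
  (forall k, (k < N)%N -> fsol E (H sg k) (X k)) ->
  (forall k a, (k < N)%N -> hp (sg * u) (s k) (pt a b)) ->
  (forall k z, (k < N)%N -> V k z -> H sg k z -> X k z = F k z) ->
  (forall k z, (k < N)%N -> V k.+1 z -> H sg k z -> X k z = T' k *m F k.+1 z) ->
  Phi (pt (ly 0) b) = F 0%N (pt (ly 0) b) ->
  forall k, (k <= N)%N -> forall z, V k z -> M < Re (c * z) ->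
    Phi z = mxprod T' k *m F k z.
Proof.
move=> c0 hb rM hPhi hX hsg e1 e2 ePhi.
have cM : cvx (fun w => M < Re (c * w)).
  by move=> x y t /(farE _ _ c0) hx /(farE _ _ c0) hy ht; apply/(farE _ _ c0); exact: cvx_hp.
have prop k : (k <= N)%N ->
   Phi (pt (ly k) b) = mxprod T' k *m F k (pt (ly k) b) ->
   forall z, V k z -> M < Re (c * z) -> Phi z = mxprod T' k *m F k z.
  move=> kN he z Vz Mz.
  apply: (@fsol_uniq _ E (fun w => V k w /\ M < Re (c * w)) Phi (fun z => mxprod T' k *m F k z) (pt (ly k) b) (cvxI (@cV k) cM)) => //.
  - by move=> w [_ /rM].
  - by apply: fsol_sub hPhi => w [].
  - by apply: fsol_sub (fsol_mul _ (hF kN).1) => w [].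
  by split; [exact: V_pt|exact: hb].
elim=> [|k ih] kN; first by apply: prop => //; rewrite mul1mx.
apply: prop => //; have {}ih := ih (ltnW kN).
rewrite /= -mulmxA -e2 //; last exact: H_pt1 (hsg _ _ kN).
  have hk : H sg k (pt (ly k) b) by apply: H_pt => //; exact: hsg.
  have hk1 : H sg k (pt (ly k.+1) b) by apply: H_pt1 => //; exact: hsg.
  apply: (@fsol_uniq _ E (fun w => H sg k w /\ M < Re (c * w)) Phi
    (fun w => mxprod T' k *m X k w) (pt (ly k) b) (cvxI (@cH sg k) cM)) => //.
  - by move=> w [_ /rM].
  - by apply: fsol_sub hPhi => w [].
  - by apply: fsol_sub (fsol_mul _ (hX k kN)) => w [].
  rewrite e1 //; last exact/V_pt/ltnW.
  by apply: ih => //; exact/V_pt/ltnW.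
exact: V_pt.
Qed.

(** A solution far above can be chosen equal to every F_k, and one far below equal to Q_k F_k. Going
    left, up, right, down and back to the left therefore multiplies by the inverse of Q_N. *)
Lemma ldat_strips_infinity : exists v r Gam, ldat (at_infinity E) v 0 r Gam (invmx (Q N)).
Proof.
(* Larger than every coordinate of the points u s_k, so the far half-planes contain no singular
   point. *)
pose M : R := 1 + \sum_(k < N) (`|Re (u * s k)| + `|Im (u * s k)|).
have MP k : (k < N)%N -> `|Re (u * s k)| < M /\ `|Im (u * s k)| < M.
  move=> kN; have h : `|Re (u * s k)| + `|Im (u * s k)| < M.
    rewrite /M (bigD1 (Ordinal kN)) //= addrCA ltrDl ltr_wpDr //.
    by apply: sumr_ge0 => i _; rewrite addr_ge0.
  by split; apply: le_lt_trans h; rewrite ?lerDl ?lerDr.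
have M0 : 0 < M by rewrite ltr_wpDr // sumr_ge0 // => i _; rewrite addr_ge0.
have uQ k : (k <= N)%N -> Q k \in unitmx.
  elim: k => [|k ih] kN; first by rewrite unitmx1.
  by rewrite /Q /= unitmx_mul ih ?uT // ltnW.
have E0 w : M < Re (- u * 'i ^+ 0 * w) -> V 0 w.
  rewrite expr0 mulr1 mulNr ReN => h; split=> // N0; apply/hpN.
  by have [+ _] := MP _ N0; rewrite ltr_norml => /andP[a _]; lra.
have E2 w : M < Re (- u * 'i ^+ 2 * w) -> V N w.
  rewrite sqr_i mulrN1 opprK => h; split; last by rewrite ltnn.
  move=> N0; apply/hpP; have N1 : (N.-1 < N)%N by rewrite prednK.
  by have [+ _] := MP _ N1; rewrite ltr_norml => /andP[_ a]; lra.
have e1 w : Re (- u * 'i ^+ 1 * w) = Im (u * w).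
  by rewrite expr1 -mulrA mulrCA ReM !mulNr ReN ImN /= mul0r sub0r mul1r opprK.
have e3 w : Re (- u * 'i ^+ 3 * w) = - Im (u * w).
  have -> : - u * 'i ^+ 3 * w = 'i * (u * w).
    by rewrite exprS sqr_i mulrN1; ring.
  by rewrite ReM /= mul0r sub0r mul1r.
have r1 w : M < Re (- u * 'i ^+ 1 * w) -> reg E w.
  rewrite e1 => h; apply/regE => k kN; apply: contraTneq h => ->.
  by have [_ +] := MP _ kN; rewrite ltr_norml -leNgt => /andP[_ /ltW].
have r3 w : M < Re (- u * 'i ^+ 3 * w) -> reg E w.
  rewrite e3 => h; apply/regE => k kN; apply: contraTneq h => ->.
  by have [_ +] := MP _ kN; rewrite ltr_norml -leNgt => /andP[h _]; lra.
have g0 j : - u * 'i ^+ j != 0.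
  by rewrite mulf_neq0 ?oppr_eq0 // expf_neq0 // -nm_eq0 nm_i oner_neq0.
have cM j : cvx (fun w => M < Re (- u * 'i ^+ j * w)).
  move=> x y t /(farE _ _ (g0 j)) hx /(farE _ _ (g0 j)) hy ht.
  by apply/(farE _ _ (g0 j)); exact: cvx_hp.
have oM j : opn (fun w => M < Re (- u * 'i ^+ j * w)).
  move=> w /(farE _ _ (g0 j)) /opn_hp[r r0 h]; exists r => // z /h h'.
  exact/(farE _ _ (g0 j)).
have b1 a : M < Re (- u * 'i ^+ 1 * pt a (M + 1)) by rewrite e1 u_pt /= ltrDl.
have b3 a : M < Re (- u * 'i ^+ 3 * pt a (- (M + 1))) by rewrite e3 u_pt /= opprK ltrDl.
have [Pu [hPu ePu]] := fsol_exists (F 0 (pt (ly 0) (M + 1))) (cM 1%N) (oM 1%N) r1 (b1 (ly 0)).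
have [Pd [hPd ePd]] := fsol_exists (F 0 (pt (ly 0) (- (M + 1)))) (cM 3%N) (oM 3%N) r3 (b3 (ly 0)).
have SU k z : (k <= N)%N -> V k z -> M < Re (- u * 'i ^+ 1 * z) -> Pu z = F k z.
  move=> kN Vz Mz.
  have := @far_strips (- u * 'i ^+ 1) (- 'i) M (M + 1) Pu Up (fun=> 1%:M) (g0 1%N) b1 r1 hPu
    _ _ _ _ ePu k kN z Vz Mz.
  have -> : mxprod (fun=> 1%:M) k = 1%:M by elim: (k) => //= j ->; rewrite mulmx1.
  rewrite mul1mx; apply.
  - by move=> j jN; have [_ _ []] := hS jN.
  - move=> j a jN; apply/hp_up; rewrite u_pt /=.
    by have [_ +] := MP _ jN; rewrite ltr_norml => /andP[_ h]; lra.
  - by move=> j z' jN; have [_ _ [_ _ h _] _ _] := hS jN; exact: h.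
  by move=> j z' jN; have [_ _ [_ _ _ h] _ _] := hS jN; rewrite mul1mx; exact: h.
have SD k z : (k <= N)%N -> V k z -> M < Re (- u * 'i ^+ 3 * z) -> Pd z = Q k *m F k z.
  move=> kN Vz Mz.
  apply: (@far_strips (- u * 'i ^+ 3) 'i M (- (M + 1)) Pd Lo T (g0 3%N) b3 r3 hPd
    _ _ _ _ ePd k kN z Vz Mz).
  - by move=> j jN; have [_ _ _ []] := hS jN.
  - move=> j a jN; apply/hp_down; rewrite u_pt /=.
    by have [_ +] := MP _ jN; rewrite ltr_norml => /andP[h _]; lra.
  - by move=> j z' jN; have [_ _ _ [_ _ h _] _] := hS jN; exact: h.
  by move=> j z' jN; have [_ _ _ [_ _ _ h] _] := hS jN; exact: h.
pose Psi j : C -> 'M[C]_2 := match j with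
  | 0 => F 0 | 1 => Pu | 2 => F N | _ => (fun z => invmx (Q N) *m Pd z) end.
have [f1 f2] := hF (leq0n N); have [f3 f4] := hF (leqnn N).
apply: (@ldat_at_infinity _ E u M Psi (invmx (Q N)) u0 M0).
- move=> [|[|[|[|//]]]] _ /=.
  - by apply: fsol_sub f1.
  - exact: hPu.
  - by apply: fsol_sub f3.
  exact: fsol_mul.
- move=> [|[|[|[|//]]]] w _ h /=.
  - exact/f2/E0.
  - apply: (fsol_unit (cM 1%N) r1 hPu (b1 (ly 0)) _ h).
    by rewrite ePu f2 //; exact: V_pt.
  - exact/f4/E2.
  rewrite unitmx_mul unitmx_inv uQ //=.
  apply: (fsol_unit (cM 3%N) r3 hPd (b3 (ly 0)) _ h).
  by rewrite ePd f2 //; exact: V_pt.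
- move=> [|[|[|//]]] w _ h h' /=.
  - by rewrite (SU 0%N) //; exact: E0.
  - by rewrite (SU N) //; exact: E2.
  by rewrite (SD N) ?mulKmx ?uQ //; exact: E2.
- by move=> w h h' /=; rewrite (SD 0%N) // ?/Q /= ?mul1mx //; exact: E0.
by rewrite unitmx_inv uQ.
Qed.

End Strips.

(** * Charts on the sphere and the local form of the covering *)

Section Charts.
Variable R : realType.
Local Notation C := R[i].
Local Notation tofrac := (@FracField.tofrac {poly R[i]}).
Implicit Types (E : equation R) (f : ratfun R).

(** With u = 1 - i x, two distinct points have equal projections only if Re(a - b) + x Im(a - b) =
    0, which finitely many real x satisfy. *)
Lemma separating_projection (rs : seq C) : exists2 u : C, u != 0 &
  forall a b, a \in rs -> b \in rs -> Re (u * a) = Re (u * b) -> a = b.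
Proof.
pose lin (a b : C) : {poly R} := if a == b then 1 else (Re (a - b))%:P + Im (a - b) *: 'X.
have lin0 a b : lin a b != 0.
  rewrite /lin; case: (eqVneq a b) => [_|ab]; first exact: oner_neq0.
  apply: contra ab => /eqP h; rewrite -subr_eq0; apply/eqP/complex_ext.
    by move/polyP: h => /(_ 0%N); rewrite coefD coefC coefZ coefX mulr0 addr0 coef0.
  by move/polyP: h => /(_ 1%N); rewrite coefD coefC coefZ coefX mulr1 add0r coef0.
pose P := \prod_(a <- rs) \prod_(b <- rs) lin a b.
have P0 : P != 0.
  rewrite /P prodf_seq_neq0; apply/allP => a _ /=.
  by rewrite prodf_seq_neq0; apply/allP => b _ /=.
have [x hx] := poly_nonroot P0.
exists (1 -i* x); first by rewrite eq_complex /= oner_eq0.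
move=> a b ha hb e; apply/eqP; apply: contraT => ab.
move: hx; rewrite /P horner_prod prodf_seq_neq0 => /allP /(_ a ha) /=.
rewrite horner_prod prodf_seq_neq0 => /allP /(_ b hb) /=.
rewrite /lin (negPf ab) hornerD hornerC hornerZ hornerX ReB ImB.
move: e; rewrite !ReM /= !mul1r !mulNr !opprK => e.
have -> : Re a - Re b + (Im a - Im b) * x = (Re a + x * Im a) - (Re b + x * Im b) by ring.
by rewrite e subrr eqxx.
Qed.

Lemma singular_points E : exists (u : C) (S : seq C), [/\ u != 0, uniq S,
  forall z, reg E z = (z \notin S) &
  forall j k, (j < k)%N -> (k < size S)%N -> Re (u * nth 0 S j) < Re (u * nth 0 S k)].
Proof.
pose p := fden (pcoef E) * fden (qcoef E).
have [rs e] := closed_field_poly_normal p.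
have p0 : p != 0 by rewrite mulf_neq0 ?fden_neq0.
have [u u0 hu] := separating_projection (undup rs).
pose leT (a b : C) := Re (u * a) <= Re (u * b).
have tr : transitive leT by move=> b a c; exact: le_trans.
have tt : total leT by move=> a b; exact: le_total.
have rf : reflexive leT by move=> a; exact: lexx.
exists u, (sort leT (undup rs)); split=> //.
- by rewrite sort_uniq undup_uniq.
- move=> z; rewrite mem_sort mem_undup /reg -negb_or -mulf_eq0 -hornerM -/p e.
  rewrite hornerZ mulf_eq0 lead_coef_eq0 (negPf p0) /=.
  by rewrite -rootE root_prod_XsubC.
move=> j k jk; set S := sort _ _ => kS.
have jS : (j < size S)%N by exact: ltn_trans kS.
have uS : uniq S by rewrite sort_uniq undup_uniq.
have le : leT (nth 0 S j) (nth 0 S k).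
  by apply: (sorted_leq_nth tr rf 0 (sort_sorted tt (undup rs))) => //; exact: ltnW.
rewrite lt_neqAle [_ <= _]le andbT; apply: contraTneq jk => e'.
have e2 : nth 0 S j = nth 0 S k.
  by apply: hu => //; rewrite -(mem_sort leT) mem_nth.
by move/eqP: e2; rewrite nth_uniq // => /eqP ->; rewrite ltnn.
Qed.

Definition chart E (c : option C) : equation R := if c is Some _ then E else at_infinity E.
Definition coord (c : option C) : C := if c is Some z then z else 0.

Definition local_monodromy E (c : option C) (A : 'M[C]_2) : Prop :=
  exists v r Gam, ldat (chart E c) v (coord c) r Gam A.

Lemma global_monodromy E : exists (S : seq C) (T : nat -> 'M[C]_2),
  [/\ uniq S, forall z, reg E z = (z \notin S),
   forall k, (k < size S)%N -> local_monodromy E (Some (nth 0 S k)) (T k) /\ T k \in unitmx,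
   local_monodromy E None (invmx (mxprod T (size S))) &
   forall b (f : 'I_2 -> C^o -> C^o), ordinary E b -> solution_basis E b f ->
     exists2 D, D \in unitmx & forall M, monodromy_group E b f M ->
     exists2 A, mxgen (fun A => exists2 k, (k < size S)%N & A = T k) A & M = D *m A *m invmx D].
Proof.
have [u [S [u0 uS hS inc]]] := singular_points E.
have hr z : reg E z <-> forall k, (k < size S)%N -> z != nth 0 S k.
  rewrite hS; split=> [zS k kS|h]; first by apply: contraNneq zS => ->; exact: mem_nth.
  apply/negP => /(nthP 0)[k kS e]; by have := h k kS; rewrite e eqxx.
have [F [Up [Lo [T [h1 h2]]]]] := strip_system u0 hr inc.
exists S, T; split=> //.
- move=> k kS; split; first exact: (ldat_strips u0 hr inc h1 h2 kS).
  by have [] := h2 k kS.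
- exact: (ldat_strips_infinity u0 hr inc h1 h2).
by move=> b f; exact: (monodromy_strips u0 hr inc h1 h2).
Qed.

Lemma ldat_regular E c : reg E c -> exists v r Gam, ldat E v c r Gam 1%:M.
Proof.
move=> /fsol_local[r r0 [rE [F [hF Fc]]]].
exists 1, r, (fun=> F); split=> //.
- by move=> z hz _; exact: rE.
- by move=> k; apply: fsol_sub hF => z [].
- move=> k z [hz _]; apply: (fsol_unit (@cvx_ball _ c r) rE hF (ballC_center c r0)) => //.
  by rewrite Fc unitmx1.
by move=> k z _; rewrite mul1mx.
Qed.

(** The pullback by the identity, with ramification index 1. *)
Lemma trivial_monodromyP E c v r Gam A : ldat E v c r Gam A ->
  trivial_local_monodromy E c <-> is_scalar_mx A.
Proof.
move=> D; have := @trivial_monodromy_pullback R E v c r Gam A D (tofrac 'X) c 1 1 (fun=> 1).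
rewrite pullbackX expr1; apply=> //; first exact: nonconstX.
move=> eps eps0; have [d d0 hd] := cofin_punctured c (rep_poly ('X : {poly C})).
exists d => // z zd zc; have [_ ->] := hd z zd zc.
by rewrite hornerX mulr1 expr1 addrC subrK subrr nm0.
Qed.

(** At an ordinary point the local monodromy is trivial, so nontriviality already implies
    singularity. *)
Lemma nonapparentE E (x : option C) : nonapparent_singularities E x <->
  ~ trivial_local_monodromy (chart E x) (coord x).
Proof.
have ord E' z : ordinary E' z -> trivial_local_monodromy E' z.
  move=> /regP /ldat_regular[v [r [Gam D]]].
  by apply/(trivial_monodromyP D); apply/is_scalar_mxP; exists 1.
rewrite /nonapparent_singularities /= /apparent; split.
  by case: x => [z|] /= [s h] t; apply: h.
move=> h; split; first by case: x h => [z|] /= h /ord.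
by case: x h => [z|] /= h [].
Qed.

Lemma nonapparent_local_monodromy E (x : option C) A : local_monodromy E x A ->
  nonapparent_singularities E x <-> ~ is_scalar_mx A.
Proof.
move=> [v [r [Gam D]]]; rewrite nonapparentE.
by split=> h k; apply: h; apply/(trivial_monodromyP D).
Qed.

(** In the chart at [c] the covering is [coord c + fiber_poly f c / fdenc f c], see [rep_fchart]. *)
Definition fdenc f (c : option C) : {poly C} := if c is Some _ then fden f else fnum f.
Definition fchart f (c : option C) : ratfun R := if c is Some _ then f else f^-1.
Definition xchart f (x : option C) : ratfun R := if x is Some _ then f else fcomp f (tofrac 'X)^-1.

Lemma fiber_poly_neq0 f c : ramified_covering f -> fiber_poly f c != 0.
Proof. by case: c => [a|] nf; [exact: nonconst_fiber|exact: fden_neq0]. Qed.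

Lemma fdenc_root f c z : (fiber_poly f c).[z] = 0 -> (fdenc f c).[z] != 0.
Proof.
case: c => [a|] /=; last exact: fnum_fden_neq0.
move=> h; apply/negP => /eqP h'; have := fnum_fden_neq0 h'.
by move: h; rewrite hornerD hornerN hornerZ h' mulr0 subr0 => ->; rewrite eqxx.
Qed.

Lemma size_fnum f : (size (fnum f) <= (fdegree f).+1)%N.
Proof. by rewrite /fdegree; lia. Qed.

Lemma size_fden f : (size (fden f) <= (fdegree f).+1)%N.
Proof. by rewrite /fdegree; lia. Qed.

Lemma size_fiber_poly f c : (size (fiber_poly f c) <= (fdegree f).+1)%N.
Proof.
case: c => [a|] /=; last exact: size_fden.
apply: (leq_trans (size_polyD _ _)); rewrite geq_max size_fnum size_polyN.
by apply: (leq_trans (size_scale_leq _ _)); exact: size_fden.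
Qed.

Lemma size_fdenc f c : (size (fdenc f c) <= (fdegree f).+1)%N.
Proof. by case: c => [a|] /=; [exact: size_fden|exact: size_fnum]. Qed.

Lemma coef_fdegree f : ramified_covering f -> ((fnum f)`_(fdegree f) != 0) || ((fden f)`_(fdegree f) != 0).
Proof.
rewrite /ramified_covering => d0.
have [h|h] := leqP (size (fnum f)).-1 (size (fden f)).-1; apply/orP; [right|left].
  have e : fdegree f = (size (fden f)).-1 by rewrite /fdegree; lia.
  by rewrite e -/(lead_coef _) lead_coef_eq0 fden_neq0.
have e : fdegree f = (size (fnum f)).-1 by rewrite /fdegree; lia.
rewrite e -/(lead_coef _) lead_coef_eq0; apply: contraTneq d0 => h0.
by move: h; rewrite h0 size_poly0.
Qed.

Lemma fdenc_coef f c : ramified_covering f -> (fiber_poly f c)`_(fdegree f) = 0 ->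
  (fdenc f c)`_(fdegree f) != 0.
Proof.
move=> /coef_fdegree; case: c => [a|] /=; last by move=> + h; rewrite h eqxx orbF.
move=> /orP[h|//]; rewrite coefB coefZ => /eqP; rewrite subr_eq0 => /eqP e.
by apply: contraNneq h => h'; rewrite e h' mulr0.
Qed.

Lemma rep_fchart f c : rep (fchart f c) (fun z => coord c + (fiber_poly f c).[z] / (fdenc f c).[z]).
Proof.
case: c => [a|] /=.
  apply: (rep_ext (rep_feval f)); exists (fden f); first exact: fden_neq0.
  move=> z hz; rewrite hornerD hornerN hornerZ mulrBl mulfK // addrC subrK //.
apply: (rep_ext (rep_inv (rep_feval f))); apply: cofinT => z.
by rewrite /feval invf_div add0r.
Qed.

Lemma nonconst_fchart f c : ramified_covering f -> ramified_covering (fchart f c).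
Proof. by case: c => [a|] //=; exact: nonconstV. Qed.

Lemma nonconst_xchart f x : ramified_covering f -> ramified_covering (xchart f x).
Proof. by case: x => [a|] //= nf; apply: nonconst_fcomp => //; exact/nonconstV/nonconstX. Qed.

Lemma xchart_fchart f c x : ramified_covering f -> xchart (fchart f c) x = fchart (xchart f x) c.
Proof.
move=> nf; case: x => [z|]; case: c => [a|] //=.
have nX := nonconstV (@nonconstX R); have rX := rep_inv (rep_poly ('X : {poly C})).
apply: rep_uniq (rep_comp nX rX (rep_inv (rep_feval f))) _.
exact: rep_inv (rep_comp nX rX (rep_feval f)).
Qed.

Lemma chart_pullback f E c x : ramified_covering f ->
  chart (pullback f E) x = pullback (fchart (xchart f x) c) (chart E c).
Proof.
move=> nf; have e : chart (pullback f E) x = pullback (xchart f x) E.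
  by case: x => [z|] //=; exact: at_infinity_pullback.
rewrite e; case: c => [a|] //=; rewrite pullback_at_infinity //; exact: nonconst_xchart.
Qed.

(** The reciprocal polynomial z^n p(1/z), which moves infinity to 0. *)
Definition revp n (p : {poly C}) : {poly C} := \poly_(i < n.+1) p`_(n - i).

Lemma revpE n (p : {poly C}) z : (size p <= n.+1)%N -> z != 0 -> (revp n p).[z] = z ^+ n * p.[z^-1].
Proof.
move=> sp z0; rewrite horner_poly (horner_coef_wide _ sp) mulr_sumr.
rewrite (reindex_inj rev_ord_inj) /=; apply: eq_bigr => i _.
have ip : (i <= n)%N by rewrite -ltnS.
rewrite subSS subKn // exprVn.
have -> : z ^+ n = z ^+ (n - i) * z ^+ i by rewrite -exprD subnK.
by rewrite mulrCA mulfK ?expf_neq0.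
Qed.

Lemma revp0 n p : (revp n p).[0] = p`_n.
Proof. by rewrite horner_coef0 coef_poly /= subn0. Qed.

(** The zero of [fiber_poly f c] at [x] is split off. At infinity its order is the drop of the
    degree below [fdegree f], which reversal turns into a zero at 0. *)
Lemma local_form f c x : ramified_covering f -> (0 < fiber_mult f c x)%N ->
  exists P Q : {poly C}, [/\ P.[coord x] != 0, Q.[coord x] != 0 &
   rep (fchart (xchart f x) c) (fun z => coord c + (z - coord x) ^+ fiber_mult f c x * (P.[z] / Q.[z]))].
Proof.
move=> nf; rewrite -xchart_fchart //; case: x => [z0|] /= e0.
  have p0 := fiber_poly_neq0 c nf.
  have [m [q]] := multiplicity_XsubC (fiber_poly f c) z0; rewrite p0 /= => q0 ep.
  have em : mup z0 (fiber_poly f c) = m.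
    by rewrite ep mupMr // mup_XsubCX eqxx.
  exists q, (fdenc f c); split=> //.
    apply: fdenc_root; rewrite ep hornerM horner_exp hornerXsubC subrr expr0n.
    by move: e0; rewrite em; case: m {ep em} => // m _; rewrite mulr0.
  apply: (rep_ext (rep_fchart f c)); apply: cofinT => z; rewrite em {1}ep.
  by rewrite hornerM horner_exp hornerXsubC; ring.
set d := fdegree f in e0 *; set e := (d - (size (fiber_poly f c)).-1)%N in e0 *.
have p0 := fiber_poly_neq0 c nf.
have sp := size_fiber_poly f c; rewrite -/d in sp.
have spe : (size (fiber_poly f c)).-1 = (d - e)%N by rewrite /e; lia.
have s0 : (0 < size (fiber_poly f c))%N by rewrite size_poly_gt0.
have dl : (size (fiber_poly f c) <= d)%N by move: e0; rewrite /e; lia.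
exists (revp (d - e) (fiber_poly f c)), (revp d (fdenc f c)); split.
- by rewrite revp0 -spe -/(lead_coef _) lead_coef_eq0.
- by rewrite revp0; apply: fdenc_coef => //; rewrite nth_default.
have nX := nonconstV (@nonconstX R); have rX := rep_inv (rep_poly ('X : {poly C})).
apply: (rep_ext (rep_comp nX rX (rep_fchart f c))).
exists 'X; first by rewrite polyX_eq0.
move=> z; rewrite hornerX => z0; congr (_ + _).
rewrite subr0 revpE //; last by lia.
rewrite revpE ?size_fdenc //.
have e1 : z ^+ d = z ^+ (d - e) * z ^+ e by rewrite -exprD subnK // /e leq_subr.
have [->|y0] := eqVneq (fdenc f c).[z^-1] 0; first by rewrite !(mulr0, invr0).
rewrite e1 -!mulrA; have h1 : z ^+ (d - e) != 0 by rewrite expf_neq0.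
have h2 : z ^+ e != 0 by rewrite expf_neq0.
move: y0 h1 h2; set a := (fdenc f c).[_]; set b := (fiber_poly f c).[_].
by set u := z ^+ (d - e); set w := z ^+ e; move=> y0 h1 h2; rewrite !invfM; move: (divff h1) (divff h2) => g1 g2;
  rewrite -[LHS]mulr1 -g1 -[LHS]mulr1 -g2; ring.
Qed.

(** By [local_form] the covering is c + (z - x)^e h(z) with h(x) nonzero, so the monodromy at [x] is
    trivial exactly if A^e is scalar. *)
Lemma nonapparent_pullback f E c x A : ramified_covering f -> local_monodromy E c A ->
  (0 < fiber_mult f c x)%N ->
  nonapparent_singularities (pullback f E) x <-> ~ is_scalar_mx (A ^+ fiber_mult f c x).
Proof.
move=> nf [v [r [Gam D]]] e0; rewrite nonapparentE (chart_pullback E c x nf).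
have [P [Q [P0 Q0 hrep]]] := local_form nf e0.
pose h z := P.[z] / Q.[z].
have a0 : h (coord x) != 0 by rewrite mulf_neq0 ?invr_eq0.
have nf' : ramified_covering (fchart (xchart f x) c) by exact/nonconst_fchart/nonconst_xchart.
have key := @trivial_monodromy_pullback R _ v _ r Gam A D _ (coord x) _ _ h nf' e0 a0.
suff H : forall eps : R, 0 < eps -> exists2 d : R, 0 < d & forall z, ballC (coord x) d z -> z != coord x ->
  feval (fchart (xchart f x) c) z = coord c + (z - coord x) ^+ fiber_mult f c x * h z /\ nm (h z - h (coord x)) < eps.
  by split=> k k'; apply: k; apply/(key H).
move=> eps eps0.
have [d1 d10 h1] := cofin_punctured (coord x) hrep.
have hc := cderM (cder_horner P (coord x)) (cderV Q0 (cder_horner Q (coord x))).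
have [d2 d20 h2] := cder_cont hc eps0.
exists (Num.min d1 d2); first by rewrite lt_min d10.
move=> z /ballC_min[z1 z2] zx; split; last exact: h2.
by have [_] := h1 z z1 zx.
Qed.

End Charts.

(** * The Riemann-Hurwitz inequality *)

Section RiemannHurwitz.
Variable R : realType.
Local Notation C := R[i].
Implicit Types f : ratfun R.

Lemma sum_count_mem_uniq (T : eqType) (zs rs : seq T) : uniq zs ->
  (\sum_(z <- zs) count_mem z rs = count [in zs] rs)%N.
Proof.
move=> uz; elim: rs => [|r rs ih] /=; first by rewrite big1_seq.
rewrite big_split /= ih; congr addn.
by rewrite -count_uniq_mem // -sum1_count [RHS]big_mkcond; apply: eq_bigr => z _; rewrite eq_sym /=; case: eqP.
Qed.

Lemma mup_roots (p : {poly C}) : p != 0 -> exists2 rs : seq C,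
  size p = (size rs).+1 & forall z, mup z p = count_mem z rs.
Proof.
move=> p0; have [rs e] := closed_field_poly_normal p; exists rs.
  by rewrite e size_scale ?lead_coef_eq0 // size_prod_XsubC.
have l0 : lead_coef p != 0 by rewrite lead_coef_eq0.
by move=> z; rewrite e -mul_polyC mupMr ?rootC // mu_prod_XsubC.
Qed.

Lemma sum_mup_leq (p : {poly C}) (zs : seq C) : p != 0 -> uniq zs ->
  (\sum_(z <- zs) mup z p <= (size p).-1)%N.
Proof.
move=> /mup_roots[rs -> h] uz; rewrite (eq_bigr _ (fun z _ => h z)).
by rewrite sum_count_mem_uniq // count_size.
Qed.

Definition wronskian f := (fnum f)^`() * fden f - fnum f * (fden f)^`().

Lemma wronskian_neq0 f : ramified_covering f -> wronskian f != 0.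
Proof.
move=> nf; apply/eqP => w0; have [z] := cofin_ex (fderiv_nonconst nf).
have e : fderiv f = 0 by rewrite /fderiv -/(wronskian f) w0 tofrac0 mul0r.
have := ratfun_numden (fderiv f); rewrite {1}e => /esym/eqP.
rewrite mulf_eq0 invr_eq0 (negPf (tofrac_neq0 (fden_neq0 _))) orbF => h.
rewrite /feval; suff -> : fnum (fderiv f) = 0 by rewrite horner0 mul0r eqxx.
by apply/eqP; apply: contraT => /tofrac_neq0; rewrite h.
Qed.

(** A change of coordinate on the target changes the Wronskian only by a constant, so it can be
    computed from any fibre polynomial. *)
Lemma wronskian_fiber f c : exists2 s : C, s != 0 &
  wronskian f = s *: ((fiber_poly f c)^`() * fdenc f c - fiber_poly f c * (fdenc f c)^`()).
Proof.
case: c => [a|] /=.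
  by exists 1; rewrite ?oner_neq0 // scale1r derivB derivZ -!mul_polyC /wronskian; ring.
exists (-1); first by rewrite oppr_eq0 oner_neq0.
by rewrite scaleN1r opprB /wronskian mulrC; congr (_ - _); rewrite mulrC.
Qed.

(** If ('X - z)^e divides the fibre polynomial, then ('X - z)^(e-1) divides both it and its
    derivative. *)
Lemma wronskian_mup f c z : ramified_covering f ->
  ((fiber_mult f c (Some z)).-1 <= mup z (wronskian f))%N.
Proof.
move=> nf; rewrite mup_geq ?wronskian_neq0 //.
have [s s0 ->] := wronskian_fiber f c; rewrite dvdpZr //=.
set p := fiber_poly f c; have p0 : p != 0 by exact: fiber_poly_neq0.
case e : (mup z p) => [|m] /=; first by rewrite expr0 dvd1p.
have : ('X - z%:P) ^+ m.+1 %| p by rewrite -mup_geq // e.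
case/dvdpP => q eq; rewrite {1 2}eq derivM deriv_exp derivXsubC mul1r /= exprSr.
by apply/dvdpP; exists ((q^`() * ('X - z%:P) + q *+ m.+1) * fdenc f c - q * ('X - z%:P) * (fdenc f c)^`()); ring.
Qed.

Lemma size_deriv_leq (p : {poly C}) : (size p^`() <= (size p).-1)%N.
Proof. by have [->|/lt_size_deriv] := eqVneq p 0; [rewrite linear0 size_poly0|lia]. Qed.

(** Index e at infinity means that the fibre polynomial has degree d - e, so the Wronskian has
    degree at most 2d - 1 - e. *)
Lemma wronskian_size f c : ramified_covering f -> (0 < fiber_mult f c None)%N ->
  (size (wronskian f) <= (fdegree f).*2 - fiber_mult f c None)%N.
Proof.
move=> nf; have [s s0 ->] := wronskian_fiber f c; rewrite size_scale //=.
have p0 := fiber_poly_neq0 c nf; rewrite -size_poly_gt0 in p0.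
have aux (a b a' b' x y d : nat) : (x <= (a' + b).-1 -> y <= (a + b').-1 -> 0 < a -> a' <= a.-1 ->
    b' <= b.-1 -> b <= d.+1 -> 0 < d - a.-1 ->
    (x <= d.*2 - (d - a.-1)) && (y <= d.*2 - (d - a.-1)))%N by lia.
move=> h; apply: (leq_trans (size_polyD _ _)); rewrite geq_max size_polyN.
exact: (aux _ _ _ _ _ _ _ (size_polyMleq _ _) (size_polyMleq _ _) p0 (size_deriv_leq _)
  (size_deriv_leq _) (size_fdenc f c) h).
Qed.

Definition cval f (x : option C) : option C :=
  if x is Some z then if (fden f).[z] == 0 then None else Some ((fnum f).[z] / (fden f).[z])
  else if (fden f)`_(fdegree f) == 0 then None
       else Some ((fnum f)`_(fdegree f) / (fden f)`_(fdegree f)).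

Lemma fiber_mult_gt0 f c x : ramified_covering f -> (0 < fiber_mult f c x)%N = (cval f x == c).
Proof.
move=> nf; have p0 := fiber_poly_neq0 c nf.
have key (u v a : C) : v != 0 -> (u - a * v == 0) = (Some (u / v) == Some a).
  move=> v0; rewrite subr_eq0; apply/eqP/eqP => [->|[<-]]; first by rewrite mulfK.
  by rewrite divfK.
case: x => [z|] /=.
  rewrite -XsubC_dvd // dvdp_XsubCl rootE; case: c {p0} => [a|] /=; last by case: eqVneq.
  rewrite hornerD hornerN hornerZ; have [h|h] := eqVneq (fden f).[z] 0; last exact: key.
  by rewrite h mulr0 subr0 (negPf (fnum_fden_neq0 h)).
have sp := size_fiber_poly f c.
have -> : (0 < fdegree f - (size (fiber_poly f c)).-1)%N = ((fiber_poly f c)`_(fdegree f) == 0).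
  have aux (s d : nat) : (0 < d - s.-1 -> s <= d)%N by lia.
  apply/idP/eqP => h; first by rewrite nth_default // aux.
  move: p0; rewrite -lead_coef_eq0 /lead_coef subn_gt0; apply: contraR; rewrite -leqNgt => h'.
  have -> : (size (fiber_poly f c)).-1 = fdegree f by move: h' sp nf; rewrite /ramified_covering; lia.
  by rewrite h.
case: c {p0 sp} => [a|] /=; last by case: eqVneq.
rewrite coefB coefZ; have [h|h] := eqVneq (fden f)`_(fdegree f) 0; last exact: key.
by have := coef_fdegree nf; rewrite h mulr0 subr0 eqxx orbF => /negPf ->.
Qed.

Lemma fiber_seq f c : ramified_covering f -> exists s : seq (option C),
  [/\ uniq s, forall x, (x \in s) = (cval f x == c) &
      (\sum_(x <- s) fiber_mult f c x = fdegree f)%N].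
Proof.
move=> nf; have p0 := fiber_poly_neq0 c nf.
have [rs ers hrs] := mup_roots p0.
exists ((if (0 < fiber_mult f c None)%N then [:: None] else [::]) ++ map Some (undup rs)); split.
- rewrite cat_uniq map_inj_uniq ?undup_uniq ?andbT; last by move=> ? ? [].
  apply/andP; split; first by case: ifP.
  by apply/hasPn => _ /mapP[z _ ->]; case: ifP.
- move=> x; rewrite mem_cat -fiber_mult_gt0 //; case: x => [z|].
    rewrite mem_map ?mem_undup; last by move=> ? ? [].
    by rewrite /= hrs -has_count has_pred1; case: ifP.
  have -> : (None \in map Some (undup rs)) = false by apply/mapP => -[].
  by rewrite orbF; case: ifP.
rewrite big_cat big_map /= (eq_bigr _ (fun z _ => hrs z)).
rewrite sum_count_mem_uniq ?undup_uniq //.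
have -> : count [in undup rs] rs = size rs.
  by apply/eqP; rewrite -all_count; apply/allP => z; rewrite /= mem_undup.
have := size_fiber_poly f c; move: (ers); set a := size (fiber_poly f c) => ea.
by case: ifP; rewrite ?big_seq1 ?big_nil /= -/a ea /=; lia.
Qed.

(** The Wronskian has at most 2d - 1 - e finite zeros, with e the index at infinity; the
    contribution e - 1 of infinity completes 2d - 2. *)
Lemma ramification_leq f (L : seq (option C)) : ramified_covering f -> uniq L ->
  (\sum_(x <- L) (fiber_mult f (cval f x) x).-1 <= (fdegree f).*2 - 2)%N.
Proof.
move=> nf uL; have W0 := wronskian_neq0 nf.
have e0 : (0 < fiber_mult f (cval f None) None)%N by rewrite fiber_mult_gt0.
have hs := wronskian_size nf e0; have sW : (0 < size (wronskian f))%N by rewrite size_poly_gt0.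
pose Z := pmap id L.
have uZ : uniq Z by rewrite /Z; elim: L uL {Z} => //= x L ih /andP[xL /ih h]; case: x xL => //= z zL; rewrite h andbT mem_pmap map_id.
have hle (x : option C) : ((fiber_mult f (cval f x) x).-1 <= if x is Some z then mup z (wronskian f)
    else (fiber_mult f (cval f None) None).-1)%N by case: x => [z|] //; exact: wronskian_mup.
have h1 : (\sum_(x <- L) (fiber_mult f (cval f x) x).-1 <=
   \sum_(z <- Z) mup z (wronskian f) + (fiber_mult f (cval f None) None).-1)%N.
  move: hle; rewrite /Z; set E := (fiber_mult f (cval f None) None).-1.
  pose F x := (fiber_mult f (cval f x) x).-1; move=> hle; rewrite -/(\sum_(x <- L) F x)%N.
  apply: (@leq_trans (\sum_(z <- pmap id L) mup z (wronskian f) + (None \in L) * E)%N); last first.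
    by rewrite leq_add2l; case: (None \in L); rewrite ?mul1n.
  elim: L uL {uZ Z} => [|x L ih] /=; first by rewrite !big_nil.
  move=> /andP[xL /ih h]; rewrite big_cons in_cons; have := hle x; rewrite -/(F x); case: x xL => [z|] /= xL h'.
    by rewrite big_cons -addnA leq_add.
  by rewrite addnC mul1n leq_add //; apply: leq_trans h _; rewrite (negPf xL) addn0.
have := sum_mup_leq W0 uZ; move: h1 hs sW e0; lia.
Qed.

(** Over one value, d minus the number of points is the sum of e - 1 over the fibre, and distinct
    fibres are disjoint. *)
Lemma riemann_hurwitz f (fib : option C -> seq (option C)) (Cs : seq (option C)) :
  ramified_covering f -> uniq Cs ->
  (forall c, [/\ uniq (fib c), forall x, (x \in fib c) = (cval f x == c) &
      (\sum_(x <- fib c) fiber_mult f c x = fdegree f)%N]) ->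
  (\sum_(c <- Cs) (fdegree f - size (fib c)) <= (fdegree f).*2 - 2)%N.
Proof.
move=> nf uCs hfib.
have uL : uniq (flatten (map fib Cs)).
  elim: Cs uCs => //= c Cs ih /andP[cCs /ih h]; rewrite cat_uniq h andbT.
  have [-> hc _] := hfib c; apply/hasPn => x /flattenP[_ /mapP[c' hc' ->]].
  have [_ -> _] := hfib c'; rewrite /= hc => /eqP ->.
  by apply: contraNneq cCs => <-.
apply: leq_trans (ramification_leq nf uL); rewrite big_flatten big_map.
apply: leq_sum => c _; have [_ hc <-] := hfib c.
rewrite leq_subLR -sum1_size -big_split /= big_seq [X in (_ <= X)%N]big_seq.
by apply: leq_sum => x; rewrite hc => /eqP <-; case: fiber_mult.
Qed.

End RiemannHurwitz.

(** * Groups contained in finitely many hyperplanes *)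

Section Covered.
Variable R : realType.
Local Notation C := R[i].
Implicit Types (A B K M : 'M[C]_2) (P G : 'M[C]_2 -> Prop).

(** A concrete obstruction to density: every linear form on matrices is M -> tr(K M), and finitely
    many of them have kernels that cover the group. *)
Definition covered P := exists2 Ks : seq 'M[C]_2, all (fun K => K != 0) Ks &
  forall M, mxgen P M -> exists2 K, K \in Ks & \tr (K *m M) = 0.

Definition trace_form (K : 'M[C]_2) : mpoly.mpoly (2 * 2) C :=
  \sum_(k < 2 * 2) mxvec K^T 0 k *: mpoly.mpolyX C (mpoly.mnm1 k).

Lemma trace_formE K M : mpoly.meval (fun k => mxvec M 0 k) (trace_form K) = \tr (K *m M).
Proof.
rewrite /trace_form raddf_sum mxtrace_mulC /mxtrace /=.
under eq_bigr => k _ do rewrite mpoly.mevalZ mpoly.mevalXU.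
under [RHS]eq_bigr => i _ do rewrite mxE.
rewrite [RHS]pair_big (reindex _ (curry_mxvec_bij 2 2)) /=.
by apply: eq_bigr => -[i j] _ /=; rewrite !mxvecE mxE mulrC.
Qed.

Lemma trace_form_homog K : trace_form K \is @mpoly.ishomog1 (2 * 2) C 1 mpoly.mdeg.
Proof.
rewrite /trace_form; apply: rpred_sum => k _; apply: mpoly.dhomogZ.
by rewrite mpoly.dhomogX; apply/eqP; exact: mpoly.mdeg1.
Qed.

(* The entries of this curve are linearly independent functions of t, so that no *)
(* finite union of hyperplanes contains it.                                      *)
Definition moment (t : C) : 'M[C]_2 :=
  \matrix_(i, j) if i == 0 then (if j == 0 then t else 1) else (if j == 0 then t ^+ 2 else t ^+ 4).

Definition moment_poly K : {poly C} := Poly [:: K 1 0; K 0 0; K 0 1; 0; K 1 1].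

Lemma moment_polyE K t : (moment_poly K).[t] = \tr (K *m moment t).
Proof.
rewrite /moment_poly horner_Poly /= /mxtrace !big_ord_recl !big_ord0 !mxE !big_ord_recl !big_ord0 !mxE /=.
rewrite (_ : lift ord0 ord0 = 1 :> 'I_2); last exact: val_inj.
rewrite (_ : ord0 = 0) //; ring.
Qed.

Lemma moment_poly_neq0 K : K != 0 -> moment_poly K != 0.
Proof.
apply: contraNneq => /polyP h; apply/eqP/matrixP => i j; rewrite [RHS]mxE.
have := h 0%N; have := h 1%N; have := h 2%N; have := h 4%N; rewrite !coef_Poly !coef0 /= => h4 h2 h1 h0.
by move: i j; apply: ord2_ind; apply: ord2_ind.
Qed.

Lemma det_moment t : \det (moment t) = t ^+ 5 - t ^+ 2.
Proof. rewrite (expand_det_row _ 0) !big_ord_recl big_ord0 /cofactor !det_mx11 !mxE /=.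
by rewrite /bump /=; ring. Qed.

(** The product of the linear forms, conjugated by [D], is homogeneous and vanishes on [G], yet it
    is nonzero at some invertible matrix of the moment curve. *)
Lemma covered_nondense P (G : set 'M[C]_2) D : covered P -> D \in unitmx ->
  (forall M, G M -> exists2 A, mxgen P A & M = D *m A *m invmx D) -> ~ zariski_dense_PGL2 G.
Proof.
move=> [Ks Ks0 hK] Du hG dense.
pose conj K := D *m K *m invmx D.
have conj0 K : K != 0 -> conj K != 0.
  apply: contraNneq => /(congr1 (fun X => invmx D *m X *m D)).
  by rewrite /conj !mulmxA mulVmx // mul1mx mulmxKV // mulmx0 mul0mx => ->.
pose F := \prod_(K <- Ks) trace_form (conj K).
have FE M : mpoly.meval (fun k => mxvec M 0 k) F = \prod_(K <- Ks) \tr (conj K *m M).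
  by rewrite rmorph_prod; apply: eq_bigr => K _; exact: trace_formE.
have Fh : F \is @mpoly.ishomog1 (2 * 2) C (size Ks) mpoly.mdeg.
  rewrite /F; elim: (Ks) => [|K s ih]; first by rewrite big_nil mpoly.dhomog1.
  by rewrite big_cons; exact: (mpoly.dhomogM (trace_form_homog (conj K)) ih).
have F0 M : G M -> mpoly.meval (fun k => mxvec M 0 k) F = 0.
  move=> /hG[A /hK[K hKs e] ->]; rewrite FE; apply/eqP; rewrite prodf_seq_eq0.
  apply/hasP; exists K => //=; rewrite /conj !mulmxA mulmxKV // mxtrace_mulC !mulmxA mulVmx // mul1mx.
  by rewrite e.
have q0 : ('X^5 - 'X^2) * \prod_(K <- Ks) moment_poly (conj K) != 0.
  rewrite mulf_neq0 //.
    by apply/eqP => /polyP /(_ 5%N); rewrite coefB !coefXn /= subr0 coef0 => /eqP; rewrite oner_eq0.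
  rewrite prodf_seq_neq0; apply/allP => K hKs /=.
  by apply/moment_poly_neq0/conj0; exact: (allP Ks0).
have [t] := poly_nonroot q0; rewrite hornerM mulf_eq0 negb_or => /andP[t1].
rewrite horner_prod; under eq_bigr => K _ do rewrite moment_polyE.
rewrite -FE (dense _ _ Fh F0) ?eqxx //.
by rewrite unitmxE det_moment unitfE; move: t1; rewrite hornerD hornerN !hornerXn.
Qed.

(** Commuting with the matrix units at (0, 0) and (0, 1) already makes [A] scalar. *)
Lemma nonscalar_commute A : ~ is_scalar_mx A -> exists K, A *m K <> K *m A.
Proof.
move=> nA; apply: contrapT => h; apply: nA.
have c K : A *m K = K *m A by apply: contrapT => hK; apply: h; exists K.
have e i j i' j' : (A *m delta_mx i j) i' j' = A i' i * (j == j')%:R.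
  rewrite mxE (bigD1 i) //= mxE eqxx [j' == j]eq_sym big1 ?addr0 // => k /negPf ki.
  by rewrite mxE ki mulr0.
have e' i j i' j' : (delta_mx i j *m A) i' j' = (i' == i)%:R * A j j'.
  rewrite mxE (bigD1 j) //= mxE eqxx andbT big1 ?addr0 // => k /negPf ki.
  by rewrite mxE ki andbF mul0r.
apply/is_scalar_mxP; exists (A 0 0); apply/matrixP => i j; rewrite !mxE.
have h1 := congr1 (fun X : 'M[C]_2 => X 0 1) (c (delta_mx 0 0)).
have h2 := congr1 (fun X : 'M[C]_2 => X 1 0) (c (delta_mx 0 0)).
have h3 := congr1 (fun X : 'M[C]_2 => X 0 1) (c (delta_mx 0 1)).
move: h1 h2 h3; rewrite /= !e !e' /= !(mulr1, mul1r, mulr0, mul0r) => h1 h2 h3.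
by move: i j; apply: ord2_ind; apply: ord2_ind; rewrite /= ?mulr1n ?mulr0n.
Qed.

Lemma nonscalar_intertwiner A X : ~ is_scalar_mx A -> exists K, A *m K - K *m X != 0.
Proof.
move=> /nonscalar_commute[K hK].
have [e|e] := eqVneq (A - X) 0; last by exists 1%:M; rewrite mulmx1 mul1mx.
have -> : X = A by apply/eqP; rewrite eq_sym -subr_eq0 e.
by exists K; rewrite subr_eq0; apply/eqP.
Qed.

(** If M A = X M, then tr((A K - K X) M) = tr(K M A) - tr(K X M) = 0; for each X some K makes A K -
    K X nonzero. *)
Lemma covered_intertwine P A (Xs : seq 'M[C]_2) : ~ is_scalar_mx A ->
  (forall M, mxgen P M -> exists2 X, X \in Xs & M *m A = X *m M) -> covered P.
Proof.
move=> nA h; pose k X := projT1 (cid (nonscalar_intertwiner X nA)).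
exists [seq A *m k X - k X *m X | X <- Xs].
  by apply/allP => _ /mapP[X _ ->]; rewrite /k; case: cid.
move=> M /h[X hX e]; exists (A *m k X - k X *m X); first exact: map_f.
by rewrite mulmxBl raddfB /= -!mulmxA -e mxtrace_mulC [in X in _ - X]mulmxA subrr.
Qed.

(** With d = diag(1, -1), the trace of d W^-1 (c W) is c tr(d) = 0. *)
Lemma covered_finite P (Ws : seq 'M[C]_2) : {subset Ws <= unitmx} ->
  (forall M, mxgen P M -> exists2 W, W \in Ws & exists c, M = c *: W) -> covered P.
Proof.
move=> uW h; pose d : 'M[C]_2 := \matrix_(i, j) ((i == j)%:R * (-1) ^+ i).
exists [seq d *m invmx W | W <- Ws].
  apply/allP => _ /mapP[W hW ->]; apply/eqP => /(congr1 (fun X => X *m W)).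
  rewrite mulmxKV ?uW // mul0mx => /matrixP/(_ 0 0); rewrite !mxE eqxx mul1r expr0 => /eqP.
  by rewrite oner_eq0.
move=> M /h[W hW [c ->]]; exists (d *m invmx W); first exact: map_f.
rewrite -scalemxAr mxtraceZ mulmxKV ?uW // /mxtrace !big_ord_recl big_ord0 !mxE /=.
by rewrite /bump /=; ring.
Qed.

Lemma mxgen_sub P P' M : (forall B, P B -> mxgen P' B) -> (forall B, P' B -> B \in unitmx) ->
  mxgen P M -> mxgen P' M.
Proof.
move=> h u; elim=> [|A B _ hA _ hB|A hA|A hA]; [exact: mxgen1|exact: mxgenM|exact: h|].
by have [] := mxgen_unit u (h _ hA).
Qed.

Lemma covered_sub P P' : (forall B, P B -> mxgen P' B) -> (forall B, P' B -> B \in unitmx) ->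
  covered P' -> covered P.
Proof. by move=> h u [Ks Ks0 hK]; exists Ks => // M /(mxgen_sub h u) /hK. Qed.

End Covered.

(** * Finiteness of von Dyck groups by rewriting *)

Section Words.

Definition rewrite_head (rs : seq (seq bool * seq bool)) (w : seq bool) :=
  foldr (fun r acc => if prefix r.1 w then r.2 ++ drop (size r.1) w else acc) w rs.

Fixpoint rewrite_pass rs (w : seq bool) :=
  if w is x :: w' then rewrite_head rs (x :: rewrite_pass rs w') else [::].

(* Knuth-Bendix completion step: overlap the last k letters of the left side of rule i *)
(* with the first k letters of the left side of rule j, and reduce both ways; b tells   *)
(* which of the two results is the smaller one.                                          *)
Definition add_rule rs (c : nat * nat * nat * bool) :=
  let: (i, j, k, b) := c in
  let: (l1, r1) := nth ([::], [::]) rs i in let: (l2, r2) := nth ([::], [::]) rs j in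
  if drop (size l1 - k) l1 == take k l2 then
    let u := rewrite_pass rs (r1 ++ drop k l2) in
    let v := rewrite_pass rs (take (size l1 - k) l1 ++ r2) in
    rcons rs (if b then (v, u) else (u, v))
  else rs.

(** The presentation a^2 = b^3 = (a b)^n = 1, with a written [true] and b written [false]. *)
Definition von_dyck_rules n : seq (seq bool * seq bool) :=
  [:: ([:: true; true], [::]); ([:: false; false; false], [::]);
      (flatten (nseq n [:: true; false]), [::])].

(** Letters are prepended one at a time, so testing prefixes at each stage excludes left sides
    anywhere in the word; lengths run from 0 to [n - 1]. *)
Definition irreducible_words (rs : seq (seq bool * seq bool)) n :=
  flatten (traject (fun L => [seq w <- [seq x :: w | w <- L, x <- [:: true; false]] |
    all (fun r => ~~ prefix r.1 w) rs]) [:: [::]] n).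

Definition closed_words (rs : seq (seq bool * seq bool)) (L : seq (seq bool)) :=
  ([::] \in L) && all (fun w => all (fun x => rewrite_pass rs (rcons w x) \in L) [:: true; false]) L.

Section Congruence.
Variable eqv : seq bool -> seq bool -> Prop.
Hypothesis eqv_refl : forall u, eqv u u.
Hypothesis eqv_sym : forall u v, eqv u v -> eqv v u.
Hypothesis eqv_trans : forall u v w, eqv u v -> eqv v w -> eqv u w.
Hypothesis eqv_cat : forall u u' v v', eqv u u' -> eqv v v' -> eqv (u ++ v) (u' ++ v').

Definition sound (rs : seq (seq bool * seq bool)) := forall r, r \in rs -> eqv r.1 r.2.

Lemma rewrite_head_sound rs w : sound rs -> eqv w (rewrite_head rs w).
Proof.
rewrite /rewrite_head; elim: rs => //= r rs ih h.
case: ifP => [|_]; last by apply: ih => r' hr'; apply: h; rewrite inE hr' orbT.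
by case/prefixP => t ->; rewrite drop_size_cat //; apply: eqv_cat => //; apply: h; rewrite inE eqxx.
Qed.

Lemma rewrite_pass_sound rs w : sound rs -> eqv w (rewrite_pass rs w).
Proof.
move=> h; elim: w => //= x u ih; apply: eqv_trans (rewrite_head_sound _ h).
exact: (eqv_cat (eqv_refl [:: x]) ih).
Qed.

Lemma add_rule_sound rs c : sound rs -> sound (add_rule rs c).
Proof.
case: c => [[[i j] k] b] h; rewrite /add_rule.
have hi a : eqv (nth ([::], [::]) rs a).1 (nth ([::], [::]) rs a).2.
  have [ar|ar] := ltnP a (size rs); first by apply: h; exact: mem_nth.
  by rewrite nth_default.
case: (nth _ rs i) (hi i) => l1 r1 /= h1; case: (nth _ rs j) (hi j) => l2 r2 /= h2.
case: eqP => // e.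
have key : eqv (r1 ++ drop k l2) (take (size l1 - k) l1 ++ r2).
  apply: (eqv_trans (eqv_cat (eqv_sym h1) (eqv_refl _))).
  by rewrite -{1}(cat_take_drop (size l1 - k) l1) -catA e cat_take_drop; exact: eqv_cat.
have k2 := eqv_trans (eqv_sym (rewrite_pass_sound _ h)) (eqv_trans key (rewrite_pass_sound _ h)).
move=> r; rewrite mem_rcons inE => /orP[/eqP ->|/h //].
by case: b => //=; exact: eqv_sym.
Qed.

(** A letter appended to a representative reduces to another representative. *)
Lemma closed_words_exhaust rs L : sound rs -> closed_words rs L ->
  forall w, exists2 u, u \in L & eqv w u.
Proof.
move=> h /andP[L0 hL]; elim/last_ind => [|w x [u uL e]]; first by exists [::].
have /allP := hL; move=> /(_ u uL) /allP /(_ x); rewrite !inE => /(_ _) hx.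
exists (rewrite_pass rs (rcons u x)); first by apply: hx; case: (x).
apply: eqv_trans (rewrite_pass_sound _ h); rewrite -!cats1; exact: eqv_cat.
Qed.

(** The tetrahedral, octahedral and icosahedral cases. The steps in [cert] add only sound rules;
    that the irreducible words of length at most 12 are closed is then a computation. *)
Lemma von_dyck_finite n : (3 <= n <= 5)%N -> sound (von_dyck_rules n) ->
  exists L : seq (seq bool), forall w, exists2 u, u \in L & eqv w u.
Proof.
pose cert := match n with
  | 3 => [:: (2, 1, 1, true); (3, 0, 1, true); (0, 4, 1, true); (0, 3, 1, false); (1, 6, 1, true)]
  | 4 => [:: (2, 1, 1, true); (3, 0, 1, true); (0, 4, 1, false); (4, 1, 1, false); (5, 6, 1, true)]
  | _ => [:: (2, 1, 1, true); (3, 0, 1, true); (4, 1, 1, true); (0, 5, 1, false);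
             (5, 0, 1, false); (7, 6, 2, true); (4, 7, 1, true); (0, 9, 1, false); (7, 10, 2, true)]
  end%N.
move=> hn h; pose rs := foldl add_rule (von_dyck_rules n) cert.
have hrs : sound rs.
  rewrite /rs; elim: (cert) (von_dyck_rules n) h => //= c cs ih r0 h'.
  by apply: ih; exact: add_rule_sound.
exists (irreducible_words rs 13).
apply: closed_words_exhaust hrs _; rewrite {}/rs {}/cert {h}.
have hn' : (n = 3 \/ n = 4 \/ n = 5)%N by move: hn; lia.
by move: hn' => [->|[->|->]]; vm_compute.
Qed.

End Congruence.
End Words.

(** * Spherical triples of local monodromies *)

Section Spherical.
Variable R : realType.
Local Notation C := R[i].
Implicit Types (A B M : 'M[C]_2).

(** On invertible matrices this is equality in PGL(2, C). *)
Definition peq A B := exists2 c : C, c != 0 & A = c *: B.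

Lemma peq_refl A : peq A A.
Proof. by exists 1; rewrite ?oner_neq0 // scale1r. Qed.

Lemma peq_sym A B : peq A B -> peq B A.
Proof. by move=> [c c0 ->]; exists c^-1; rewrite ?invr_eq0 // scalerA mulVf // scale1r. Qed.

Lemma peq_trans A B M : peq A B -> peq B M -> peq A M.
Proof. by move=> [c c0 ->] [d d0 ->]; exists (c * d); rewrite ?mulf_neq0 // scalerA. Qed.

Lemma peqM A A' B B' : peq A A' -> peq B B' -> peq (A *m B) (A' *m B').
Proof.
move=> [c c0 ->] [d d0 ->]; exists (c * d); first by rewrite mulf_neq0.
by rewrite -scalemxAl -scalemxAr scalerA.
Qed.

Lemma peq_unit A B : peq A B -> B \in unitmx -> A \in unitmx.
Proof. by move=> [c c0 ->] u; rewrite unitmxZ // unitfE. Qed.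

Lemma peq1P A : A \in unitmx -> reflect (peq A 1%:M) (is_scalar_mx A).
Proof.
move=> u; apply: (iffP idP) => [/is_scalar_mxP[c e]|[c _ ->]].
  exists c; last by rewrite e scalemx1.
  by apply: contraTneq u => c0; rewrite e c0 raddf0 unitmxE det0 unitr0.
by rewrite scalemx1 scalar_mx_is_scalar.
Qed.

Lemma peqV A B : B \in unitmx -> peq A B -> peq (invmx A) (invmx B).
Proof.
move=> u [c c0 ->]; exists c^-1; first by rewrite invr_eq0.
by rewrite invmxZ // unitmxZ // unitfE.
Qed.

Lemma peq_inv A B : B \in unitmx -> peq (A *m B) 1%:M -> peq A (invmx B).
Proof.
move=> u [c c0 e]; exists c => //.
by rewrite -[LHS](mulmxK u) e -scalemxAl mul1mx.
Qed.

(* The generated group contains all the scalars, so that only the classes of A, B, M in PGL matter. *)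
Definition gen3 A B M : 'M[C]_2 -> Prop :=
  fun X => [\/ peq X A, peq X B, peq X M | peq X 1%:M].

Lemma gen3_unit A B M X : A \in unitmx -> B \in unitmx -> M \in unitmx -> gen3 A B M X -> X \in unitmx.
Proof. by move=> a b c [] h; apply: (peq_unit h) => //; exact: unitmx1. Qed.

(** Modulo scalars [M] is the inverse of A B, so a property stable under products and scalars need
    only be checked on A, B and their inverses. *)
Lemma gen3_ind A B M (S : 'M[C]_2 -> Prop) : A \in unitmx -> B \in unitmx -> peq (A *m B *m M) 1%:M ->
  M \in unitmx ->
  S 1%:M -> (forall X Y, S X -> S Y -> S (X *m Y)) -> (forall X Y, peq X Y -> S Y -> S X) ->
  S A -> S (invmx A) -> S B -> S (invmx B) -> forall X, mxgen (gen3 A B M) X -> S X.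
Proof.
move=> a b h m S1 SM Sp SA SA' SB SB'.
have hM : peq M (invmx B *m invmx A).
  have ab : A *m B \in unitmx by rewrite unitmx_mul a b.
  have := peqM (peq_refl (invmx (A *m B))) h; rewrite mulKmx // mulmx1.
  by rewrite invmx_mul.
have SMM : S M by apply: (Sp _ _ hM); exact: SM.
have SMV : S (invmx M).
  apply: (Sp _ (A *m B)); last exact: SM.
  by apply/peq_sym/peq_inv.
move=> X; elim=> [|Y Z _ hY _ hZ|Y|Y]; [exact: S1|exact: SM| |]; case=> hY.
- exact: (Sp _ _ hY).
- exact: (Sp _ _ hY).
- exact: (Sp _ _ hY).
- exact: (Sp _ _ hY).
- exact: (Sp _ _ (peqV a hY)).
- exact: (Sp _ _ (peqV b hY)).
- exact: (Sp _ _ (peqV m hY)).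
by apply: (Sp _ 1%:M) => //; rewrite -[1%:M in X in peq _ X]invmx1; exact: (peqV (unitmx1 _ _) hY).
Qed.

Lemma sq_inv A : A \in unitmx -> is_scalar_mx (A ^+ 2) -> peq (invmx A) A.
Proof.
move=> a; rewrite expr2 => /peq1P h; apply/peq_sym/peq_inv => //; apply: h.
by rewrite unitmx_mul a.
Qed.

(** Modulo scalars A and B are involutions that conjugate [M] to its inverse, so every X in the
    group conjugates [M] to a multiple of [M] or of its inverse; only finitely many multiples
    occur. *)
Lemma dihedral_covered A B M : A \in unitmx -> B \in unitmx -> M \in unitmx ->
  ~ is_scalar_mx M -> peq (A *m B *m M) 1%:M ->
  is_scalar_mx (A ^+ 2) -> is_scalar_mx (B ^+ 2) -> covered (gen3 A B M).
Proof.
move=> a b m nM h a2 b2.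
pose S X := X \in unitmx /\ (peq (X *m M) (M *m X) \/ peq (X *m M) (invmx M *m X)).
have hAB : peq (A *m B) (invmx M) by exact: peq_inv.
have hBA : peq (B *m A) M.
  have e : invmx (invmx B *m invmx A) = A *m B by rewrite invmx_mul ?unitmx_inv // !invmxK.
  have u : invmx B *m invmx A \in unitmx by rewrite unitmx_mul !unitmx_inv a b.
  have h1 : peq (B *m A) (invmx B *m invmx A) by apply: peqM; apply/peq_sym/sq_inv.
  apply: (peq_trans h1); rewrite -[X in peq X]invmxK e -[X in peq _ X]invmxK.
  by apply: peqV => //; rewrite unitmx_inv.
have conj_inv X : X \in unitmx -> peq (X *m M) (invmx M *m X) -> peq (X *m invmx M) (M *m X).
  move=> x h1; have := peqM (peqM (peq_refl M) h1) (peq_refl (invmx M)).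
  by rewrite !mulmxA (mulmxV m) mul1mx (mulmxK m); exact: peq_sym.
have conj_same X : X \in unitmx -> peq (X *m M) (M *m X) -> peq (X *m invmx M) (invmx M *m X).
  move=> x h1; have := peqM (peqM (peq_refl (invmx M)) h1) (peq_refl (invmx M)).
  by rewrite !mulmxA (mulVmx m) mul1mx (mulmxK m); exact: peq_sym.
have AM : peq (A *m M) (invmx M *m A).
  have h1 : peq (A *m (B *m A)) (A *m M) by apply: peqM; [exact: peq_refl|].
  apply: (peq_trans (peq_sym h1)); rewrite mulmxA; apply: peqM => //; exact: peq_refl.
have BM : peq (B *m M) (invmx M *m B).
  have h1 : peq (B *m A *m B) (M *m B) by apply: peqM; [|exact: peq_refl].
  have h2 : peq (B *m invmx M) (M *m B).
    by apply: peq_trans h1; rewrite -mulmxA; apply: peqM; [exact: peq_refl|exact: peq_sym].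
  have := peqM (peqM (peq_refl (invmx M)) h2) (peq_refl M).
  by rewrite !mulmxA (mulVmx m) mul1mx (mulmxKV m); exact: peq_sym.
have hS : forall X, mxgen (gen3 A B M) X -> S X.
  apply: (gen3_ind a b h m).
  - by split; [exact: unitmx1|left; rewrite mul1mx mulmx1; exact: peq_refl].
  - move=> X Y [x hX] [y hY]; split; first by rewrite unitmx_mul x.
    have st Z T : peq (Y *m M) (Z *m Y) -> peq (X *m Z) (T *m X) -> peq (X *m Y *m M) (T *m (X *m Y)).
      move=> h1 h2; rewrite -mulmxA; apply: (peq_trans (peqM (peq_refl X) h1)).
      by rewrite mulmxA [T *m _]mulmxA; apply: peqM h2 (peq_refl Y).
    case: hY => hY; case: hX => hX.
    + by left; exact: st hY hX.
    + by right; exact: st hY hX.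
    + by right; apply: st hY _; exact: conj_same.
    + by left; apply: st hY _; exact: conj_inv.
  - move=> X Y hXY [y hY]; split; first exact: (peq_unit hXY).
    have st Z : peq (Y *m M) (Z *m Y) -> peq (X *m M) (Z *m X).
      move=> h1; apply: (peq_trans (peqM hXY (peq_refl M))); apply: (peq_trans h1).
      by apply: peqM; [exact: peq_refl|exact: peq_sym].
    by case: hY => hY; [left|right]; exact: st.
  - by split=> //; right.
  - split; first by rewrite unitmx_inv.
    right; apply: (peq_trans (peqM (sq_inv a a2) (peq_refl M))); apply: (peq_trans AM).
    by apply: peqM; [exact: peq_refl|apply/peq_sym/sq_inv].
  - by split=> //; right.
  split; first by rewrite unitmx_inv.
  right; apply: (peq_trans (peqM (sq_inv b b2) (peq_refl M))); apply: (peq_trans BM).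
  by apply: peqM; [exact: peq_refl|apply/peq_sym/sq_inv].
(* Comparing determinants restricts the factor to 1 or -1 in the first case and to D or -D in the
   second. *)
pose D := \det M; have D0 : D != 0 by rewrite -unitfE -unitmxE.
apply: (covered_intertwine nM (Xs := [:: M; - M; D *: invmx M; - D *: invmx M])) => X /hS[x].
have dx : \det X != 0 by rewrite -unitfE -unitmxE.
have detZ2 (c : C) (Y : 'M[C]_2) : \det (c *: Y) = c ^+ 2 * \det Y by rewrite detZ.
case=> -[c c0 e]; have := congr1 determinant e; rewrite detZ2 !det_mulmx.
  rewrite -/D mulrC -{1}[D * _]mul1r => /(mulIf (mulf_neq0 D0 dx)) /esym/eqP.
  rewrite -[1](expr1n _ 2) eqf_sqr => /orP[] /eqP ec; rewrite e ec.
    by exists M; rewrite ?inE ?eqxx // scale1r.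
  by exists (- M); rewrite ?inE ?eqxx ?orbT // scaleN1r mulNmx.
rewrite det_inv -/D mulrA mulrC => /(mulIf dx) h1.
have : c ^+ 2 = D ^+ 2 by rewrite [RHS]expr2 {1}h1 divfK.
move=> /eqP; rewrite eqf_sqr => /orP[] /eqP ec; rewrite e ec.
  by exists (D *: invmx M); rewrite ?inE ?eqxx ?orbT // -scalemxAl.
by exists (- D *: invmx M); rewrite ?inE ?eqxx ?orbT // -scalemxAl.
Qed.

Definition word_mx A B (w : seq bool) : 'M[C]_2 := foldr (fun x X => (if x then A else B) *m X) 1%:M w.

Lemma word_mx_cat A B u v : word_mx A B (u ++ v) = word_mx A B u *m word_mx A B v.
Proof. by elim: u => [|x u ih] /=; rewrite ?mul1mx // ih mulmxA. Qed.

Lemma word_mx_nseq A B (x : bool) n : word_mx A B (nseq n x) = (if x then A else B) ^+ n.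
Proof. by elim: n => [|n ih] //=; rewrite ih exprS. Qed.

Lemma word_mx_flatten A B n : word_mx A B (flatten (nseq n [:: true; false])) = (A *m B) ^+ n.
Proof. by elim: n => [|n ih] //=; rewrite ih exprS !mulmxA. Qed.

(** Modulo scalars A B is the inverse of [M], so A and B satisfy the von Dyck relations and finitely
    many words represent the group. *)
Lemma von_dyck_covered A B M n : A \in unitmx -> B \in unitmx -> M \in unitmx ->
  peq (A *m B *m M) 1%:M -> (3 <= n <= 5)%N ->
  is_scalar_mx (A ^+ 2) -> is_scalar_mx (B ^+ 3) -> is_scalar_mx (M ^+ n) -> covered (gen3 A B M).
Proof.
move=> a b m h hn a2 b3 mn.
have uA : forall k, A ^+ k \in unitmx by elim=> [|k ih]; rewrite ?unitmx1 // exprS unitmx_mul a.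
have uB : forall k, B ^+ k \in unitmx by elim=> [|k ih]; rewrite ?unitmx1 // exprS unitmx_mul b.
have uM : forall k, M ^+ k \in unitmx by elim=> [|k ih]; rewrite ?unitmx1 // exprS unitmx_mul m.
pose W := word_mx A B; pose eqv u v := peq (W u) (W v).
have uW w : W w \in unitmx.
  by elim: w => [|x w ih] /=; rewrite ?unitmx1 // unitmx_mul ih andbT; case: x.
have ABn : peq ((A *m B) ^+ n) 1%:M.
  have hAB : peq (A *m B) (invmx M) by exact: peq_inv.
  have h1 : peq ((A *m B) ^+ n) (invmx (M ^+ n)).
    elim: (n) => [|k ih]; first by rewrite !expr0 invmx1; exact: peq_refl.
    by rewrite exprSr [in invmx _]exprS invmx_mul //; apply: peqM.
  apply: (peq_trans h1); rewrite -[1%:M in X in peq _ X]invmx1.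
  by apply: peqV; [exact: unitmx1|apply/peq1P].
have hs : sound eqv (von_dyck_rules n).
  move=> r; rewrite !inE => /orP[|/orP[]] /eqP -> /=; rewrite /eqv /W.
  - by rewrite (word_mx_nseq A B true 2); apply/peq1P.
  - by rewrite (word_mx_nseq A B false 3); apply/peq1P.
  by rewrite word_mx_flatten.
have [L hL] := @von_dyck_finite eqv (fun u => peq_refl _) (fun u v => @peq_sym _ _)
  (fun u v w => @peq_trans _ _ _) (fun u u' v v' h1 h2 => ltac:(rewrite /eqv /W !word_mx_cat; exact: peqM)) n hn hs.
have hW : forall X, mxgen (gen3 A B M) X -> exists w, peq X (W w).
  apply: gen3_ind => //.
  - by exists [::]; exact: peq_refl.
  - by move=> X Y [u hu] [v hv]; exists (u ++ v); rewrite /W word_mx_cat; exact: peqM.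
  - by move=> X Y hXY [u hu]; exists u; exact: peq_trans hu.
  - by exists [:: true]; rewrite /W /= mulmx1; exact: peq_refl.
  - by exists [:: true]; rewrite /W /= mulmx1; exact: sq_inv.
  - by exists [:: false]; rewrite /W /= mulmx1; exact: peq_refl.
  exists [:: false; false]; rewrite /W /= mulmx1; apply/peq_sym/peq_inv => //.
  rewrite (_ : B *m B *m B = B ^+ 3); last by rewrite -mulmxA.
  exact/(peq1P (uB 3)).
apply: (@covered_finite _ _ [seq W w | w <- L]); first by move=> _ /mapP[w _ ->].
move=> X /hW[w hw]; have [u uL hu] := hL w; exists (W u); first exact: map_f.
by have [c _ ->] := peq_trans hw hu; exists c.
Qed.

(** For entries at least 2, the ordered forms (2, 2, r) and (2, 3, r) with r <= 5 to which 1/p + 1/q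
    + 1/r > 1 reduces by permutation. *)
Definition spherical0 (p q r : nat) := (p == 2) && ((q == 2) || ((q == 3) && (2 <= r <= 5)))%N.

Definition spherical p q r :=
  [|| spherical0 p q r, spherical0 q r p, spherical0 r p q,
      spherical0 p r q, spherical0 r q p | spherical0 q p r].

Lemma spherical0_covered A B M p q r : A \in unitmx -> B \in unitmx -> M \in unitmx ->
  ~ is_scalar_mx A -> ~ is_scalar_mx B -> ~ is_scalar_mx M -> peq (A *m B *m M) 1%:M ->
  ((p < 6)%N -> is_scalar_mx (A ^+ p)) -> ((q < 6)%N -> is_scalar_mx (B ^+ q)) ->
  ((r < 6)%N -> is_scalar_mx (M ^+ r)) -> spherical0 p q r -> covered (gen3 A B M).
Proof.
move=> a b m nA nB nM h hp hq hr; rewrite /spherical0 => /andP[/eqP e2]; rewrite e2 in hp.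
have sub (X Y Z X' Y' Z' : 'M[C]_2) : X' \in unitmx -> Y' \in unitmx -> Z' \in unitmx ->
    (forall T, gen3 X Y Z T -> gen3 X' Y' Z' T) -> covered (gen3 X' Y' Z') -> covered (gen3 X Y Z).
  move=> x y z hT; apply: covered_sub => T; first by move=> /hT; exact: mxgenG.
  exact: gen3_unit.
have rot : peq (M *m A *m B) 1%:M.
  have h1 := peq_inv m h; have := peqM (peq_refl M) h1; by rewrite mulmxA mulmxV.
move=> /orP[/eqP e|/andP[/eqP e3 hr']].
  by rewrite e in hq; apply: dihedral_covered => //; [exact: hp|exact: hq].
rewrite e3 in hq; have [r2|r2] := eqVneq r 2; last first.
  have h3 : (3 <= r <= 5)%N by move: hr' r2; clear; lia.
  have h6 : (r < 6)%N by move: h3; clear; lia.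
  exact: (von_dyck_covered a b m h h3 (hp isT) (hq isT) (hr h6)).
(* Orders (2, 3, 2) become (2, 2, 3) by rotation, which is the dihedral case. *)
rewrite r2 in hr; apply: (sub _ _ _ M A B) => //.
  by move=> T []; [constructor 2|constructor 3|constructor 1|constructor 4].
by apply: dihedral_covered => //; [exact: hr|exact: hp].
Qed.

(** Rotations preserve the relation A B M = 1 modulo scalars. Odd permutations are reached by
    inverses, as A^-1 M^-1 B^-1 is again scalar. *)
Lemma spherical_covered A B M p q r : A \in unitmx -> B \in unitmx -> M \in unitmx ->
  ~ is_scalar_mx A -> ~ is_scalar_mx B -> ~ is_scalar_mx M -> peq (A *m B *m M) 1%:M ->
  ((p < 6)%N -> is_scalar_mx (A ^+ p)) -> ((q < 6)%N -> is_scalar_mx (B ^+ q)) ->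
  ((r < 6)%N -> is_scalar_mx (M ^+ r)) -> spherical p q r -> covered (gen3 A B M).
Proof.
have rot (A' B' M' : 'M[C]_2) : M' \in unitmx -> peq (A' *m B' *m M') 1%:M -> peq (M' *m A' *m B') 1%:M.
  by move=> m h; have := peqM (peq_refl M') (peq_inv m h); rewrite mulmxA mulmxV.
have sub (X Y Z X' Y' Z' : 'M[C]_2) : X' \in unitmx -> Y' \in unitmx -> Z' \in unitmx ->
    (forall T, gen3 X Y Z T -> mxgen (gen3 X' Y' Z') T) -> covered (gen3 X' Y' Z') -> covered (gen3 X Y Z).
  by move=> x y z hT; apply: covered_sub => T; [exact: hT|exact: gen3_unit].
have inv (X : 'M[C]_2) : X \in unitmx -> ~ is_scalar_mx X -> ~ is_scalar_mx (invmx X).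
  by move=> x nX /is_scalar_mxP[c e]; apply: nX; rewrite -[X]invmxK e invmx_scalar scalar_mx_is_scalar.
have invX (X : 'M[C]_2) k : X \in unitmx -> ((k < 6)%N -> is_scalar_mx (X ^+ k)) ->
    (k < 6)%N -> is_scalar_mx (invmx X ^+ k).
  move=> x + hk => /(_ hk) /is_scalar_mxP[c e].
  suff -> : invmx X ^+ k = invmx (X ^+ k) by rewrite e invmx_scalar scalar_mx_is_scalar.
  have uX : forall j, X ^+ j \in unitmx by elim=> [|j ih]; rewrite ?unitmx1 // exprS unitmx_mul x.
  elim: (k) => [|j ih]; first by rewrite !expr0 invmx1.
  by rewrite exprSr [in RHS]exprS invmx_mul // ih.
have three (A' B' M' : 'M[C]_2) p' q' r' : A' \in unitmx -> B' \in unitmx -> M' \in unitmx ->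
    ~ is_scalar_mx A' -> ~ is_scalar_mx B' -> ~ is_scalar_mx M' -> peq (A' *m B' *m M') 1%:M ->
    ((p' < 6)%N -> is_scalar_mx (A' ^+ p')) -> ((q' < 6)%N -> is_scalar_mx (B' ^+ q')) ->
    ((r' < 6)%N -> is_scalar_mx (M' ^+ r')) ->
    [|| spherical0 p' q' r', spherical0 q' r' p' | spherical0 r' p' q'] -> covered (gen3 A' B' M').
  move=> a b m nA nB nM h hp hq hr /or3P[] hs; first exact: (spherical0_covered a b m nA nB nM h hp hq hr hs).
    apply: (sub _ _ _ B' M' A') => //.
      by move=> T hT; apply: mxgenG; case: hT; [constructor 3|constructor 1|constructor 2|constructor 4].
    exact: (spherical0_covered b m a nB nM nA (rot _ _ _ b (rot _ _ _ m h)) hq hr hp hs).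
  apply: (sub _ _ _ M' A' B') => //.
    by move=> T hT; apply: mxgenG; case: hT; [constructor 2|constructor 3|constructor 1|constructor 4].
  exact: (spherical0_covered m a b nM nA nB (rot _ _ _ m h) hr hp hq hs).
move=> a b m nA nB nM h hp hq hr hs.
have /orP[{}hs|{}hs] : [|| spherical0 p q r, spherical0 q r p | spherical0 r p q] ||
    [|| spherical0 p r q, spherical0 r q p | spherical0 q p r].
  by move: hs; rewrite /spherical -!orbA.
  exact: (three A B M p q r a b m nA nB nM h hp hq hr hs).
apply: (sub _ _ _ (invmx A) (invmx M) (invmx B)); rewrite ?unitmx_inv //.
  have gV X Y : peq Y X -> gen3 (invmx A) (invmx M) (invmx B) (invmx X) -> X \in unitmx ->
      mxgen (gen3 (invmx A) (invmx M) (invmx B)) Y.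
    move=> [c c0 ->] g x; rewrite -[X]invmxK -mul_scalar_mx; apply: mxgenM; last exact: mxgenV.
    by apply: mxgenG; constructor 4; exists c => //; rewrite scalemx1.
  move=> T [] hT.
  - by apply: (gV _ _ hT) => //; constructor 1; exact: peq_refl.
  - by apply: (gV _ _ hT) => //; constructor 3; exact: peq_refl.
  - by apply: (gV _ _ hT) => //; constructor 2; exact: peq_refl.
  by apply: mxgenG; constructor 4.
have k : peq (invmx A *m invmx M *m invmx B) 1%:M.
  have h1 := peqV (unitmx1 C 2) (rot _ _ _ b (rot _ _ _ m h)).
  move: h1; rewrite invmx1 !invmx_mul ?unitmx_mul ?b ?m // mulmxA => h1; exact: h1.
have [a' b' m'] : [/\ invmx A \in unitmx, invmx B \in unitmx & invmx M \in unitmx] by rewrite !unitmx_inv.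
exact: (three _ _ _ p r q a' m' b' (inv _ a nA) (inv _ m nM) (inv _ b nB) k
  (invX _ _ a hp) (invX _ _ m hr) (invX _ _ b hq) hs).
Qed.

End Spherical.

(** * Non-apparent singularities of a non-elementary equation *)

Section Points.
Variable R : realType.
Local Notation C := R[i].
Implicit Types (A : 'M[C]_2) (E : equation R).

Lemma mxprod_nonscalar (U : nat -> 'M[C]_2) n : (forall k, (k < n)%N -> U k \in unitmx) ->
  peq (mxprod U n) (foldl (fun X k => X *m U k) 1%:M [seq k <- iota 0 n | ~~ is_scalar_mx (U k)]).
Proof.
elim: n => [|n ih] hU; first exact: peq_refl.
have {}ih := ih (fun k kn => hU k (ltnW kn)).
rewrite -[in iota _ _]addn1 iotaD add0n cats1 filter_rcons /=.
case: ifPn => [_|]; first by rewrite foldl_rcons; exact: peqM ih (peq_refl _).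
rewrite negbK => /(peq1P (hU n (ltnSn n))) h; rewrite -[X in peq _ X]mulmx1; exact: peqM.
Qed.

Section Cyclic.
Variables (T : nat -> 'M[C]_2) (N : nat).
Hypothesis uT : forall k, (k < N)%N -> T k \in unitmx.

(** The local monodromies in order, index [N] standing for infinity; their product is 1. *)
Definition cyc k := if (k < N)%N then T k else invmx (mxprod T N).
Definition cyc_support := [seq k <- iota 0 N.+1 | ~~ is_scalar_mx (cyc k)].
Let P A := exists2 k, (k < N)%N & A = T k.

Lemma mxprod_unit : mxprod T N \in unitmx.
Proof.
suff h n : (n <= N)%N -> mxprod T n \in unitmx by exact: h.
by elim: n => [|n ih] nN; rewrite ?unitmx1 //= unitmx_mul uT // ih // ltnW.
Qed.

Lemma cyc_unit k : cyc k \in unitmx.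
Proof. by rewrite /cyc; case: ltnP => [/uT//|_]; rewrite unitmx_inv mxprod_unit. Qed.

Lemma cyc_support_prod : peq 1%:M (foldl (fun X k => X *m cyc k) 1%:M cyc_support).
Proof.
have := @mxprod_nonscalar cyc N.+1 (fun k _ => cyc_unit k).
suff -> : mxprod cyc N.+1 = 1%:M by [].
rewrite /= {2}/cyc ltnn; suff -> : mxprod cyc N = mxprod T N by rewrite mulmxV // mxprod_unit.
suff h n : (n <= N)%N -> mxprod cyc n = mxprod T n by exact: h.
by elim: n => //= n ih nN; rewrite ih ?[in LHS]/cyc ?nN // ltnW.
Qed.

Lemma cyc_nonsupport k : (k <= N)%N -> k \notin cyc_support -> peq (cyc k) 1%:M.
Proof.
by move=> kN; rewrite mem_filter mem_iota /= add0n ltnS kN andbT negbK => /(peq1P (cyc_unit k)).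
Qed.

Lemma cyc_support_nonscalar k : k \in cyc_support -> ~ is_scalar_mx (cyc k).
Proof. by rewrite mem_filter => /andP[/negP]. Qed.

Lemma commute_covered A : ~ is_scalar_mx A -> (forall k, (k < N)%N -> T k *m A = A *m T k) -> covered P.
Proof.
move=> nA h; apply: (covered_intertwine nA (Xs := [:: A])) => M hM; exists A; first by rewrite inE.
elim: hM => [|X Y _ hX _ hY|X [k kN ->]|X [k kN ->]].
- by rewrite mul1mx mulmx1.
- by rewrite -mulmxA hY mulmxA hX mulmxA.
- exact: h.
have u := uT kN; apply: (can_inj (mulKmx u)); rewrite mulmxA (mulmxV u) mul1mx.
by rewrite mulmxA h // (mulmxK u).
Qed.

(** Without non-scalar factors all generators are scalar; a single one is impossible, the product
    being 1; two are inverse to each other modulo scalars, so everything commutes with the first. *)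
Lemma few_covered : (size cyc_support <= 2)%N -> covered P.
Proof.
have hT k : (k < N)%N -> T k = cyc k by rewrite /cyc => ->.
have hs A X : peq X 1%:M -> X *m A = A *m X.
  by move=> [c _ ->]; rewrite -scalemxAl -scalemxAr mul1mx mulmx1.
move=> sJ; have hp := cyc_support_prod; have hn := cyc_support_nonscalar.
case e : cyc_support sJ hp hn => [|i [|j [|//]]] /= _ hp hn.
- apply: (@commute_covered (delta_mx 0 1)).
    by move=> /is_scalar_mxP[c] /matrixP /(_ 0 1); rewrite !mxE /= => /eqP; rewrite oner_eq0.
  by move=> k kN; rewrite hT //; apply: hs; apply: cyc_nonsupport; [exact: ltnW|rewrite e].
- exfalso; apply: (hn i); first by rewrite inE.
  by apply/(peq1P (cyc_unit i))/peq_sym; rewrite mul1mx in hp.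
rewrite mul1mx in hp; apply: (@commute_covered (cyc i)); first by apply: hn; rewrite inE eqxx.
move=> k kN; rewrite hT //; have [kJ|kJ] := boolP (k \in cyc_support); last first.
  by apply: hs; apply: cyc_nonsupport => //; exact: ltnW.
move: kJ; rewrite e !inE => /orP[] /eqP -> //.
have [c c0 ec] := peq_inv (cyc_unit j) (peq_sym hp).
by rewrite ec -scalemxAl -scalemxAr mulmxV ?mulVmx // cyc_unit.
Qed.

Lemma three_covered i j k p q r : cyc_support = [:: i; j; k] ->
  ((p < 6)%N -> is_scalar_mx (cyc i ^+ p)) -> ((q < 6)%N -> is_scalar_mx (cyc j ^+ q)) ->
  ((r < 6)%N -> is_scalar_mx (cyc k ^+ r)) -> spherical p q r -> covered P.
Proof.
move=> e hp hq hr hs; have hn := cyc_support_nonscalar; have hP := cyc_support_prod.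
rewrite e /= mul1mx in hP; rewrite e in hn.
apply: (@covered_sub _ P (gen3 (cyc i) (cyc j) (cyc k))).
- move=> _ [l lN ->]; apply: mxgenG; have -> : T l = cyc l by rewrite /cyc lN.
  have [|lJ] := boolP (l \in cyc_support); last by constructor 4; apply: cyc_nonsupport => //; exact: ltnW.
  rewrite e !inE => /or3P[] /eqP ->; [constructor 1|constructor 2|constructor 3]; exact: peq_refl.
- by move=> X; apply: gen3_unit; exact: cyc_unit.
apply: (@spherical_covered _ (cyc i) (cyc j) (cyc k) p q r) => //; try (exact: cyc_unit); last exact: peq_sym.
- by apply: hn; rewrite !inE eqxx.
- by apply: hn; rewrite !inE eqxx orbT.
- by apply: hn; rewrite !inE eqxx !orbT.
Qed.

End Cyclic.

(* 6 stands for an infinite order: only the orders at most 5 are ever used from above. *)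
Lemma projective_order A : exists p : nat,
  [/\ forall e, (0 < e)%N -> is_scalar_mx (A ^+ e) -> (p <= e)%N,
      (p < 6)%N -> is_scalar_mx (A ^+ p) & ~ is_scalar_mx A -> (1 < p)%N].
Proof.
have [[e he]|h] := pselect (exists e, (0 < e)%N && is_scalar_mx (A ^+ e)); last first.
  by exists 6; split=> // e e0 he; exfalso; apply: h; exists e; rewrite e0.
have ex : exists e, (0 < e)%N && is_scalar_mx (A ^+ e) by exists e.
exists (ex_minn ex); case: ex_minnP => p /andP[p0 hp] pmin; split=> //.
  by move=> k k0 hk; apply: pmin; rewrite k0.
by move=> nA; case: p p0 hp {pmin} => [|[|p]] // _; rewrite expr1 => /nA.
Qed.

Lemma local_monodromy_exists E c : exists A, local_monodromy E c A.
Proof.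
have [S [T [uS hS hT hI _]]] := global_monodromy E.
case: c => [z|]; last by exists (invmx (mxprod T (size S))).
have [zS|zS] := boolP (z \in S).
  exists (T (index z S)); have [] := hT (index z S); first by rewrite index_mem.
  by rewrite nth_index.
by have [|v [r [Gam D]]] := @ldat_regular R E z; [rewrite hS|exists 1%:M, v, r, Gam].
Qed.

Lemma nonelementary_points E : nonelementary E -> exists (S : seq (option C)) (p : option C -> nat),
  [/\ uniq S, forall c, nonapparent_singularities E c <-> c \in S,
   forall c, c \in S -> (1 < p c)%N /\ exists2 A, local_monodromy E c A &
     forall e, (0 < e)%N -> is_scalar_mx (A ^+ e) -> (p c <= e)%N,
   (2 < size S)%N & forall a b c, S = [:: a; b; c] -> ~~ spherical (p a) (p b) (p c)].
Proof.
move=> [b [f [ob sb dense]]]; have [S [T [uS hS hT hI hG]]] := global_monodromy E.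
have [D Du hD] := hG b f ob sb; set N := size S in hT hI hG hD.
have uT k : (k < N)%N -> T k \in unitmx by move=> /hT[].
have ncov : ~ covered (fun A => exists2 k, (k < N)%N & A = T k).
  by move=> /covered_nondense /(_ Du hD).
pose pt k : option C := if (k < N)%N then Some (nth 0 S k) else None.
pose idx (c : option C) := if c is Some z then index z S else N.
have idxK k : (k <= N)%N -> idx (pt k) = k.
  rewrite /pt /idx; case: ltnP => kN kN'; first by rewrite index_uniq.
  by apply/eqP; rewrite eqn_leq kN kN'.
have hpt k : (k <= N)%N -> local_monodromy E (pt k) (cyc T N k).
  by rewrite /pt /cyc; case: ltnP => [/hT[]|].
have [po hpo] := choice projective_order.
pose J := cyc_support T N; have JN k : k \in J -> (k <= N)%N.
  by rewrite mem_filter mem_iota add0n ltnS => /andP[_ /andP[]].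
have nap k : (k <= N)%N -> nonapparent_singularities E (pt k) <-> k \in J.
  move=> kN; rewrite mem_filter mem_iota add0n ltnS kN !andbT.
  by split=> [/(nonapparent_local_monodromy (hpt k kN)) /negP|/negP h]; [|apply/(nonapparent_local_monodromy (hpt k kN))].
have injpt : {in J &, injective pt} by move=> j k /JN jN /JN kN e; rewrite -(idxK j) // e idxK.
exists [seq pt k | k <- J], (fun c => po (cyc T N (idx c))); split.
- by rewrite map_inj_in_uniq // filter_uniq // iota_uniq.
- move=> c; split=> [h|/mapP[k kJ ->]]; last by apply/nap => //; exact: JN.
  have [k kN ec] : exists2 k, (k <= N)%N & c = pt k.
    case: c h => [z|] h; last by exists N => //; rewrite /pt ltnn.
    have [zS|zS] := boolP (z \in S).
      by exists (index z S); rewrite ?index_size // /pt index_mem zS nth_index.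
    exfalso; have rz : reg E z by rewrite hS.
    have [v [r [Gam hl]]] := ldat_regular rz.
    have hm : local_monodromy E (Some z) 1%:M by exists v, r, Gam.
    by move/(nonapparent_local_monodromy hm): h; apply; exact: scalar_mx_is_scalar.
  by rewrite ec; apply: map_f; apply/nap => //; rewrite -ec.
- move=> _ /mapP[k kJ ->]; rewrite idxK ?JN //; have [h1 h2 h3] := hpo (cyc T N k).
  split; first by apply: h3; exact: cyc_support_nonscalar kJ.
  by exists (cyc T N k); [exact: hpt (JN k kJ)|].
- by rewrite size_map ltnNge; apply/negP => /(few_covered uT) /ncov.
move=> a0 b0 c0 e; apply/negP => hs; apply: ncov.
case eJ : J e => [|i [|j [|k [|//]]]] //= -[ea eb ec].
have mJ l : l \in [:: i; j; k] -> (l <= N)%N by rewrite -eJ => /JN.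
rewrite -ea -eb -ec !idxK ?mJ ?inE ?eqxx ?orbT // in hs.
apply: (three_covered uT eJ _ _ _ hs); first by have [] := hpo (cyc T N i).
  by have [] := hpo (cyc T N j).
by have [] := hpo (cyc T N k).
Qed.

End Points.

(** * Counting points in the fibres *)

Section Counting.

(** The solutions of 1/P + 1/Q + 1/T = 1; their largest entry 6 is the source of the bound n < 7. *)
Definition euclidean_triples : seq (nat * nat * nat) :=
  [:: (2, 3, 6); (2, 6, 3); (3, 2, 6); (3, 6, 2); (6, 2, 3); (6, 3, 2);
      (2, 4, 4); (4, 2, 4); (4, 4, 2); (3, 3, 3)]%N.

(** No Euclidean entry exceeds 6, so only entries up to 5 have to be told apart. *)
Lemma nonspherical_dominates (p q r : nat) : (1 < p)%N -> (1 < q)%N -> (1 < r)%N -> ~~ spherical p q r ->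
  has (fun t => [&& t.1.1 <= p, t.1.2 <= q & t.2 <= r]%N) euclidean_triples.
Proof.
by case: p => [|[|[|[|[|[|p]]]]]] //; case: q => [|[|[|[|[|[|q]]]]]] //;
   case: r => [|[|[|[|[|[|r]]]]]].
Qed.

(* Dividing the three inequalities by a Euclidean triple P, Q, T dominated by p, q, r, for *)
(* which 1/P + 1/Q + 1/T = 1, gives n1/P + n2/Q + n3/T <= 1.                               *)
Lemma three_points_bound (d p q r k1 k2 k3 n1 n2 n3 : nat) :
  (1 < p)%N -> (1 < q)%N -> (1 < r)%N -> ~~ spherical p q r ->
  (n1 + k1 * p <= d)%N -> (n2 + k2 * q <= d)%N -> (n3 + k3 * r <= d)%N ->
  (d <= 1 + (k1 + (k2 + k3)))%N -> (n1 + (n2 + n3) < 7)%N.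
Proof.
move=> hp hq hr /(nonspherical_dominates hp hq hr)/hasP[[[P Q] T] hPQT /and3P[Pp Qq Tr]] h1 h2 h3 h.
have {Pp}h1 : (n1 + k1 * P <= d)%N by apply: leq_trans h1; rewrite leq_add2l leq_mul2l Pp orbT.
have {Qq}h2 : (n2 + k2 * Q <= d)%N by apply: leq_trans h2; rewrite leq_add2l leq_mul2l Qq orbT.
have {Tr}h3 : (n3 + k3 * T <= d)%N by apply: leq_trans h3; rewrite leq_add2l leq_mul2l Tr orbT.
move: h1 h2 h3 h hPQT {hp hq hr}; rewrite !inE.
move=> h1 h2 h3 h; do 9?[case/orP]; move=> /eqP[eP eQ eT]; rewrite {}eP in h1; rewrite {}eQ in h2; rewrite {}eT in h3; lia.
Qed.

(** Eliminating K gives n <= (4 - m) d + 2 <= 2. *)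
Lemma four_points_bound (m d K n : nat) : (3 < m)%N ->
  (n + K * 2 <= m * d)%N -> (m * d <= d.*2 + 1 + K)%N -> (n < 7)%N.
Proof. by move=> m4 h1 h2; have h : (4 * d <= m * d)%N; [rewrite leq_mul2r m4 orbT|lia]. Qed.

Variable R : realType.

Lemma seq_card (T : choiceType) (A : set T) (L : seq T) n : uniq L -> (forall x, A x <-> x \in L) ->
  (A #= `I_n)%card -> size L = n.
Proof.
move=> uL hL /card_fset_set <-.
have fA : finite_set A.
  rewrite (_ : A = [set x | x \in L]); first exact: finite_seq.
  by apply/seteqP; split=> x /hL.
apply/perm_size/uniq_perm => //.
by move=> x; rewrite in_fset_set //; apply/idP/idP => [/hL h|/set_mem/hL //]; exact: mem_set.
Qed.

Lemma inj_seq (T : choiceType) (B : set T) k : (`I_k #<= B)%card ->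
  exists F : seq T, [/\ uniq F, size F = k & forall x, x \in F -> B x].
Proof.
move=> /card_subP[D Dk DB].
exists (finmap.enum_fset (fset_set D)); split; [exact: finmap.fset_uniq|exact: card_fset_set|].
have fD : finite_set D by apply/finite_setP; exists k.
by move=> x xD; apply: DB; apply: set_mem; rewrite -in_fset_set.
Qed.

Lemma pullback_bound (E : equation R) (f : ratfun R) n : nonelementary E -> ramified_covering f ->
  (nonapparent_singularities (pullback f E) #= `I_n)%card ->
  (`I_(n - 3) #<= [set c | ramifies_over f c /\ ~ nonapparent_singularities E c])%card ->
  (n < 7)%N.
Proof.
move=> nE nf hn hfree; rewrite ltnNge; apply/negP => n7.
have [S [p [uS hS hp S3 hsph]]] := nonelementary_points nE.
have [fib hfib] := choice (fun c => fiber_seq c nf).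
have [F [uF sF hF]] := inj_seq hfree.
pose d := fdegree f; pose NA x := `[< nonapparent_singularities (pullback f E) x >].
pose nn c := count NA (fib c); pose kk c := count (predC NA) (fib c).
have szE c : size (fib c) = (nn c + kk c)%N by rewrite /nn /kk count_predC.
have hm c x : x \in fib c -> (0 < fiber_mult f c x)%N.
  by have [_ h _] := hfib c; rewrite h fiber_mult_gt0.
(* Over [c] a non-apparent point takes at least 1 of the total multiplicity d, an apparent one at
   least [p c]. *)
have hd c : c \in S -> (nn c + kk c * p c <= d)%N.
  move=> /hp[_ [A hA hAp]]; have [_ _ es] := hfib c; rewrite /d -es.
  have step x : x \in fib c -> ((if NA x then 1 else p c) <= fiber_mult f c x)%N.
    move=> /hm e0; case: ifPn => // /asboolPn hx; apply: hAp => //.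
    by apply: contrapT => h; apply: hx; apply/(nonapparent_pullback nf hA).
  have : (\sum_(x <- fib c) (if NA x then 1 else p c) <= \sum_(x <- fib c) fiber_mult f c x)%N.
    by rewrite big_seq [leqRHS]big_seq; apply: leq_sum => x; exact: step.
  apply: leq_trans; rewrite /nn /kk; elim: (fib c) => [|x s ih] /=; first by rewrite big_nil.
  by rewrite big_cons; case: (NA x) => /=; move: ih; lia.
(* Away from [S] the local monodromy is scalar and so are its powers; hence all non-apparent points
   of the pullback lie over [S]. *)
have nS c x : c \notin S -> x \in fib c -> ~~ NA x.
  move=> cS /hm e0; have [A hA] := local_monodromy_exists E c; apply/asboolPn.
  move=> /(nonapparent_pullback nf hA e0); apply.
  have sA : is_scalar_mx A.
    by apply: contraT => h; case/negP: cS; apply/hS/(nonapparent_local_monodromy hA)/negP.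
  have /is_scalar_mxP[a ->] := sA.
  elim: (fiber_mult f c x) => [|k ih]; first by rewrite expr0; exact: scalar_mx_is_scalar.
  by have /is_scalar_mxP[b e] := ih; rewrite exprS e (_ : _ * _ = (a * b)%:M) ?scalar_mx_is_scalar // scalar_mxM.
have en : (\sum_(c <- S) nn c)%N = n.
  pose L := flatten [seq [seq x <- fib c | NA x] | c <- S].
  have -> : (\sum_(c <- S) nn c)%N = size L.
    rewrite /L size_flatten /shape -map_comp sumnE big_map; apply: eq_bigr => c _.
    by rewrite /= size_filter.
  apply: seq_card hn.
    rewrite /L; elim: (S) uS => //= c s ih /andP[cs /ih h]; rewrite cat_uniq h andbT.
    have [ufc hc _] := hfib c; rewrite filter_uniq //=; apply/hasPn => x /flattenP[_ /mapP[c' hc' ->]].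
    have [_ hc2 _] := hfib c'; rewrite !mem_filter hc2 hc => /andP[_ /eqP e]; rewrite -e in hc'.
    by rewrite negb_and; apply/orP; right; apply: contraNneq cs => <-.
  move=> x; split=> [hx|/flattenP[_ /mapP[c hc ->]]]; last by rewrite mem_filter => /andP[/asboolP].
  have [_ hc _] := hfib (cval f x).
  have xf : x \in fib (cval f x) by rewrite hc.
  have hNA : NA x by apply/asboolP.
  apply/flattenP; exists [seq y <- fib (cval f x) | NA y]; last by rewrite mem_filter hNA.
  by apply: map_f; apply: contraLR hNA => cS; exact: nS xf.
have uSF : uniq (S ++ F).
  rewrite cat_uniq uS uF andbT; apply/hasPn => c /hF[_ hc]; apply/negP => /= cS.
  by apply: hc; apply/hS.
have rh := riemann_hurwitz nf uSF hfib; rewrite big_cat /= in rh.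
(* Over a ramified value the fibre has fewer than d points, so each free branch value contributes at
   least 1. *)
have sizeF : (n - 3 <= \sum_(c <- F) (fdegree f - size (fib c)))%N.
  rewrite -sF -sum1_size big_seq [leqRHS]big_seq; apply: leq_sum => c /hF[[x hx] _].
  have [ufc hc es] := hfib c.
  have xf : x \in fib c by rewrite hc -fiber_mult_gt0 // ltnW.
  rewrite subn_gt0 -es -sum1_size !(big_rem x xf) /=.
  rewrite -addSn leq_add // big_seq [leqRHS]big_seq; apply: leq_sum => y /mem_rem; exact: hm.
have szd c : (size (fib c) <= d)%N.
  have [_ _ es] := hfib c; rewrite /d -es -sum1_size big_seq [leqRHS]big_seq; apply: leq_sum => y; exact: hm.
have sizeS : (\sum_(c <- S) (d - size (fib c)) + (n + \sum_(c <- S) kk c) = size S * d)%N.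
  rewrite -en -!big_split /= -sum1_size big_distrl /=; apply: eq_bigr => c _.
  by rewrite -szE subnK // mul1n.
have hS2 : (n + (\sum_(c <- S) kk c) * 2 <= size S * d)%N.
  rewrite -en big_distrl -big_split /= -sum1_size big_distrl /= big_seq [leqRHS]big_seq.
  apply: leq_sum => c cS; rewrite mul1n; apply: leq_trans (hd c cS).
  by rewrite leq_add2l leq_mul2l; have [-> _] := hp c cS; rewrite orbT.
have d0 : (0 < d)%N := nf.
(* Riemann-Hurwitz over [S] and [F]: the deficits over [S] are at most 2d - 2 - (n - 3), and adding
   the n non-apparent and K apparent points gives 2d + 1 + K. *)
have main : (size S * d <= d.*2 + 1 + \sum_(c <- S) kk c)%N.
  rewrite -sizeS; move: (rh) sizeF d0 n7; rewrite -/d.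
  have aux (u v w e : nat) : (u + v <= e.*2 - 2 -> n - 3 <= v -> 0 < e -> 6 < n ->
    u + (n + w) <= e.*2 + 1 + w)%N by clear; lia.
  exact: aux.
have [m4|m3] := ltnP 3 (size S).
  by have := four_points_bound m4 hS2 main; rewrite ltnNge n7.
case: (S) S3 m3 hsph hp hd main en => [|a [|b [|c [|//]]]] //= _ _ hsph hp hd main en.
have [pa _] : (1 < p a)%N /\ _ := hp a ltac:(by rewrite !inE eqxx).
have [pb _] : (1 < p b)%N /\ _ := hp b ltac:(by rewrite !inE eqxx orbT).
have [pc _] : (1 < p c)%N /\ _ := hp c ltac:(by rewrite !inE eqxx !orbT).
have h3 : (d <= 1 + (kk a + (kk b + kk c)))%N.
  by move: main; rewrite !big_cons big_nil addn0; move: (kk a) (kk b) (kk c) (d); lia.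
have hda : (nn a + kk a * p a <= d)%N by apply: hd; rewrite !inE eqxx.
have hdb : (nn b + kk b * p b <= d)%N by apply: hd; rewrite !inE eqxx orbT.
have hdc : (nn c + kk c * p c <= d)%N by apply: hd; rewrite !inE eqxx !orbT.
have := three_points_bound pa pb pc (hsph a b c erefl) hda hdb hdc h3.
by move: en; rewrite !big_cons big_nil addn0 => ->; rewrite ltnNge n7.
Qed.

End Counting.

Local Close Scope complex_scope.
Local Close Scope ring_scope.
Local Open Scope card_scope.
Local Open Scope classical_set_scope.

Theorem mainTheorem11 (R : realType) (n : nat) (hn : (7 <= n)%N) :
  ~ exists (E : equation R) (phi : ratfun R),
      [/\ fuchsian E,
          nonelementary E,
          ramified_covering phi,
          nonapparent_singularities (pullback phi E) #= `I_n &
          `I_(n - 3) #<= [set c : P1 R | ramifies_over phi c /\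
                                         ~ nonapparent_singularities E c]].
Proof.
move=> [E [phi [_ nE rphi hn' hfree]]].
by have := pullback_bound nE rphi hn' hfree; rewrite ltnNge hn.
Qed.
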